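(* Let $n\ge1$ and let $(M,\nabla,P)$ be an infinitesimally homogeneous affine manifold with structure group $G=\operatorname{U}(n)\times\{1\}$. Then its torsion characteristic tensor is uniquely determined by $\tau_1,\tau_2,\tau_3\in\mathbb R$ through $$T_0(X,Y)=\tau_3\,\omega_0(X,Y)e,\qquad T_0(X,e)=\tau_1X+\tau_2J_0X,\qquad X,Y\in H_0.$$ Its symmetrized connection $\nabla^s=\nabla-\frac12T$ is torsion-free and $(M,\nabla^s,P)$ is infinitesimally homogeneous. Consequently, with inner torsion parameters $(a^s,b^s,\alpha^s,\beta^s,\gamma^s,\delta^s)$, curvature coefficients $c_0^s,\dots,c_4^s$ and horizontal curvature block $B^s$, and with $P^s(X)=\alpha^sX+\beta^sJ_0X$, $Q^s(X)=\gamma^sX+\delta^sJ_0X$, the connection $\nabla^s$ belongs to exactly one of the following torsion-free families: (1) (compatible family) $a^s=b^s=\alpha^s=\beta^s=\gamma^s=\delta^s=0$, $c_0^s=\dots=c_4^s=0$, $B^s=\kappa^sK$ with $\kappa^s\in\mathbb R$; (2) (non-compatible branch $a^s=\alpha^s$) $(a^s,b^s,\alpha^s,\beta^s,\gamma^s,\delta^s)\ne0$, $a^s=\alpha^s$, $c_1^s=a^s(b^s-a^s)+(\beta^s)^2$, $c_2^s=\beta^s(b^s-2a^s)$, $c_3^s=(a^s-b^s)\gamma^s+\beta^s\delta^s$, $c_4^s=(a^s-b^s)\delta^s-\beta^s\gamma^s$, $c_0^s=2c_4^s$, and for some $\kappa^s\in\mathbb R$ $$B^s(X,Y)Z=h_0(Q^s(Y),Z)P^s(X)-h_0(Q^s(X),Z)P^s(Y)-2a^s\delta^s\omega_0(X,Y)Z-2\beta^s\delta^s\omega_0(X,Y)J_0Z+\kappa^sK_{X,Y}Z;$$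 (3) (complementary branch) $a^s\neq\alpha^s$, $\delta^s=0$, $c_1^s=-(\alpha^s)^2+b^s\alpha^s+(\beta^s)^2$, $c_2^s=\beta^s(b^s-2\alpha^s)$, $c_3^s=(2a^s-\alpha^s-b^s)\gamma^s$, $c_4^s=-\beta^s\gamma^s$, $c_0^s=-2\beta^s\gamma^s$, and $$B^s(X,Y)Z=\gamma^s\bigl(h_0(Y,Z)P^s(X)-h_0(X,Z)P^s(Y)\bigr).$$ Conversely, $\nabla=\nabla^s+\frac12T$, and its inner torsion parameters $(a,b,\alpha,\beta,\gamma,\delta)$ and its curvature characteristic tensor (with coefficients $c_0,\dots,c_4$ and block $B$) are determined by $$a=a^s-\tfrac{\tau_1}2,\quad b=b^s,\quad \alpha=\alpha^s+\tfrac{\tau_1}2,\quad \beta=\beta^s+\tfrac{\tau_2}2,\quad \gamma=\gamma^s,\quad \delta=\delta^s+\tfrac{\tau_3}2,$$ $$c_1=c_1^s+\tfrac12b^s\tau_1+\tfrac14(\tau_1^2-\tau_2^2),\qquad c_2=c_2^s+\tfrac12b^s\tau_2+\tfrac12\tau_1\tau_2,$$ $$c_3=c_3^s-\tfrac12\gamma^s\tau_1-\tfrac12\delta^s\tau_2+\tfrac12\beta^s\tau_3-\tfrac14\tau_2\tau_3,$$ $$c_4=c_4^s-\tfrac12\delta^s\tau_1+\tfrac12\gamma^s\tau_2+\Bigl(a^s-\tfrac{\alpha^s+b^s}2\Bigr)\tau_3-\tfrac14\tau_1\tau_3,$$ $$c_0=c_0^s+\delta^s\tau_1-\gamma^s\tau_2+\alpha^s\tau_3+\tfrac12\tau_1\tau_3,$$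 $$\begin{aligned}B(X,Y)Z={}&B^s(X,Y)Z+\tfrac{\tau_3}2\bigl(\omega_0(Y,Z)P(X)-\omega_0(X,Z)P(Y)\bigr)+\delta^s\omega_0(X,Y)P_0(Z)\\&-\tfrac12h_0(Q^s(X),Z)P_0(Y)+\tfrac12h_0(Q^s(Y),Z)P_0(X),\end{aligned}$$ where $P_0(X)=\tau_1X+\tau_2J_0X$ and $P(X)=P^s(X)+\frac12P_0(X)$. Therefore these formulas, specialized to the families (1), (2) and (3) with arbitrary $\tau_1,\tau_2,\tau_3\in\mathbb R$, give an exhaustive description of the characteristic tensors of infinitesimally homogeneous affine manifolds with structure group $\operatorname{U}(n)\times\{1\}$ in the case of arbitrary torsion.
   Context: Let $V$ be a finite-dimensional real vector space and $G\subseteq\operatorname{GL}(V)$ a Lie subgroup with Lie algebra $\mathfrak g\subseteq\mathfrak{gl}(V)$. A $G$-structure on a smooth manifold $M$ with $\dim M=\dim V$ is a principal $G$-subbundle $P$ of the frame bundle $\operatorname{FR}(TM)$; elements $p\in P_x$ are linear isomorphisms $p:V\to T_xM$, and two frames in $P_x$ differ by right composition with an element of $G$. An affine manifold with $G$-structure is a triple $(M,\nabla,P)$ with $\nabla$ an affine connection on $M$ and $P$ a $G$-structure. Put $T(X,Y)=\nabla_XY-\nabla_YX-[X,Y]$ and $R(X,Y)=\nabla_X\nabla_Y-\nabla_Y\nabla_X-\nabla_{[X,Y]}$. Inner torsion: for a local section $s:U\to P$ define $\Lambda^s_x(u)\in\mathfrak{gl}(V)$ by $\nabla_{s(x)u}(s\,w)=s(x)(\Lambda^s_x(u)w)$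 for $u,w\in V$, where $s\,w$ is the vector field $x\mapsto s(x)w$. With $\mathfrak g_x=\operatorname{Ad}_p(\mathfrak g)$ for any $p\in P_x$ and $\overline{\operatorname{Ad}}_p:\mathfrak{gl}(V)/\mathfrak g\to\mathfrak{gl}(T_xM)/\mathfrak g_x$ induced by conjugation by $p$, the inner torsion is $\mathfrak I^P_x:T_xM\to\mathfrak{gl}(T_xM)/\mathfrak g_x$, $\mathfrak I^P_x(s(x)u)=\overline{\operatorname{Ad}}_{s(x)}(\Lambda^s_x(u)+\mathfrak g)$ (independent of $s$). $(M,\nabla,P)$ is infinitesimally homogeneous if there are linear maps $T_0:\Lambda^2V\to V$, $R_0:\Lambda^2V\to\mathfrak{gl}(V)$, $\mathfrak I_0:V\to\mathfrak{gl}(V)/\mathfrak g$ (the characteristic tensors) with $T_x(pu,pv)=p\,T_0(u,v)$, $R_x(pu,pv)pw=p\,R_0(u,v)w$, $\mathfrak I^P_x(pu)=\overline{\operatorname{Ad}}_p(\mathfrak I_0(u))$ for all $x\in M$, $p\in P_x$, $u,v,w\in V$. A lift of $\mathfrak I_0$ is a linear map $\lambda:V\to\mathfrak{gl}(V)$ with $\mathfrak I_0(u)=\lambda(u)+\mathfrak g$. Here $V=H_0\oplus\mathbb Re$, where $H_0\simeq\mathbb R^{2n}$ has its standard Euclidean metric $h_0$, standard complex structure $J_0$ and $\omega_0(X,Y)=h_0(J_0X,Y)$. $G=\operatorname{U}(n)\times\{1\}\subset\operatorname{GL}(V)$ acts on $H_0$ by the standard real representation of $\operatorname{U}(n)$ and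 fixes $e$; $\mathfrak g=\mathfrak u(n)\oplus\{0\}$. Write $Z^\flat=h_0(Z,\cdot)$; matrices are with respect to $V=H_0\oplus\mathbb Re$. Inner torsion parameters: the characteristic inner torsion is $G$-equivariant and has a lift, with uniquely determined parameters $a,b,\alpha,\beta,\gamma,\delta\in\mathbb R$, $$\lambda(X+se)=\begin{pmatrix}as\,\operatorname{Id}_{H_0}&\alpha X+\beta J_0X\\(\gamma X+\delta J_0X)^\flat&bs\end{pmatrix},\quad X\in H_0,\ s\in\mathbb R.$$ Curvature coefficients $c_0,\dots,c_4\in\mathbb R$ and horizontal block $B\in\operatorname{Hom}_{\operatorname{U}(n)}(\Lambda^2H_0,\mathfrak{gl}(H_0))$: for $X,Y\in H_0$, $$R_0(X,e)=\begin{pmatrix}0&c_1X+c_2J_0X\\(c_3X+c_4J_0X)^\flat&0\end{pmatrix},\qquad R_0(X,Y)=\begin{pmatrix}B(X,Y)&0\\0&c_0\,\omega_0(X,Y)\end{pmatrix}.$$ A superscript $s$ denotes the corresponding quantities for $\nabla^s$. For $X,Y,Z\in H_0$, $$K_{X,Y}Z=\tfrac14\bigl(h_0(Y,Z)X-h_0(X,Z)Y+\omega_0(Y,Z)J_0X-\omega_0(X,Z)J_0Y-2\omega_0(X,Y)J_0Z\bigr).$$ *)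

(* Defs.v *)
From HB Require Import structures.
From mathcomp Require Import all_boot all_order all_algebra.
From mathcomp Require Import all_classical all_reals all_analysis.
Set Implicit Arguments.
Unset Strict Implicit.
Unset Printing Implicit Defensive.
Import Order.TTheory GRing.Theory Num.Theory.
Import numFieldNormedType.Exports.
Local Open Scope classical_set_scope.
Local Open Scope ring_scope.

(* Vectors are column vectors, endomorphisms and frames are matrices acting
   by left multiplication. *)

(* [Ck k U f]: on the open set U, f has continuous iterated directional
   derivatives up to order k. *)
Fixpoint Ck (R : realType) (E W : normedModType R) (k : nat) (U : set E)
    (f : E -> W) : Prop :=
  if k is k'.+1 then
    (forall x, U x -> differentiable f x) /\
    (forall v, Ck k' U (fun x => 'D_v f x))
  else forall x, U x -> {for x, continuous f}.

Definition smooth_on (R : realType) (E W : normedModType R) (U : set E)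
    (f : E -> W) : Prop :=
  forall k, Ck k U f.

(* The values of [chart_fun] outside [chart_dom] and of [chart_inv] outside the
   image of [chart_dom] are irrelevant. *)
Record chart (R : realType) (d : nat) (M : topologicalType) := Chart {
  chart_dom : set M;
  chart_fun :> M -> 'cV[R]_d;
  chart_inv : 'cV[R]_d -> M }.

Record is_chart (R : realType) (d : nat) (M : topologicalType)
    (c : chart R d M) : Prop := {
  chart_dom_open : open (chart_dom c);
  chart_img_open : open (c @` chart_dom c);
  chart_funK : forall x, chart_dom c x -> chart_inv c (c x) = x;
  chart_fun_cont : forall x, chart_dom c x -> {for x, continuous c};
  chart_inv_cont :
    forall z, (c @` chart_dom c) z -> {for z, continuous (chart_inv c)} }.

(* A nonempty smooth manifold of dimension d. [chart_at x] is a chosen chart of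
   the atlas around x, and T_x M is identified with R^d by taking components
   in [chart_at x]. So tangent vectors have type 'cV_d, and a vector field is
   a function M -> 'cV_d; its smoothness is read in the charts of the atlas
   through [tchange] below, and not as that of a function to R^d. *)
Record manifold (R : realType) (d : nat) := Manifold {
  carrier :> topologicalType;
  mfd_hausdorff : hausdorff_space carrier;
  mfd_second_countable : @second_countable carrier;
  mfd_nonempty : [set: carrier] !=set0;
  atlas : set (chart R d carrier);
  atlas_chart : forall c, atlas c -> is_chart c;
  atlas_smooth : forall c c', atlas c -> atlas c' ->
    smooth_on (c @` (chart_dom c `&` chart_dom c')) (c' \o chart_inv c);
  chart_at : carrier -> chart R d carrier;
  chart_at_atlas : forall x, atlas (chart_at x);
  chart_at_dom : forall x, chart_dom (chart_at x) x }.

Section Manifold.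
Variables (R : realType) (d : nat) (M : manifold R d).

Notation E := 'cV[R]_d.
Notation field := (M -> 'cV[R]_d).

(* The components in the chart c' of the vector at x with components v in c. *)
Definition tchange (c c' : chart R d M) (x : M) (v : E) : E :=
  'D_v (c' \o chart_inv c) (c x).

Definition field_in (c : chart R d M) (X : field) (z : E) : E :=
  let y := chart_inv c z in tchange (chart_at y) c y (X y).

Definition smooth_field (U : set M) (X : field) : Prop :=
  forall c, atlas c -> smooth_on (c @` (U `&` chart_dom c)) (field_in c X).

Definition smooth_fun (U : set M) (f : M -> R) : Prop :=
  forall c, atlas c ->
    smooth_on (c @` (U `&` chart_dom c)) (f \o chart_inv c : E -> R^o).

Definition smooth_field_near (x : M) (X : field) : Prop :=
  exists U, [/\ open U, U x & smooth_field U X].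

Definition smooth_fun_near (x : M) (f : M -> R) : Prop :=
  exists U, [/\ open U, U x & smooth_fun U f].

Definition dfun (f : M -> R) (x : M) (v : E) : R :=
  'D_v (f \o chart_inv (chart_at x) : E -> R^o) (chart_at x x).

Definition bracket (X Y : field) (x : M) : E :=
  let c := chart_at x in
  'D_(X x) (field_in c Y) (c x) - 'D_(Y x) (field_in c X) (c x).

(* The vector field around x with constant components v in [chart_at x]. *)
Definition ext (x : M) (v : E) : field :=
  fun y => tchange (chart_at x) (chart_at y) y v.

(* [nabla x v Y] is the covariant derivative at x of Y in the direction
   v \in T_x M. It is meaningful only for Y smooth near x. *)
Definition connection := M -> E -> field -> E.

Record is_connection (nabla : connection) : Prop := {
  conn_linear : forall x Y, smooth_field_near x Y ->
    linear (fun v => nabla x v Y);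
  conn_add : forall x v Y Z, smooth_field_near x Y -> smooth_field_near x Z ->
    nabla x v (fun y => Y y + Z y) = nabla x v Y + nabla x v Z;
  conn_leibniz : forall x v f Y, smooth_fun_near x f -> smooth_field_near x Y ->
    nabla x v (fun y => f y *: Y y) = dfun f x v *: Y x + f x *: nabla x v Y;
  conn_local : forall x v Y Z, smooth_field_near x Y ->
    (\forall y \near x, Y y = Z y) -> nabla x v Y = nabla x v Z;
  conn_smooth : forall U X Y, open U -> smooth_field U X -> smooth_field U Y ->
    smooth_field U (fun y => nabla y (X y) Y) }.

Definition torsion_op (nabla : connection) (X Y : field) (x : M) : E :=
  nabla x (X x) Y - nabla x (Y x) X - bracket X Y x.

Definition curvature_op (nabla : connection) (X Y Z : field) (x : M) : E :=
  nabla x (X x) (fun y => nabla y (Y y) Z)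
  - nabla x (Y x) (fun y => nabla y (X y) Z)
  - nabla x (bracket X Y x) Z.

(* The tensors T_x(u, v) and R_x(u, v)w; by tensoriality any smooth extensions
   of u, v, w may be used. *)
Definition torsion (nabla : connection) (x : M) (u v : E) : E :=
  torsion_op nabla (ext x u) (ext x v) x.

Definition curvature (nabla : connection) (x : M) (u v w : E) : E :=
  curvature_op nabla (ext x u) (ext x v) (ext x w) x.

Definition torsion_free (nabla : connection) : Prop :=
  forall x u v, torsion nabla x u v = 0.

Definition add_tensor (nabla : connection) (S : M -> E -> E -> E) : connection :=
  fun x v Y => nabla x v Y + S x v (Y x).

Definition symmetrized (nabla : connection) : connection :=
  add_tensor nabla (fun x u v => - (2%:R^-1 *: torsion nabla x u v)).

(* Here V = 'cV_d, so a frame V -> T_x M is an invertible matrix; G is a set of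
   invertible matrices and g is its Lie algebra. *)

Definition local_section (P : M -> set 'M[R]_d) (U : set M)
    (s : M -> 'M[R]_d) : Prop :=
  [/\ open U, forall y, U y -> P y (s y)
    & forall w : 'cV[R]_d, smooth_field U (fun y => s y *m w)].

Record is_Gstructure (G : set 'M[R]_d) (P : M -> set 'M[R]_d) : Prop := {
  Gstr_frame : forall x p, P x p -> p \in unitmx;
  Gstr_orbit : forall x p q, P x p -> P x q <-> (exists2 g, G g & q = p *m g);
  Gstr_section : forall x, exists U s, local_section P U s /\ U x }.

(* Elements of gl(V)/g are represented by cosets. *)
Definition coset (g : set 'M[R]_d) (A : 'M[R]_d) : set 'M[R]_d :=
  [set B | g (B - A)].

Definition Adbar (p : 'M[R]_d) (C : set 'M[R]_d) : set 'M[R]_d :=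
  [set p *m B *m invmx p | B in C].

Definition linear_to_quotient (g : set 'M[R]_d)
    (I : 'cV[R]_d -> set 'M[R]_d) : Prop :=
  (forall u, exists A, I u = coset g A) /\
  (forall a u v A B, I u = coset g A -> I v = coset g B ->
     I (a *: u + v) = coset g (a *: A + B)).

(* A = \Lambda^s_x(u) *)
Definition is_Lambda (nabla : connection) (s : M -> 'M[R]_d) (x : M)
    (u : 'cV[R]_d) (A : 'M[R]_d) : Prop :=
  forall w, nabla x (s x *m u) (fun y => s y *m w) = s x *m (A *m w).

(* The union over all local sections s around x of the cosets
   Adbar_{s(x)}(\Lambda^s_x(u) + g), s(x)u = v. These cosets coincide. *)
Definition inner_torsion (g : set 'M[R]_d) (nabla : connection)
    (P : M -> set 'M[R]_d) (x : M) (v : E) : set 'M[R]_d :=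
  [set B | exists U s u A, [/\ local_section P U s, U x, s x *m u = v,
     is_Lambda nabla s x u A & Adbar (s x) (coset g A) B]].

Definition alternating_bilinear (U W : lmodType R) (f : U -> U -> W) : Prop :=
  [/\ forall v, linear (fun u => f u v), forall u, linear (f u)
    & forall u, f u u = 0].

Record characteristic_tensors (g : set 'M[R]_d) (nabla : connection)
    (P : M -> set 'M[R]_d) (T0 : 'cV[R]_d -> 'cV[R]_d -> 'cV[R]_d)
    (R0 : 'cV[R]_d -> 'cV[R]_d -> 'M[R]_d)
    (I0 : 'cV[R]_d -> set 'M[R]_d) : Prop := {
  char_T0_alt : alternating_bilinear T0;
  char_R0_alt : alternating_bilinear R0;
  char_I0_lin : linear_to_quotient g I0;
  char_torsion : forall x p u v, P x p ->
    torsion nabla x (p *m u) (p *m v) = p *m T0 u v;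
  char_curvature : forall x p u v w, P x p ->
    curvature nabla x (p *m u) (p *m v) (p *m w) = p *m (R0 u v *m w);
  char_inner : forall x p u, P x p ->
    inner_torsion g nabla P x (p *m u) = Adbar p (I0 u) }.

Definition infinitesimally_homogeneous (g : set 'M[R]_d) (nabla : connection)
    (P : M -> set 'M[R]_d) : Prop :=
  exists T0 R0 I0, characteristic_tensors g nabla P T0 R0 I0.

(* The tensor field on M equal to T0 in a frame p of P; if T0 is G-invariant,
   it does not depend on the choice of p \in P_x. *)
Definition tensor_of (P : M -> set 'M[R]_d)
    (T0 : 'cV[R]_d -> 'cV[R]_d -> 'cV[R]_d) (x : M) (u v : E) : E :=
  let p := xget 1%:M (P x) in
  p *m T0 (invmx p *m u) (invmx p *m v).

End Manifold.

(* H_0 = R^(n + n) with J_0(x, y) = (- y, x), and V = H_0 + R e. *)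
Section Unitary.
Variables (R : realType) (n : nat).

Notation H := 'cV[R]_(n + n).
Notation V := 'cV[R]_(n + n + 1).

Definition h0 (X Y : H) : R := (X^T *m Y) 0 0.

Definition J0 : 'M[R]_(n + n) := block_mx 0 (- 1%:M) 1%:M 0.

Definition omega0 (X Y : H) : R := h0 (J0 *m X) Y.

Definition Un : set 'M[R]_(n + n) :=
  [set A | A^T *m A = 1%:M /\ A *m J0 = J0 *m A].

Definition un : set 'M[R]_(n + n) :=
  [set A | A^T = - A /\ A *m J0 = J0 *m A].

Definition Un1 : set 'M[R]_(n + n + 1) := [set block_mx A 0 0 1%:M | A in Un].

Definition un1 : set 'M[R]_(n + n + 1) := [set block_mx A 0 0 0 | A in un].

Definition horiz (X : H) : V := col_mx X 0.

Definition evec : V := col_mx 0 1%:M.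

Record torsion_params := TorsionParams { tau1 : R; tau2 : R; tau3 : R }.

Record inner_params := InnerParams {
  pa : R; pb : R; palpha : R; pbeta : R; pgamma : R; pdelta : R }.

Record curvature_params := CurvatureParams {
  pc0 : R; pc1 : R; pc2 : R; pc3 : R; pc4 : R;
  pB : H -> H -> 'M[R]_(n + n) }.

Definition cmul (x y : R) (X : H) : H := x *: X + y *: (J0 *m X).

Definition torsion_form (t : torsion_params) (T0 : V -> V -> V) : Prop :=
  forall X Y : H,
    T0 (horiz X) (horiz Y) = (tau3 t * omega0 X Y) *: evec /\
    T0 (horiz X) evec = horiz (cmul (tau1 t) (tau2 t) X).

Definition lambda (q : inner_params) (v : V) : 'M[R]_(n + n + 1) :=
  let X := usubmx v in
  let s := dsubmx v 0 0 in
  block_mx (pa q * s)%:M (cmul (palpha q) (pbeta q) X)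
           (cmul (pgamma q) (pdelta q) X)^T (pb q * s)%:M.

Definition inner_form (q : inner_params) (I0 : V -> set 'M[R]_(n + n + 1)) :
    Prop :=
  forall u, I0 u = coset un1 (lambda q u).

Definition equivariant_block (B : H -> H -> 'M[R]_(n + n)) : Prop :=
  alternating_bilinear B /\
  forall A X Y, Un A -> B (A *m X) (A *m Y) = A *m B X Y *m invmx A.

Definition curvature_form (k : curvature_params)
    (R0 : V -> V -> 'M[R]_(n + n + 1)) : Prop :=
  equivariant_block (pB k) /\
  forall X Y : H,
    R0 (horiz X) evec =
      block_mx 0 (cmul (pc1 k) (pc2 k) X) (cmul (pc3 k) (pc4 k) X)^T 0 /\
    R0 (horiz X) (horiz Y) = block_mx (pB k X Y) 0 0 (pc0 k * omega0 X Y)%:M.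

Definition K (X Y Z : H) : H :=
  4%:R^-1 *: (h0 Y Z *: X - h0 X Z *: Y
              + omega0 Y Z *: (J0 *m X) - omega0 X Z *: (J0 *m Y)
              - (2%:R * omega0 X Y) *: (J0 *m Z)).

Definition inner0 : inner_params := InnerParams 0 0 0 0 0 0.

Definition family1 (q : inner_params) (k : curvature_params) : Prop :=
  [/\ q = inner0,
      [/\ pc0 k = 0, pc1 k = 0, pc2 k = 0, pc3 k = 0 & pc4 k = 0]
    & exists kappa, forall X Y Z, pB k X Y *m Z = kappa *: K X Y Z].

Definition family2 (q : inner_params) (k : curvature_params) : Prop :=
  let: InnerParams a b alpha beta gamma delta := q in
  let P := cmul alpha beta in
  let Q := cmul gamma delta in
  [/\ q <> inner0, a = alpha,
      [/\ pc1 k = a * (b - a) + beta ^+ 2,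
          pc2 k = beta * (b - 2%:R * a),
          pc3 k = (a - b) * gamma + beta * delta,
          pc4 k = (a - b) * delta - beta * gamma
        & pc0 k = 2%:R * pc4 k]
    & exists kappa, forall X Y Z, pB k X Y *m Z =
        h0 (Q Y) Z *: P X - h0 (Q X) Z *: P Y
        - (2%:R * a * delta * omega0 X Y) *: Z
        - (2%:R * beta * delta * omega0 X Y) *: (J0 *m Z)
        + kappa *: K X Y Z].

Definition family3 (q : inner_params) (k : curvature_params) : Prop :=
  let: InnerParams a b alpha beta gamma delta := q in
  let P := cmul alpha beta in
  [/\ a <> alpha, delta = 0,
      [/\ pc1 k = - alpha ^+ 2 + b * alpha + beta ^+ 2,
          pc2 k = beta * (b - 2%:R * alpha),
          pc3 k = (2%:R * a - alpha - b) * gamma,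
          pc4 k = - (beta * gamma)
        & pc0 k = - (2%:R * beta * gamma)]
    & forall X Y Z, pB k X Y *m Z =
        gamma *: (h0 Y Z *: P X - h0 X Z *: P Y)].

Definition in_exactly_one_family (q : inner_params) (k : curvature_params) :
    Prop :=
  [/\ [\/ family1 q k, family2 q k | family3 q k],
      ~ (family1 q k /\ family2 q k), ~ (family1 q k /\ family3 q k)
    & ~ (family2 q k /\ family3 q k)].

Definition inner_with_torsion (q : inner_params) (t : torsion_params) :
    inner_params :=
  InnerParams (pa q - tau1 t / 2%:R) (pb q) (palpha q + tau1 t / 2%:R)
              (pbeta q + tau2 t / 2%:R) (pgamma q) (pdelta q + tau3 t / 2%:R).

(* [q], [ks] are the parameters of the symmetrized connection, [k] those of the
   connection itself. *)
Definition curvature_with_torsion (q : inner_params) (ks : curvature_params)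
    (t : torsion_params) (k : curvature_params) : Prop :=
  let: InnerParams a b alpha beta gamma delta := q in
  let: TorsionParams t1 t2 t3 := t in
  let P0 := cmul t1 t2 in
  let Q := cmul gamma delta in
  let P X := cmul alpha beta X + 2%:R^-1 *: P0 X in
  [/\ pc1 k = pc1 ks + 2%:R^-1 * b * t1 + 4%:R^-1 * (t1 ^+ 2 - t2 ^+ 2),
      pc2 k = pc2 ks + 2%:R^-1 * b * t2 + 2%:R^-1 * t1 * t2,
      pc3 k = pc3 ks - 2%:R^-1 * gamma * t1 - 2%:R^-1 * delta * t2
              + 2%:R^-1 * beta * t3 - 4%:R^-1 * t2 * t3,
      pc4 k = pc4 ks - 2%:R^-1 * delta * t1 + 2%:R^-1 * gamma * t2
              + (a - (alpha + b) / 2%:R) * t3 - 4%:R^-1 * t1 * t3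
    & pc0 k = pc0 ks + delta * t1 - gamma * t2 + alpha * t3
              + 2%:R^-1 * t1 * t3] /\
  (forall X Y Z, pB k X Y *m Z =
     pB ks X Y *m Z
     + (t3 / 2%:R) *: (omega0 Y Z *: P X - omega0 X Z *: P Y)
     + (delta * omega0 X Y) *: P0 Z
     - (2%:R^-1 * h0 (Q X) Z) *: P0 Y
     + (2%:R^-1 * h0 (Q Y) Z) *: P0 X).

End Unitary.

Arguments inner0 {R}.

(* Main.v *)
Require Import Defs.
From HB Require Import structures.
From mathcomp Require Import all_boot all_order all_algebra.
From mathcomp Require Import all_classical all_reals all_analysis.
From mathcomp Require Import ring lra.
Set Implicit Arguments.
Unset Strict Implicit.
Unset Printing Implicit Defensive.
Import Order.TTheory GRing.Theory Num.Theory.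
Import numFieldNormedType.Exports.
Local Open Scope classical_set_scope.
Local Open Scope ring_scope.

(** The characteristic tensors of an infinitesimally homogeneous connection obey
    finitely many algebraic identities, and U(n) x {1} is large enough for these
    identities to be solved explicitly.

    The identities. A local section of P is a moving frame. In a chart, its
    coframe Sg and its connection form A satisfy Cartan's structure equations,
    whose right-hand sides T0 (Sg, Sg) and R0 (Sg, Sg) have constant coefficients
    ([cartan_of_section]). The characteristic inner torsion says that A is the sum
    of lambda (Sg) and of a form with values in the Lie algebra g. Inserting this
    in the structure equations shows, by the equivariance of lambda, that
    R0 (u, v) - [lambda u, lambda v] + lambda (lambda u v - lambda v u - T0 (u, v))
    lies in g ([curvature_mod_lie]). If T0 = 0, the exterior derivatives of the
    structure equations give the two Bianchi identities; in the second one the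
    covariant derivative of R0 is the action of lambda on R0 ([cartan_bianchi1],
    [cartan_bianchi2]).

    The parameters. Characteristic tensors are equivariant
    ([characteristic_equivariant]). The group U(n) contains -1, which kills the
    blocks of the wrong parity, and it is transitive on spheres and contains the
    complex reflections, so that its equivariant endomorphisms of H are x + y J
    ([schur]). This leaves exactly the parameters of the statement
    ([characteristic_params]).

    Symmetrization. Adding to a connection the tensor that is a constant S0 in all
    frames of P adds S0 to lambda and changes R0 by a polynomial in lambda and S0:
    the derivative of S0 (Sg) that appears in the curvature is known from the first
    structure equation ([add_tensor_characteristic]). For S0 = - T0 / 2 the result is
    torsion-free; for S0 = T0 / 2 the blocks of that polynomial are the formulas
    that express the tensors of the connection through those of its symmetrization
    ([curvature_formulas]).

    The torsion-free families. The off-diagonal blocks of the condition modulo g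
    determine c1, ..., c4 ([mixed_coefficients]). Its entry along e and the first
    Bianchi identity give two values of c0, and their comparison reads
    delta (a - alpha) = 0 ([branch_equation]). Its block on H determines B modulo
    u(n), and the remainder is an invariant curvature tensor of Kaehler type; such
    a tensor is fixed by its holomorphic sectional curvature, a constant on unit
    vectors, and is thus a multiple of K ([kaehler_invariant]). For
    a different from alpha the second Bianchi identity makes this multiple vanish
    ([kaehler_coefficient]). *)

(** * Differentiable maps with matrix values *)

Section SmoothMaps.
Variables (R : realType) (E : normedModType R).
Implicit Types (U : set E) (k : nat).

(** The differential of f is also a first-order expansion of g, and such an
    expansion characterizes the differential. *)
Lemma near_eq_differentiable (W : normedModType R) (f g : E -> W) x :
  (\near x, f x = g x) -> differentiable f x -> differentiable g x.
Proof.
move=> fg df; have fgx := nbhs_singleton fg.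
have dg : g \o shift x = cst (g x) + 'd f x +o_ 0 id.
  apply/eqaddoP => e e0; have := diff_locally df => /eqaddoP /(_ e e0) H.
  have fg0 : \forall h \near (0 : E), f (h + x) = g (h + x).
    by have := fg; rewrite (near_shift 0); apply: filterS => h /=; rewrite subr0.
  apply: filterS2 fg0 H => h fgh.
  suff -> : (f \o shift x - (cst (f x) + 'd f x)) h
          = (g \o shift x - (cst (g x) + 'd f x)) h by [].
  by rewrite -[LHS]/(f (h + x) - (f x + 'd f x h)) fgh fgx.
have dgE := diff_unique (diff_continuous df) dg.
apply/diff_locallyP; rewrite dgE; split=> //.
exact: diff_continuous df.
Qed.

Lemma differentiable_mx m n (f : E -> 'M[R]_(m, n)) x :
  (forall i j, differentiable (fun z => f z i j : R^o) x) -> differentiable f x.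
Proof.
move=> df.
have -> : f = \sum_(i < m) \sum_(j < n) (fun z => f z i j *: delta_mx i j).
  rewrite funeqE => z; rewrite [LHS]matrix_sum_delta fct_sumE.
  by apply: eq_bigr => i _; rewrite fct_sumE.
by do 2 (apply: differentiable_sum => ?); apply: differentiableZl.
Qed.

Lemma differentiable_entry m n (f : E -> 'M[R]_(m, n)) x i j :
  differentiable f x -> differentiable (fun z => f z i j : R^o) x.
Proof.
by move=> df; exact: (differentiable_comp df (differentiable_coord (f x) i j)).
Qed.

Lemma derive_entry m n (f : E -> 'M[R]_(m, n)) x v i j :
  differentiable f x -> ('D_v f x) i j = 'D_v (fun z => f z i j : R^o) x.
Proof. by move=> df; rewrite derive_mx ?mxE //; apply: diff_derivable. Qed.

Lemma Ck_eq (W : normedModType R) k U (f g : E -> W) : open U ->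
  (forall x, U x -> f x = g x) -> Ck k U f -> Ck k U g.
Proof.
move=> oU; elim: k f g => [|k IH] f g fg /=.
  move=> fc x Ux; have := fc x Ux.
  have nfg : \near x, f x = g x by apply: filterS (open_nbhs_nbhs (conj oU Ux)).
  move=> fcx; rewrite /prop_for /continuous_at -(fg x Ux).
  by apply: cvg_trans fcx; apply: near_eq_cvg; apply: filterS nfg.
move=> [df Df]; split=> [x Ux|v].
  apply: near_eq_differentiable (df x Ux).
  by apply: filterS (open_nbhs_nbhs (conj oU Ux)).
apply: IH (Df v) => x Ux; apply: near_eq_derive.
by apply: filterS (open_nbhs_nbhs (conj oU Ux)).
Qed.

Lemma Ck_sub (W : normedModType R) k U V (f : E -> W) :
  V `<=` U -> Ck k U f -> Ck k V f.
Proof.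
move=> VU; elim: k f => [|k IH] f /= => [fc x /VU /fc //|[df Df]].
by split=> [x /VU /df //|v]; apply: IH.
Qed.

Lemma Ck_local (W : normedModType R) k U (f : E -> W) :
  (forall x, U x -> exists2 V, V x & Ck k V f) -> Ck k U f.
Proof.
elim: k f => [|k IH] f /= => H.
  by move=> x /H[V Vx]; apply.
split=> [x /H[V Vx [df _]]|v]; first exact: df.
by apply: IH => x /H[V Vx [_ Df]]; exists V.
Qed.

Lemma CkW (W : normedModType R) k U (f : E -> W) : Ck k.+1 U f -> Ck k U f.
Proof.
elim: k f => [|k IH] f.
  by move=> [df _] x Ux; apply: differentiable_continuous; apply: df.
by move=> [df Df]; split=> // v; apply: IH.
Qed.

Lemma Ck_cst (W : normedModType R) k U (w : W) : Ck k U (fun=> w : W).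
Proof.
elim: k w => [|k IH] w /=; first by move=> x _; apply: cst_continuous.
split=> [x _|v]; first exact: differentiable_cst.
by rewrite (_ : 'D_v _ = fun=> 0); [exact: IH|rewrite funeqE => x; exact: derive_cst].
Qed.

Lemma Ck_add (W : normedModType R) k U (f g : E -> W) : open U ->
  Ck k U f -> Ck k U g -> Ck k U (fun x => f x + g x).
Proof.
move=> oU; elim: k f g => [|k IH] f g /=.
  by move=> fc gc x Ux; apply: continuousD; [exact: fc|exact: gc].
move=> [df Df] [dg Dg]; split=> [x Ux|v].
  by apply: differentiableD; [exact: df|exact: dg].
apply: Ck_eq (IH _ _ (Df v) (Dg v)) => // x Ux; symmetry.
by apply: deriveD; apply: diff_derivable; [exact: df|exact: dg].
Qed.

Lemma Ck_mul k U (f g : E -> R^o) : open U ->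
  Ck k U f -> Ck k U g -> Ck k U (fun x => f x * g x : R^o).
Proof.
move=> oU; elim: k f g => [|k IH] f g /=.
  by move=> fc gc x Ux; apply: continuousM; [exact: fc|exact: gc].
move=> [df Df] [dg Dg]; split=> [x Ux|v].
  by apply: differentiableM; [exact: df|exact: dg].
(* The derivative of a product also contains the factors themselves, which
   must be of class C^k as well. *)
have fCk : Ck k U f by apply: CkW; split.
have gCk : Ck k U g by apply: CkW; split.
apply: Ck_eq (Ck_add oU (IH _ _ fCk (Dg v)) (IH _ _ gCk (Df v))) => // x Ux.
symmetry; apply: deriveM; apply: diff_derivable; [exact: df|exact: dg].
Qed.

Lemma Ck_inv k U (f : E -> R^o) : open U -> (forall x, U x -> f x != 0) ->
  Ck k U f -> Ck k U (fun x => (f x)^-1 : R^o).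
Proof.
move=> oU f0; elim: k f f0 => [|k IH] f f0 /=.
  by move=> fc x Ux; apply: continuousV; [exact: f0|exact: fc].
move=> [df Df]; split=> [x Ux|v].
  by apply: differentiableV; [exact: df|exact: f0].
have fCk : Ck k U f by apply: CkW; split.
have := Ck_mul oU (Ck_cst k U (-1 : R^o)) (Ck_mul oU (IH f f0 fCk) (IH f f0 fCk)).
move=> /(Ck_mul oU) /(_ (Df v)).
apply: Ck_eq => // x Ux; symmetry; rewrite deriveV ?f0 //; last exact/diff_derivable/df.
by rewrite -exprVn expr2 -[_ *: _]/(_ * _) !mulN1r.
Qed.

Lemma Ck_entry m n k U (f : E -> 'M[R]_(m, n)) i j : open U ->
  Ck k U f -> Ck k U (fun z => f z i j : R^o).
Proof.
move=> oU; elim: k f => [|k IH] f /=.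
  move=> fc x Ux.
  apply: (@continuous_comp _ _ _ f (fun A : 'M[R]_(m,n) => A i j : R^o)).
    exact: fc.
  exact: coord_continuous.
move=> [df Df]; split=> [x Ux|v]; first by apply: differentiable_entry; apply: df.
apply: Ck_eq (IH _ (Df v)) => // x Ux.
by apply: derive_entry; apply: df.
Qed.

Lemma continuous_mx m n (f : E -> 'M[R]_(m, n)) x :
  (forall i j, {for x, continuous (fun z => f z i j : R^o)}) ->
  {for x, continuous f}.
Proof.
move=> fc.
have -> : f = \sum_(i < m) \sum_(j < n) (fun z => f z i j *: delta_mx i j).
  rewrite funeqE => z; rewrite [LHS]matrix_sum_delta fct_sumE.
  by apply: eq_bigr => i _; rewrite fct_sumE.
do 2 (apply: (big_ind (fun F : E -> 'M[R]_(m, n) => {for x, continuous F}));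
  [exact: cst_continuous|by move=> ? ?; apply: continuousD|move=> ? _]).
by apply: continuousZr_tmp; apply: fc.
Qed.

Lemma Ck_mx m n k U (f : E -> 'M[R]_(m, n)) : open U ->
  (forall i j, Ck k U (fun z => f z i j : R^o)) -> Ck k U f.
Proof.
move=> oU; elim: k f => [|k IH] f /= => [fc x Ux|H].
  by apply: continuous_mx => i j; apply: fc.
have df x : U x -> differentiable f x.
  by move=> Ux; apply: differentiable_mx => i j; apply: (H i j).1.
split=> // v; apply: IH => i j; apply: Ck_eq ((H i j).2 v) => // x Ux.
by rewrite derive_entry //; apply: df.
Qed.

Lemma derive_comp (F W : normedModType R) (f : E -> F) (g : F -> W) x v :
  differentiable f x -> differentiable g (f x) ->
  'D_v (g \o f) x = 'D_('D_v f x) g (f x).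
Proof.
move=> df dg; rewrite !deriveE //; last exact: differentiable_comp.
by rewrite diff_comp.
Qed.

End SmoothMaps.

(** * Symmetry of second derivatives *)

Section Schwarz.
Variables (R : realType) (E : normedModType R).

(** The mean value theorem in one variable, along the line through x in the
    direction w. *)
Lemma MVT_line (f : E -> R^o) (x w : E) (h : R) : 0 < h ->
  (forall t, 0 <= t <= h -> differentiable f (x + t *: w)) ->
  exists2 t, 0 <= t <= h & f (x + h *: w) - f x = h * 'D_w f (x + t *: w).
Proof.
move=> h0 df.
have dl (t : R) : differentiable (fun t : R^o => x + t *: w) t.
  by apply: differentiableD => //; apply: differentiableZl.
have Dl (t : R) : 'D_1 (fun t : R^o => x + t *: w) t = w.
  rewrite deriveD //; last exact/diff_derivable/differentiableZl.
  rewrite derive_cst add0r deriveE; last exact: differentiableZl.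
  rewrite diffZl // -deriveE // derive_id.
  by rewrite scale1r.
have [t||t] := @MVT R (fun t => f (x + t *: w)) (fun t => 'D_w f (x + t *: w)) 0 h h0.
- rewrite in_itv /= => /andP[t0 th]; split.
    by apply/diff_derivable/(differentiable_comp (dl t))/df; rewrite !ltW.
  rewrite (derive_comp (1 : R^o) (dl t)) ?Dl //.
  by apply: df; rewrite !ltW.
- apply: derivable_within_continuous => t; rewrite in_itv /= => t0h.
  by apply/diff_derivable/(differentiable_comp (dl t))/df.
- rewrite in_itv /= => /andP[t0 th] H; exists t; first by rewrite !ltW.
  by move: H; rewrite scale0r addr0 subr0 mulrC.
Qed.

(** Apply the mean value theorem to the increment of f by h v along the
    direction u, and again to the derivative of f along u in the direction v. *)
Lemma second_difference (f : E -> R^o) (x u v : E) (h : R) : 0 < h ->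
  (forall t s, 0 <= t <= h -> 0 <= s <= h ->
    differentiable f (x + t *: u + s *: v) /\
    differentiable ('D_u f) (x + t *: u + s *: v)) ->
  exists t s, [/\ 0 <= t <= h, 0 <= s <= h &
   f (x + h *: u + h *: v) - f (x + h *: u) - (f (x + h *: v) - f x) =
   h * (h * 'D_v ('D_u f) (x + t *: u + s *: v))].
Proof.
move=> h0 H.
have h00 : 0 <= (0 : R) <= h by rewrite lexx ltW.
have hh : 0 <= h <= h by rewrite lexx ltW.
have d1 t : 0 <= t <= h -> differentiable (f \o shift (h *: v)) (x + t *: u).
  move=> th; apply: differentiable_comp.
    by apply: differentiableD.
  by have [] := H t h th hh.
have d2 t : 0 <= t <= h -> differentiable f (x + t *: u).
  by move=> th; have [] := H t 0 th h00; rewrite scale0r addr0.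
have [|t th] := @MVT_line (fun y => f (y + h *: v) - f y) x u h h0.
  by move=> t th; apply: differentiableB; [exact: d1|exact: d2].
rewrite [x + h *: u + _]addrAC => Hf.
have [|s sh Hs] := @MVT_line ('D_u f) (x + t *: u) v h h0.
  by move=> s sh; have [] := H t s th sh.
exists t, s; split=> //; rewrite {}Hf -{}Hs; congr (h * _).
rewrite deriveB; [|exact/diff_derivable/d1|exact/diff_derivable/d2].
congr (_ - _); rewrite derive_comp.
- by rewrite deriveD // derive_id derive_cst addr0.
- by apply: differentiableD.
- by have [] := H t h th hh.
Qed.

(** Both mixed derivatives are limits of the same second difference quotient. *)
Lemma schwarz (U : set E) (f : E -> R^o) x u v : open U -> U x -> Ck 2 U f ->
  'D_u ('D_v f) x = 'D_v ('D_u f) x.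
Proof.
move=> oU Ux [df Df].
apply/eqP; rewrite eq_sym -subr_eq0 -normr_le0; apply/ler_addgt0Pr => e e0.
have e2 : 0 < e / 2 by rewrite divr_gt0.
have tri (a b c : R) : `|a - c| < e / 2 -> `|b - c| < e / 2 -> `|a - b| <= e.
  move=> ac bc; rewrite -(subrKA c) ltW // [e]splitr.
  by apply: le_lt_trans (ler_normD _ _) _; rewrite ltrD // distrC.
have c1 := (Df u).2 v x Ux; have c2 := (Df v).2 u x Ux.
have /nbhs_ballP[d /= d0 Hd] : \forall y \near x,
   [/\ U y, `|'D_v ('D_u f) x - 'D_v ('D_u f) y| < e / 2
     & `|'D_u ('D_v f) x - 'D_u ('D_v f) y| < e / 2].
  move/cvgrPdist_lt : c1 => /(_ _ e2) n1; move/cvgrPdist_lt : c2 => /(_ _ e2) n2.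
  by apply: filterS3 n1 n2 (open_nbhs_nbhs (conj oU Ux)) => y h1 h2 h3; exact: (And3 h3 h1 h2).
(* The parallelogram with sides h u and h v lies in a ball on which both mixed
   derivatives vary by less than e / 2. *)
pose N := `|u| + `|v| + 1.
have N0 : 0 < N by rewrite ltr_wpDl // addr_ge0.
pose h := d / 2 / N.
have h0 : 0 < h by rewrite !divr_gt0.
have inU t s : 0 <= t <= h -> 0 <= s <= h -> ball x d (x + t *: u + s *: v).
  move=> /andP[t0 th] /andP[s0 sh]; rewrite -ball_normE /= -addrA opprD addNKr normrN.
  apply: le_lt_trans (ler_normD _ _) _; rewrite !normrZ (ger0_norm t0) (ger0_norm s0).
  apply: (@le_lt_trans _ _ (h * N)); last by rewrite divfK ?gt_eqF // ltr_pdivrMr // ltr_pMr // ltr1n.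
  rewrite /N !mulrDr mulr1; apply: (@le_trans _ _ (h * `|u| + h * `|v|)).
    by rewrite lerD // ler_wpM2r.
  by rewrite lerDl ltW.
have inU' t s : 0 <= t <= h -> 0 <= s <= h -> ball x d (x + t *: v + s *: u).
  by rewrite addrAC => ? ?; apply: inU.
have [|t [s [th sh E1]]] := @second_difference f x u v h h0.
  by move=> t s th sh; have [Uy _ _] := Hd _ (inU t s th sh); split;
     [exact: df|exact: (Df u).1].
have [|t' [s' [th' sh' E2]]] := @second_difference f x v u h h0.
  by move=> t' s' th' sh'; have [Uy _ _] := Hd _ (inU' t' s' th' sh'); split;
     [exact: df|exact: (Df v).1].
have [_ B1 _] := Hd _ (inU t s th sh).
have [_ _ B2] := Hd _ (inU' t' s' th' sh').
have E3 : 'D_v ('D_u f) (x + t *: u + s *: v) = 'D_u ('D_v f) (x + t' *: v + s' *: u).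
  have cancel (p q r r' : R) : r = h * (h * p) -> r' = h * (h * q) -> r = r' -> p = q.
    have hn : h != 0 by rewrite gt_eqF.
    by move=> -> -> /(mulfI hn)/(mulfI hn).
  apply: cancel E1 E2 _; rewrite [x + h *: v + h *: u]addrAC.
  by move: (f _) (f _) (f _) (f _) => *; ring.
rewrite add0r.
by rewrite -E3 in B2; exact: (tri _ _ _ B1 B2).
Qed.

End Schwarz.

(** * Smooth functions and matrices *)

Section SmoothScalar.
Variables (R : realType) (E : normedModType R) (U : set E) (oU : open U).
Implicit Types f g : E -> R^o.

Lemma smooth_eq (W : normedModType R) (f g : E -> W) :
  (forall x, U x -> f x = g x) -> smooth_on U f -> smooth_on U g.
Proof. by move=> fg sf k; apply: Ck_eq fg (sf k). Qed.

Lemma smooth_cst (W : normedModType R) (w : W) : smooth_on U (fun=> w).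
Proof. by move=> k; apply: Ck_cst. Qed.

Lemma smooth_add (W : normedModType R) (f g : E -> W) :
  smooth_on U f -> smooth_on U g -> smooth_on U (fun x => f x + g x).
Proof. by move=> sf sg k; apply: Ck_add. Qed.

Lemma smooth_mul f g :
  smooth_on U f -> smooth_on U g -> smooth_on U (fun x => f x * g x : R^o).
Proof. by move=> sf sg k; apply: Ck_mul. Qed.

Lemma smooth_inv f : (forall x, U x -> f x != 0) ->
  smooth_on U f -> smooth_on U (fun x => (f x)^-1 : R^o).
Proof. by move=> f0 sf k; apply: Ck_inv. Qed.

Lemma Ck_sum k (I : Type) (r : seq I) (P : pred I) (F : I -> E -> R^o) :
  (forall i, P i -> Ck k U (F i)) ->
  Ck k U (fun x => \sum_(i <- r | P i) F i x : R^o).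
Proof.
move=> sF; elim: r => [|i r IH].
  by under eq_fun do rewrite big_nil; apply: Ck_cst.
case Pi: (P i); under eq_fun do rewrite big_cons Pi; last exact: IH.
by apply: Ck_add => //; apply: sF.
Qed.

Lemma smooth_sum (I : Type) (r : seq I) (P : pred I) (F : I -> E -> R^o) :
  (forall i, P i -> smooth_on U (F i)) ->
  smooth_on U (fun x => \sum_(i <- r | P i) F i x : R^o).
Proof. by move=> sF k; apply: Ck_sum => i /sF. Qed.

Lemma smooth_prod (I : Type) (r : seq I) (P : pred I) (F : I -> E -> R^o) :
  (forall i, P i -> smooth_on U (F i)) ->
  smooth_on U (fun x => \prod_(i <- r | P i) F i x : R^o).
Proof.
move=> sF; elim: r => [|i r IH].
  by under eq_fun do rewrite big_nil; apply: smooth_cst.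
case Pi: (P i); under eq_fun do rewrite big_cons Pi; last exact: IH.
by apply: smooth_mul => //; apply: sF.
Qed.

Lemma smooth_diff (W : normedModType R) (f : E -> W) x :
  smooth_on U f -> U x -> differentiable f x.
Proof. by move=> sf; apply: (sf 1%N).1. Qed.

Lemma smooth_derive (W : normedModType R) (f : E -> W) v :
  smooth_on U f -> smooth_on U ('D_v f).
Proof. by move=> sf k; apply: (sf k.+1).2. Qed.

(** Smoothness entry by entry, which only needs the rules of scalar calculus;
    by [smooth_mxP] it is the same as smoothness. *)
Definition smooth_mx m n (F : E -> 'M[R]_(m, n)) : Prop :=
  forall i j, smooth_on U (fun z => F z i j : R^o).

Lemma smooth_mxP m n (F : E -> 'M[R]_(m, n)) : smooth_mx F <-> smooth_on U F.
Proof.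
by split=> [sF k|sF i j k]; [apply: Ck_mx => // i j; apply: sF|apply: Ck_entry].
Qed.

Lemma smooth_entry m n (F : E -> 'M[R]_(m, n)) i j :
  smooth_on U F -> smooth_on U (fun z => F z i j : R^o).
Proof. by move=> /smooth_mxP; apply. Qed.

Lemma smooth_mulmx m n p (F : E -> 'M[R]_(m, n)) (G : E -> 'M[R]_(n, p)) :
  smooth_mx F -> smooth_mx G -> smooth_mx (fun z => F z *m G z).
Proof.
move=> sF sG i j; under eq_fun do rewrite mxE.
by apply: smooth_sum => k _; apply: smooth_mul.
Qed.

Lemma smooth_mx_cst m n (A : 'M[R]_(m, n)) : smooth_mx (fun=> A).
Proof. by move=> i j; apply: smooth_cst. Qed.

Lemma smooth_mx_add m n (F G : E -> 'M[R]_(m, n)) :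
  smooth_mx F -> smooth_mx G -> smooth_mx (fun z => F z + G z).
Proof.
by move=> sF sG i j; under eq_fun do rewrite mxE; apply: smooth_add.
Qed.

Lemma smooth_mx_opp m n (F : E -> 'M[R]_(m, n)) :
  smooth_mx F -> smooth_mx (fun z => - F z).
Proof.
move=> sF i j; have := smooth_mulmx (smooth_mx_cst (- 1%:M)) sF.
by move=> /(_ i j); under eq_fun do rewrite mulNmx mul1mx.
Qed.

Lemma smooth_mx_sub m n (F G : E -> 'M[R]_(m, n)) :
  smooth_mx F -> smooth_mx G -> smooth_mx (fun z => F z - G z).
Proof. by move=> sF sG; apply: smooth_mx_add => //; apply: smooth_mx_opp. Qed.

Lemma smooth_det n (F : E -> 'M[R]_n) :
  smooth_mx F -> smooth_on U (fun z => \det (F z) : R^o).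
Proof.
move=> sF; apply: smooth_sum => s _; apply: smooth_mul; first exact: smooth_cst.
exact: smooth_prod.
Qed.

(** By Cramer's formula. *)
Lemma smooth_invmx n (F : E -> 'M[R]_n) : (forall z, U z -> F z \in unitmx) ->
  smooth_mx F -> smooth_mx (fun z => invmx (F z)).
Proof.
move=> uF sF i j.
apply: (@smooth_eq _ (fun z => (\det (F z))^-1 * \adj (F z) i j : R^o)).
  by move=> z Uz; rewrite /invmx uF // [RHS]mxE.
apply: smooth_mul.
  by apply: smooth_inv; [move=> z /uF; rewrite unitmxE unitfE|exact: smooth_det].
under eq_fun do rewrite mxE; apply: smooth_mul; first exact: smooth_cst.
by apply: smooth_det => k l; under eq_fun do rewrite !mxE; apply: sF.
Qed.

End SmoothScalar.

Lemma smooth_sub (R : realType) (E W : normedModType R) (U V : set E) (f : E -> W) :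
  V `<=` U -> smooth_on U f -> smooth_on V f.
Proof. by move=> VU sf k; apply: Ck_sub VU (sf k). Qed.

Lemma smooth_local (R : realType) (E W : normedModType R) (U : set E) (f : E -> W) :
  (forall x, U x -> exists2 V, V x & smooth_on V f) -> smooth_on U f.
Proof.
by move=> H k; apply: Ck_local => x /H[V Vx sf]; exists V.
Qed.

Section SmoothComp.
Variables (R : realType).

Lemma derive_basis (W : normedModType R) d (f : 'cV[R]_d -> W) y w :
  differentiable f y -> 'D_w f y = \sum_i w i 0 *: 'D_(delta_mx i 0) f y.
Proof.
move=> df; rewrite deriveE // [w in LHS]matrix_sum_delta linear_sum.
apply: eq_bigr => i _; rewrite big_ord1 linearZ deriveE //.
Qed.

(** By the chain rule the derivatives of the composite are combinations of
    partial derivatives of f composed with phi, to which the induction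
    hypothesis applies. *)
Lemma Ck_comp (E : normedModType R) d k (U : set E) (V : set 'cV[R]_d)
    (phi : E -> 'cV[R]_d) (f : 'cV[R]_d -> R^o) : open U -> open V ->
  (forall z, U z -> V (phi z)) -> Ck k U phi -> Ck k V f -> Ck k U (f \o phi).
Proof.
move=> oU oV UV; elim: k f => [|k IH] f.
  move=> pc fc z Uz; apply: continuous_comp; first exact: pc.
  by apply: fc; apply: UV.
move=> sp [df Df]; have [dp Dp] := sp; split=> [z Uz|v].
  by apply: differentiable_comp; [exact: dp|apply: df; exact: UV].
apply: (@Ck_eq _ _ _ _ _
  (fun z => \sum_i ('D_v phi z) i 0 * ('D_(delta_mx i 0) f \o phi) z : R^o)) => //.
  move=> z Uz; rewrite (@derive_comp _ _ _ _ phi f); [|exact: dp|by apply: df; exact: UV].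
  by rewrite derive_basis //; apply: df; exact: UV.
apply: Ck_sum => // i _; apply: Ck_mul => //.
  by apply: Ck_entry => //; apply: Dp.
by apply: IH; [exact: CkW|exact: Df].
Qed.

Lemma smooth_comp (E : normedModType R) d (U : set E) (V : set 'cV[R]_d)
    (phi : E -> 'cV[R]_d) (f : 'cV[R]_d -> R^o) : open U -> open V ->
  (forall z, U z -> V (phi z)) -> smooth_on U phi -> smooth_on V f ->
  smooth_on U (f \o phi).
Proof. by move=> oU oV UV sp sf k; apply: Ck_comp oV UV (sp k) (sf k). Qed.

End SmoothComp.

Section MatrixDerivative.
Variables (R : realType) (E : normedModType R) (U : set E) (oU : open U).

(** Derivatives of matrix-valued maps are taken entry by entry, which reduces
    every rule to the scalar one. *)
Definition DM (v : E) m n (F : E -> 'M[R]_(m, n)) (z : E) : 'M[R]_(m, n) :=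
  \matrix_(i, j) 'D_v (fun y => F y i j : R^o) z.

Lemma DM_near v m n (F G : E -> 'M[R]_(m, n)) z :
  (\near z, F z = G z) -> DM v F z = DM v G z.
Proof.
move=> FG; apply/matrixP => i j; rewrite !mxE; apply: near_eq_derive.
by apply: filterS FG => y ->.
Qed.

Lemma DM_eq v m n (F G : E -> 'M[R]_(m, n)) z : U z ->
  (forall y, U y -> F y = G y) -> DM v F z = DM v G z.
Proof.
move=> Uz FG; apply: DM_near.
by apply: filterS (open_nbhs_nbhs (conj oU Uz)).
Qed.

Lemma smooth_DM v m n (F : E -> 'M[R]_(m, n)) :
  smooth_mx U F -> smooth_mx U (DM v F).
Proof.
move=> sF i j; under eq_fun do rewrite mxE.
exact: smooth_derive.
Qed.

Lemma DM_cst v m n (A : 'M[R]_(m, n)) z : DM v (fun=> A) z = 0.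
Proof. by apply/matrixP => i j; rewrite !mxE derive_cst. Qed.

Lemma DM_add v m n (F G : E -> 'M[R]_(m, n)) z : U z ->
  smooth_mx U F -> smooth_mx U G ->
  DM v (fun y => F y + G y) z = DM v F z + DM v G z.
Proof.
move=> Uz sF sG; apply/matrixP => i j; rewrite !mxE.
under eq_fun do rewrite mxE.
by rewrite deriveD //; apply/diff_derivable/smooth_diff.
Qed.

Lemma DM_mul v m n p (F : E -> 'M[R]_(m, n)) (G : E -> 'M[R]_(n, p)) z : U z ->
  smooth_mx U F -> smooth_mx U G ->
  DM v (fun y => F y *m G y) z = DM v F z *m G z + F z *m DM v G z.
Proof.
move=> Uz sF sG; apply/matrixP => i j; rewrite !mxE -big_split /=.
have dF k l : derivable (fun y => F y k l : R^o) z v.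
  exact: diff_derivable (smooth_diff (sF k l) Uz).
have dG k l : derivable (fun y => G y k l : R^o) z v.
  exact: diff_derivable (smooth_diff (sG k l) Uz).
have -> : (fun y => (F y *m G y) i j) =
  \sum_k ((fun y => F y i k : R^o) * (fun y => G y k j)).
  by rewrite funeqE => y; rewrite mxE fct_sumE.
rewrite derive_sum; last by move=> k; apply: derivableM.
apply: eq_bigr => k _; rewrite deriveM // !mxE addrC; congr (_ + _).
by rewrite -[_ *: _]/(_ * _) mulrC.
Qed.

Lemma DM_mulr v m n p (F : E -> 'M[R]_(m, n)) (C : 'M[R]_(n, p)) z : U z ->
  smooth_mx U F -> DM v (fun y => F y *m C) z = DM v F z *m C.
Proof.
move=> Uz sF; rewrite DM_mul //; last exact: smooth_mx_cst.
by rewrite DM_cst mulmx0 addr0.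
Qed.

Lemma DM_mull v m n p (C : 'M[R]_(m, n)) (F : E -> 'M[R]_(n, p)) z : U z ->
  smooth_mx U F -> DM v (fun y => C *m F y) z = C *m DM v F z.
Proof.
move=> Uz sF; rewrite DM_mul //; last exact: smooth_mx_cst.
by rewrite DM_cst mul0mx add0r.
Qed.

Lemma DM_opp v m n (F : E -> 'M[R]_(m, n)) z : U z ->
  smooth_mx U F -> DM v (fun y => - F y) z = - DM v F z.
Proof.
move=> Uz sF; rewrite (_ : (fun _ => _) = fun y => (- 1%:M) *m F y).
  by rewrite DM_mull // mulNmx mul1mx.
by rewrite funeqE => y; rewrite mulNmx mul1mx.
Qed.

Lemma DM_sub v m n (F G : E -> 'M[R]_(m, n)) z : U z ->
  smooth_mx U F -> smooth_mx U G ->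
  DM v (fun y => F y - G y) z = DM v F z - DM v G z.
Proof.
by move=> Uz sF sG; rewrite -DM_opp // -DM_add //; apply: smooth_mx_opp.
Qed.

Lemma DM_tr v m n (F : E -> 'M[R]_(m, n)) z : DM v (fun y => (F y)^T) z = (DM v F z)^T.
Proof.
by apply/matrixP => i j; rewrite !mxE; congr ('D_v _ z); apply/funext => y; rewrite mxE.
Qed.

Lemma DM_schwarz u v m n (F : E -> 'M[R]_(m, n)) z : U z ->
  smooth_mx U F -> DM u (DM v F) z = DM v (DM u F) z.
Proof.
move=> Uz sF; apply/matrixP => i j; rewrite [LHS]mxE [RHS]mxE.
have DE w : (fun y => DM w F y i j : R^o) = 'D_w (fun y => F y i j : R^o).
  by rewrite funeqE => y; rewrite mxE.
by rewrite !DE; exact: (schwarz u v oU Uz (sF i j 2%N)).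
Qed.

End MatrixDerivative.

(** * Charts and vector fields *)

Section Charts.
Variables (R : realType) (d : nat) (M : manifold R d).
Notation E := 'cV[R]_d.
Notation field := (M -> 'cV[R]_d).
Implicit Types (c : chart R d M) (x y : M) (U V : set M).

Lemma chart_image c U z : atlas c -> (c @` (U `&` chart_dom c)) z ->
  [/\ U (chart_inv c z), chart_dom c (chart_inv c z) & c (chart_inv c z) = z].
Proof.
by move=> ac [x [Ux dx] <-]; rewrite (chart_funK (atlas_chart ac)).
Qed.

Lemma chart_inv_near c x (A : set M) : atlas c -> chart_dom c x ->
  (\near x, A x) -> \forall z \near c x, A (chart_inv c z).
Proof.
move=> ac dx nA; have ic := atlas_chart ac.
have := chart_inv_cont ic (z := c x) (ex_intro2 _ _ x dx erefl).
by apply; rewrite (chart_funK ic dx).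
Qed.

Lemma open_image c U : atlas c -> open U -> open (c @` (U `&` chart_dom c)).
Proof.
move=> ac oU; have ic := atlas_chart ac.
rewrite openE => _ [x [Ux dx] <-]; rewrite /interior.
have n1 : \forall z \near c x, (c @` chart_dom c) z.
  by apply: open_nbhs_nbhs; split; [exact: chart_img_open ic|exists x].
have n2 : \forall z \near c x, U (chart_inv c z).
  exact: chart_inv_near (open_nbhs_nbhs (conj oU Ux)).
apply: filterS2 n1 n2 => _ [y dy <-]; rewrite (chart_funK ic dy) => Uy.
by exists y.
Qed.

Lemma chart_at_open x : open (chart_dom (chart_at x)).
Proof. exact: chart_dom_open (atlas_chart (chart_at_atlas x)). Qed.

Definition trans c c' : E -> E := c' \o chart_inv c.

Lemma trans_smooth c c' : atlas c -> atlas c' ->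
  smooth_on (c @` (chart_dom c' `&` chart_dom c)) (trans c c').
Proof. by move=> ac ac'; rewrite setIC; apply: atlas_smooth. Qed.

Lemma trans_diff c c' x : atlas c -> atlas c' -> chart_dom c x ->
  chart_dom c' x -> differentiable (trans c c') (c x).
Proof.
by move=> ac ac' dx dx'; apply: (smooth_diff (trans_smooth ac ac')); exists x.
Qed.

Lemma trans_val c c' x : atlas c -> chart_dom c x -> trans c c' (c x) = c' x.
Proof. by move=> ac dx; rewrite /trans /= (chart_funK (atlas_chart ac)). Qed.

Lemma tchange_id c x v : atlas c -> chart_dom c x -> tchange c c x v = v.
Proof.
move=> ac dx; rewrite /tchange -[RHS](derive_id (c x) v).
apply: near_eq_derive.
have := open_nbhs_nbhs (conj (chart_img_open (atlas_chart ac)) (ex_intro2 _ _ x dx erefl)).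
by apply: filterS => _ [y dy <-] /=; rewrite (chart_funK (atlas_chart ac)).
Qed.

(** The chain rule for the transition maps. *)
Lemma tchange_comp c c' c'' x v : atlas c -> atlas c' -> atlas c'' ->
  chart_dom c x -> chart_dom c' x -> chart_dom c'' x ->
  tchange c' c'' x (tchange c c' x v) = tchange c c'' x v.
Proof.
move=> ac ac' ac'' dx dx' dx''; rewrite /tchange.
have d1 := trans_diff ac ac' dx dx'; have d2 := trans_diff ac' ac'' dx' dx''.
have E0 : (c' \o chart_inv c) (c x) = c' x by exact: trans_val.
rewrite -{}E0 in d2 *; rewrite -(derive_comp v d1 d2).
apply: near_eq_derive.
have : \forall y \near x, chart_dom c' y.
  by apply: open_nbhs_nbhs; split=> //; apply: chart_dom_open (atlas_chart ac').
move=> /(chart_inv_near ac dx); apply: filterS => z dz.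
by rewrite /trans /= (chart_funK (atlas_chart ac')).
Qed.

Lemma field_inE c X y : atlas c -> chart_dom c y ->
  field_in c X (c y) = tchange (chart_at y) c y (X y).
Proof. by move=> ac dy; rewrite /field_in (chart_funK (atlas_chart ac)). Qed.

Lemma field_in_trans c c' X y : atlas c -> atlas c' -> chart_dom c y ->
  chart_dom c' y -> field_in c' X (c' y) = tchange c c' y (field_in c X (c y)).
Proof.
move=> ac ac' dy dy'; rewrite !field_inE // tchange_comp //.
  exact: chart_at_atlas.
exact: chart_at_dom.
Qed.

Lemma ext_at x v : ext x v x = v.
Proof. by rewrite /ext tchange_id //; [exact: chart_at_atlas|exact: chart_at_dom]. Qed.

Lemma field_in_ext x v z : ((chart_at x) @` chart_dom (chart_at x)) z ->
  field_in (chart_at x) (ext x v) z = v.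
Proof.
case=> y dy <-; have ax := chart_at_atlas x; have ay := chart_at_atlas y.
rewrite field_inE // /ext tchange_comp //; last exact: chart_at_dom.
exact: tchange_id.
Qed.

(** The components of a field in another chart are those in c multiplied by
    the Jacobian matrix of the transition map; hence one chart around each
    point is enough. *)
Lemma smooth_field_chart U X :
  (forall x, U x -> exists c V, [/\ atlas c, chart_dom c x, open V, V x &
     smooth_on (c @` (V `&` chart_dom c)) (field_in c X)]) -> smooth_field U X.
Proof.
move=> H c' ac'; apply: smooth_local => z [x [Ux dx'] <-].
have [c [V [ac dx oV Vx sX]]] := H x Ux.
pose W := V `&` chart_dom c.
have oc : open (chart_dom c) by exact: chart_dom_open (atlas_chart ac).
have oc' : open (chart_dom c') by exact: chart_dom_open (atlas_chart ac').
have oW : open W by apply: openI.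
have oW' := open_image ac' oW; have oWc := open_image ac oV.
have oWcc : open (c @` (W `&` chart_dom c' `&` chart_dom c)).
  by apply: open_image => //; apply: openI.
exists (c' @` (W `&` chart_dom c')); first by exists x.
apply/(smooth_mxP oW') => i j; rewrite [j]ord1.
have s1 : smooth_on (c' @` (W `&` chart_dom c')) (trans c' c).
  apply: smooth_sub (trans_smooth ac' ac).
  by move=> _ [y [[Vy dy] dy'] <-]; exists y.
have m1 z' : (c' @` (W `&` chart_dom c')) z' ->
    (c @` (W `&` chart_dom c' `&` chart_dom c)) (trans c' c z').
  by case=> y [[Vy dy] dy'] <-; exists y => //; rewrite trans_val.
apply: (@smooth_eq _ _ _ oW' _
  (fun z => \sum_k (field_in c X (trans c' c z)) k 0 *
       ('D_(delta_mx k 0) (trans c c') (trans c' c z)) i 0 : R^o)).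
  move=> _ [y [[Vy dy] dy'] <-]; rewrite (field_in_trans X ac ac') //.
  rewrite trans_val // /tchange derive_basis; last exact: trans_diff.
  by rewrite summxE; apply: eq_bigr => k _; rewrite mxE.
apply: smooth_sum => // k _; apply: smooth_mul => //.
  apply: (smooth_comp (f := fun z => field_in c X z k 0) oW' oWcc m1 s1).
  apply: smooth_entry => //; apply: smooth_sub sX.
  by move=> _ [y [[[Vy _] _] dy] <-]; exists y.
apply: (smooth_comp (f := fun z => 'D_(delta_mx k 0) (trans c c') z i 0) oW' oWcc m1 s1).
apply: smooth_entry => //; apply: smooth_derive.
apply: smooth_sub (trans_smooth ac ac').
by move=> _ [y [[_ dy'] dy] <-]; exists y.
Qed.

Lemma smooth_fieldS U V X : V `<=` U -> smooth_field U X -> smooth_field V X.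
Proof.
move=> VU sX c ac; apply: smooth_sub (sX c ac).
by move=> _ [y [Vy dy] <-]; exists y => //; split=> //; apply: VU.
Qed.

Lemma smooth_ext x v : smooth_field (chart_dom (chart_at x)) (ext x v).
Proof.
apply: smooth_field_chart => y dy; exists (chart_at x), (chart_dom (chart_at x)).
split=> //; [exact: chart_at_atlas|exact: chart_at_open|].
rewrite setIid.
have := chart_img_open (atlas_chart (chart_at_atlas x)) => oi.
apply: (@smooth_eq _ _ _ oi _ (fun=> v)); last exact: smooth_cst.
by move=> z zi; rewrite field_in_ext.
Qed.

Definition smooth_map U m n (F : M -> 'M[R]_(m, n)) : Prop :=
  forall c, atlas c -> smooth_mx (c @` (U `&` chart_dom c)) (F \o chart_inv c).

Lemma smooth_map_fun U m n (F : M -> 'M[R]_(m, n)) :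
  smooth_map U F <-> forall i j, smooth_fun U (fun y => F y i j).
Proof. by split=> [sF i j c ac|sF c ac i j]; apply: sF. Qed.

Lemma smooth_fun_near_of U x (f : M -> R) : open U -> U x -> smooth_fun U f ->
  smooth_fun_near x f.
Proof. by move=> oU Ux sf; exists U. Qed.

Lemma smooth_field_near_of U x X : open U -> U x -> smooth_field U X ->
  smooth_field_near x X.
Proof. by move=> oU Ux sf; exists U. Qed.

Section OnOpen.
Variables (U : set M) (oU : open U).

Lemma smooth_map_cst m n (A : 'M[R]_(m, n)) : smooth_map U (fun=> A).
Proof. by move=> c ac i j; apply: smooth_cst. Qed.

Lemma smooth_map_mul m n p (F : M -> 'M[R]_(m, n)) (G : M -> 'M[R]_(n, p)) :
  smooth_map U F -> smooth_map U G -> smooth_map U (fun y => F y *m G y).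
Proof.
by move=> sF sG c ac; apply: smooth_mulmx; [exact: open_image|exact: sF|exact: sG].
Qed.

Lemma smooth_field_eq X Y :
  (forall y, U y -> X y = Y y) -> smooth_field U X -> smooth_field U Y.
Proof.
move=> XY sX c ac; apply: smooth_eq (sX c ac); first exact: open_image.
by move=> z /(chart_image ac)[Uz _ _]; rewrite /field_in XY.
Qed.

End OnOpen.

(** Tangent vectors at y are given by their components in the chart at y; this
    matrix converts them to components in c. *)
Definition tmx c y : 'M[R]_d :=
  \matrix_(i, j) (tchange (chart_at y) c y (delta_mx j 0)) i 0.

Lemma tmxE c y v : atlas c -> chart_dom c y ->
  tchange (chart_at y) c y v = tmx c y *m v.
Proof.
move=> ac dy; have ay := chart_at_atlas y.
have dt := trans_diff ay ac (chart_at_dom y) dy.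
apply/colP => i; rewrite /tchange (derive_basis _ dt) summxE mxE.
by apply: eq_bigr => j _; rewrite !mxE mulrC.
Qed.

Lemma tmx_unit c y : atlas c -> chart_dom c y -> tmx c y \in unitmx.
Proof.
move=> ac dy; have ay := chart_at_atlas y; have dy' := chart_at_dom y.
pose N : 'M[R]_d := \matrix_(i, j) (tchange c (chart_at y) y (delta_mx j 0)) i 0.
suff H : N *m tmx c y = 1%:M by case/mulmx1_unit: H.
apply/matrixP => i j.
have -> : (N *m tmx c y) i j = (N *m (tmx c y *m (delta_mx j 0 : 'cV_d))) i 0.
  by rewrite mulmxA -colE [RHS]mxE.
have NE v : N *m v = tchange c (chart_at y) y v.
  apply/colP => k; rewrite /tchange (derive_basis _ (trans_diff ac ay dy dy')).
  by rewrite summxE mxE; apply: eq_bigr => l _; rewrite !mxE mulrC.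
by rewrite NE -tmxE // tchange_comp // tchange_id // !mxE andbT.
Qed.

Lemma field_in_tmx c X y : atlas c -> chart_dom c y ->
  field_in c X (c y) = tmx c y *m X y.
Proof. by move=> ac dy; rewrite field_inE // tmxE. Qed.

Lemma smooth_field_add U X Y : open U -> smooth_field U X -> smooth_field U Y ->
  smooth_field U (fun y => X y + Y y).
Proof.
move=> oU sX sY c ac; have oi := open_image ac oU.
apply: (@smooth_eq _ _ _ oi _ (fun z => field_in c X z + field_in c Y z)).
  move=> _ [y [Uy dy] <-]; rewrite !field_in_tmx // mulmxDr //.
by apply: smooth_add => //; [exact: sX|exact: sY].
Qed.

Lemma smooth_field_scale U f X : open U -> smooth_fun U f -> smooth_field U X ->
  smooth_field U (fun y => f y *: X y).
Proof.
move=> oU sf sX c ac; have oi := open_image ac oU.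
apply/(smooth_mxP oi) => i j.
apply: (@smooth_eq _ _ _ oi _ (fun z => f (chart_inv c z) * field_in c X z i j : R^o)).
  move=> _ [y [Uy dy] <-]; rewrite !field_in_tmx // -scalemxAr.
  by rewrite (chart_funK (atlas_chart ac)) // !mxE.
by apply: smooth_mul => //; [exact: sf|apply: smooth_entry => //; exact: sX].
Qed.

Lemma smooth_field0 U : open U -> smooth_field U (fun=> 0).
Proof.
move=> oU c ac; apply: (@smooth_eq _ _ _ (open_image ac oU) _ (fun=> 0)).
  by move=> _ [y [Uy dy] <-]; rewrite field_in_tmx // mulmx0.
exact: smooth_cst.
Qed.

(** By the chain rule, since [ext x v y] is the image of v under the
    differential of the transition map to the chart at y. *)
Lemma dfun_ext U f x y v : open U -> U y -> chart_dom (chart_at x) y ->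
  smooth_fun U f ->
  dfun f y (ext x v y) = 'D_v (f \o chart_inv (chart_at x) : E -> R^o) (chart_at x y).
Proof.
move=> oU Uy dy sf; have ax := chart_at_atlas x; have ay := chart_at_atlas y.
have dyy := chart_at_dom y.
have E0 := trans_val (chart_at y) ax dy.
have dt := trans_diff ax ay dy dyy.
have df : differentiable (f \o chart_inv (chart_at y) : E -> R^o) (chart_at y y).
  by apply: (smooth_diff (sf _ ay)); exists y.
rewrite -E0 in df; rewrite /dfun /ext /tchange -[in LHS]E0 -(derive_comp v dt df).
apply: near_eq_derive.
have : \forall p \near y, chart_dom (chart_at y) p.
  by apply: open_nbhs_nbhs; split=> //; apply: chart_at_open.
move=> /(chart_inv_near ax dy); apply: filterS => z dz.
by rewrite /trans /= (chart_funK (atlas_chart ay)).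
Qed.

End Charts.

(** * One-forms and their exterior derivative *)

Section OneForms.
Variables (R : realType) (d : nat) (M : manifold R d).
Notation E := 'cV[R]_d.
Implicit Types (x y : M) (U V : set M).

(** Smoothness is tested on smooth vector fields, so that no chart occurs. *)
Record is_form U m n (w : M -> E -> 'M[R]_(m, n)) : Prop := IsForm {
  form_linear : forall y, U y -> linear (w y);
  form_smooth : forall V X, open V -> V `<=` U -> smooth_field V X ->
    smooth_map V (fun y => w y (X y)) }.

Lemma is_formS U V m n (w : M -> E -> 'M[R]_(m, n)) :
  V `<=` U -> is_form U w -> is_form V w.
Proof.
move=> VU [lw sw]; split=> [y /VU /lw //|V' X oV' V'V].
by apply: sw => //; apply: subset_trans VU.
Qed.

(** The coefficient of a one-form along the coordinate direction v of the
    chart at x, as a function on that chart. *)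
Definition pull m n (w : M -> E -> 'M[R]_(m, n)) x (v z : E) : 'M[R]_(m, n) :=
  let y := chart_inv (chart_at x) z in w y (ext x v y).

Definition chart_set U x : set E := chart_at x @` (U `&` chart_dom (chart_at x)).

Lemma chart_set_open U x : open U -> open (chart_set U x).
Proof. exact: open_image (chart_at_atlas x). Qed.

Lemma chart_setI U x y : U y -> chart_dom (chart_at x) y ->
  chart_set U x (chart_at x y).
Proof. by move=> Uy dy; exists y. Qed.

Lemma chart_set_at U x : U x -> chart_set U x (chart_at x x).
Proof. by move=> Ux; apply: chart_setI => //; apply: chart_at_dom. Qed.

Lemma pullE m n (w : M -> E -> 'M[R]_(m, n)) x v y :
  chart_dom (chart_at x) y -> pull w x v (chart_at x y) = w y (ext x v y).
Proof. by move=> dy; rewrite /pull (chart_funK (atlas_chart (chart_at_atlas x))). Qed.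

Variables (U : set M) (oU : open U).

Lemma pull_smooth m n (w : M -> E -> 'M[R]_(m, n)) x v : is_form U w ->
  smooth_mx (chart_set U x) (pull w x v).
Proof.
move=> fw; have ax := chart_at_atlas x.
have oV : open (U `&` chart_dom (chart_at x)).
  by apply: openI => //; apply: chart_at_open.
have := @form_smooth _ _ _ w fw (U `&` chart_dom (chart_at x)) (ext x v) oV.
move=> /(_ (@subIsetl _ _ _)) /(_ _ _ ax).
rewrite -setIA setIid; apply.
exact: smooth_fieldS (@subIsetr _ _ _) (smooth_ext x v).
Qed.

Lemma form_sum m n (w : M -> E -> 'M[R]_(m, n)) y (a : E) (f : 'I_d -> E) :
  is_form U w -> U y -> w y (\sum_i a i 0 *: f i) = \sum_i a i 0 *: w y (f i).
Proof.
move=> fw Uy; have lw := form_linear fw Uy.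
pose L := GRing.isLinear.Build R E 'M[R]_(m, n) *:%R (w y) lw.
pose W : {linear E -> 'M[R]_(m, n)} := HB.pack (w y) L.
by rewrite -[w y]/(W : E -> _) linear_sum; apply: eq_bigr => i _; rewrite linearZ.
Qed.

(** The coordinate fields of the chart at x are combinations of those of the
    chart at y, with coefficients the Jacobian matrix of the transition map. *)
Lemma pull_trans m n (w : M -> E -> 'M[R]_(m, n)) x y p v : is_form U w -> U p ->
  chart_dom (chart_at x) p -> chart_dom (chart_at y) p ->
  let phi := trans (chart_at x) (chart_at y) in let z := chart_at x p in
  pull w x v z = \sum_i ('D_v phi z) i 0 *: pull w y (delta_mx i 0) (phi z).
Proof.
move=> fw Up dx dy phi z; have ax := chart_at_atlas x; have ay := chart_at_atlas y.
have ap := chart_at_atlas p; have dp := chart_at_dom p.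
rewrite /phi /z trans_val // !pullE //.
under eq_bigr do rewrite pullE //.
rewrite -(form_sum _ _ fw Up); congr (w p _).
rewrite /ext -(tchange_comp _ ax ay ap) //.
rewrite [in LHS]/tchange (derive_basis _ (trans_diff ay ap dy dp)).
apply: eq_bigr => i _; rewrite [chart_at x p]/= -[trans _ _]/(_ \o _) //.
Qed.

(** The terms with second derivatives of the transition map cancel by
    symmetry, so an exterior derivative may be computed at each point y in the
    chart at y. The torsion and the curvature at y are defined through that
    chart. *)
Lemma exterior_chart m n (w : M -> E -> 'M[R]_(m, n)) x y u v : is_form U w ->
  U y -> chart_dom (chart_at x) y ->
  let u' := ext x u y in let v' := ext x v y in
  DM u (pull w x v) (chart_at x y) - DM v (pull w x u) (chart_at x y) =
  DM u' (pull w y v') (chart_at y y) - DM v' (pull w y u') (chart_at y y).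
Proof.
move=> fw Uy dx u' v'; have ax := chart_at_atlas x; have ay := chart_at_atlas y.
have dyy := chart_at_dom y.
pose phi := trans (chart_at x) (chart_at y).
pose V := U `&` chart_dom (chart_at y).
have oV : open V by apply: openI => //; apply: chart_at_open.
have oVx := @chart_set_open V x oV; have oUy := @chart_set_open U y oU.
set zx := chart_at x y; set zy := chart_at y y.
have Vzx : chart_set V x zx by apply: chart_setI.
have Uzy : chart_set U y zy by apply: chart_set_at.
have phiz : phi zx = zy by apply: trans_val.
have sphi : smooth_on (chart_set V x) phi.
  apply: smooth_sub (trans_smooth ax ay).
  by move=> _ [p [[_ ?] ?] <-]; exists p.
have m1 z : chart_set V x z -> chart_set U y (phi z).
  by case=> p [[Up py] px] <-; exists p => //; rewrite /phi trans_val.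
have dphi : differentiable phi zx by apply: smooth_diff Vzx.
apply/matrixP => i j.
pose b k z : R := pull w y (delta_mx k 0) z i j.
have sb k : smooth_on (chart_set U y) (b k : E -> R^o) by exact: pull_smooth.
have db k : differentiable (b k : E -> R^o) zy by exact: smooth_diff (sb k) Uzy.
have da k a : smooth_on (chart_set V x) (fun z => ('D_a phi z) k 0 : R^o).
  by apply: smooth_entry => //; apply: smooth_derive.
have dda k a : differentiable (fun z => ('D_a phi z) k 0 : R^o) zx.
  exact: smooth_diff (da k a) Vzx.
have dbp k : differentiable (b k \o phi : E -> R^o) zx.
  by apply: (differentiable_comp dphi); rewrite phiz.
(* Product and chain rule for the components in the chart at x, expressed
   through the components b in the chart at y. *)
have Dx a c : DM a (pull w x c) zx i j =
    \sum_k (('D_c phi zx) k 0 * 'D_('D_a phi zx) (b k : E -> R^o) zy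
           + b k zy * 'D_a (fun z => ('D_c phi z) k 0 : R^o) zx).
  rewrite mxE.
  rewrite (near_eq_derive _ (g := \sum_k
     ((fun z => ('D_c phi z) k 0 : R^o) * (b k \o phi)))); last first.
    have := open_nbhs_nbhs (conj oVx Vzx); apply: filterS => _ [p [[Up py] px] <-].
    rewrite (pull_trans c fw Up px py) summxE fct_sumE.
    by apply: eq_bigr => k _; rewrite mxE.
  rewrite derive_sum; last first.
    by move=> k; apply: derivableM; apply: diff_derivable.
  apply: eq_bigr => k _; rewrite deriveM; try exact: diff_derivable.
  have dbz : differentiable (b k : E -> R^o) (phi zx) by rewrite phiz.
  by rewrite (derive_comp a dphi dbz) /= phiz.
have uE : 'D_u phi zx = u' by [].
have vE : 'D_v phi zx = v' by [].
have Dy a c : DM a (pull w y c) zy i j = \sum_k c k 0 * 'D_a (b k : E -> R^o) zy.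
  rewrite mxE (near_eq_derive _ (g := \sum_k (c k 0 *: (b k : E -> R^o)))); last first.
    have := open_nbhs_nbhs (conj oUy Uzy); apply: filterS => _ [p [Up py] <-].
    rewrite (pull_trans c fw Up py py) summxE fct_sumE.
    apply: eq_bigr => k _; rewrite mxE /b trans_val //; congr (_ * _).
    by rewrite -[in RHS](tchange_id c ay py).
  rewrite derive_sum; last by move=> k; apply: derivableZ; apply: diff_derivable.
  by apply: eq_bigr => k _; rewrite deriveZ //; apply: diff_derivable.
have sub_entry (A B : 'M[R]_(m, n)) : (A - B) i j = A i j - B i j by rewrite !mxE.
have sub_eq (a a' c c' : R) : a = c -> a' = c' -> a - a' = c - c' by move=> -> ->.
apply: etrans (sub_entry _ _) _; apply: etrans (sub_eq _ _ _ _ (Dx u v) (Dx v u)) _.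
apply/esym; apply: etrans (sub_entry _ _) _.
apply: etrans (sub_eq _ _ _ _ (Dy u' v') (Dy v' u')) _; apply/esym.
rewrite uE vE.
have sch k : 'D_u (fun z => ('D_v phi z) k 0 : R^o) zx =
             'D_v (fun z => ('D_u phi z) k 0 : R^o) zx.
  have sk : smooth_on (chart_set V x) (fun z => phi z k 0 : R^o).
    exact: smooth_entry.
  have De a c : 'D_a (fun z => ('D_c phi z) k 0 : R^o) zx =
                'D_a ('D_c (fun z => phi z k 0 : R^o)) zx.
    apply: near_eq_derive; have := open_nbhs_nbhs (conj oVx Vzx).
    apply: filterS => z Vz; apply: derive_entry; exact: smooth_diff sphi Vz.
  by rewrite !De; exact: (schwarz u v oVx Vzx (sk 2%N)).
have cancel (p q e r r' : R) : r = r' -> p + e * r - (q + e * r') = p - q.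
  by move=> ->; rewrite opprD addrACA subrr addr0.
rewrite -!sumrB; apply: eq_bigr => k _; exact: cancel (sch k).
Qed.

End OneForms.

(** * Connections in a moving frame *)

Section Frames.
Variables (R : realType) (d : nat) (M : manifold R d).
Notation E := 'cV[R]_d.
Notation field := (M -> 'cV[R]_d).
Implicit Types (x y : M) (U V : set M) (X Y : M -> 'cV[R]_d).

Record is_frame U (s : M -> 'M[R]_d) : Prop := IsFrame {
  frame_open : open U;
  frame_unit : forall y, U y -> s y \in unitmx;
  frame_smooth : forall w : E, smooth_field U (fun y => s y *m w) }.

Variables (U : set M) (s : M -> 'M[R]_d) (fs : is_frame U s).

Let frame_in (c : chart R d M) z : 'M[R]_d :=
  \matrix_(i, j) (field_in c (fun y => s y *m delta_mx j 0) z) i 0.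

Let frame_inE c y : atlas c -> chart_dom c y -> frame_in c (c y) = tmx c y *m s y.
Proof.
move=> ac dy; apply/matrixP => i j; rewrite mxE field_in_tmx //.
by rewrite mulmxA -colE mxE.
Qed.

Let frame_in_smooth c V : atlas c -> V `<=` U -> open V ->
  smooth_mx (c @` (V `&` chart_dom c)) (frame_in c).
Proof.
move=> ac VU oV i j; under eq_fun do rewrite mxE.
apply: smooth_entry; first exact: open_image.
by apply: smooth_fieldS (frame_smooth fs (delta_mx j 0)) _ _.
Qed.

(** Coordinates in the frame are found by inverting the matrix of the frame in
    a chart. *)
Lemma coord_smooth V X : open V -> V `<=` U -> smooth_field V X ->
  smooth_map V (fun y => invmx (s y) *m X y).
Proof.
move=> oV VU sX c ac; have oi := open_image ac oV.
have uF z : (c @` (V `&` chart_dom c)) z -> frame_in c z \in unitmx.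
  case=> y [Vy dy] <-; rewrite frame_inE // unitmx_mul tmx_unit //.
  exact: frame_unit (VU _ Vy).
move=> i j; apply: (@smooth_eq _ _ _ oi _
  (fun z => (invmx (frame_in c z) *m field_in c X z) i j : R^o)).
  move=> _ [y [Vy dy] <-]; have us := frame_unit fs (VU _ Vy).
  have ut := tmx_unit ac dy.
  rewrite /= (chart_funK (atlas_chart ac)) // frame_inE // field_in_tmx //.
  rewrite (_ : invmx (tmx c y *m s y) = invmx (s y) *m invmx (tmx c y)).
    by rewrite -mulmxA (mulmxA (invmx (tmx c y))) mulVmx // mul1mx.
  have u2 : tmx c y *m s y \in unitmx by rewrite unitmx_mul ut us.
  apply: (can_inj (mulKmx u2)); rewrite mulmxV // -mulmxA (mulmxA (s y)).
  by rewrite mulmxV // mul1mx mulmxV.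
apply: (smooth_mulmx oi); first by apply: smooth_invmx => //; apply: frame_in_smooth.
by apply/(smooth_mxP oi); apply: sX.
Qed.

Lemma frame_comb_smooth V (F : M -> E) : open V -> V `<=` U -> smooth_map V F ->
  smooth_field V (fun y => s y *m F y).
Proof.
move=> oV VU sF c ac; have oi := open_image ac oV.
apply: (@smooth_eq _ _ _ oi _ (fun z => frame_in c z *m F (chart_inv c z))).
  move=> _ [y [Vy dy] <-]; rewrite frame_inE // field_in_tmx //.
  by rewrite (chart_funK (atlas_chart ac)) // mulmxA.
apply/(smooth_mxP oi); apply: smooth_mulmx => //; first exact: frame_in_smooth.
exact: sF.
Qed.

Lemma coord_form : is_form U (fun y v => invmx (s y) *m v).
Proof.
split=> [y Uy a u v|V X oV VU sX]; first by rewrite mulmxDr scalemxAr.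
exact: coord_smooth.
Qed.

Variables (nabla : connection M) (hn : is_connection nabla).

Lemma conn0 x v : nabla x v (fun=> 0) = 0.
Proof.
have s0 : smooth_field_near x (fun=> 0 : E).
  by exists setT; split=> //; [exact: openT|apply: smooth_field0; exact: openT].
have := conn_add hn v s0 s0; rewrite (_ : (fun _ => _) = (fun=> 0)).
  by move=> /eqP; rewrite -subr_eq subrr eq_sym => /eqP.
by rewrite funeqE => y; rewrite addr0.
Qed.

Lemma conn0v x Y : smooth_field_near x Y -> nabla x 0 Y = 0.
Proof.
move=> sY; have := conn_linear hn sY 1 0 0; rewrite scale1r addr0 => /eqP.
by rewrite scale1r -subr_eq subrr eq_sym => /eqP.
Qed.

Lemma conn_sum (I : Type) (r : seq I) (f : I -> M -> R) (Y : I -> field) V x v :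
  open V -> V x -> (forall i, smooth_fun V (f i)) ->
  (forall i, smooth_field V (Y i)) ->
  smooth_field V (fun y => \sum_(i <- r) f i y *: Y i y) /\
  nabla x v (fun y => \sum_(i <- r) f i y *: Y i y) =
  \sum_(i <- r) (dfun (f i) x v *: Y i x + f i x *: nabla x v (Y i)).
Proof.
move=> oV Vx sf sY; elim: r => [|i r [IH1 IH2]].
  rewrite big_nil (_ : (fun _ => _) = (fun=> 0)); last first.
    by rewrite funeqE => y; rewrite big_nil.
  by rewrite conn0; split=> //; apply: smooth_field0.
have -> : (fun y => \sum_(j <- i :: r) f j y *: Y j y) =
          (fun y => f i y *: Y i y + \sum_(j <- r) f j y *: Y j y).
  by rewrite funeqE => y; rewrite big_cons.
have s1 := smooth_field_scale oV (sf i) (sY i).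
split; first exact: smooth_field_add.
rewrite big_cons -IH2 (conn_add hn v (smooth_field_near_of oV Vx s1)
  (smooth_field_near_of oV Vx IH1)).
by rewrite (conn_leibniz hn v (smooth_fun_near_of oV Vx (sf i))
  (smooth_field_near_of oV Vx (sY i))).
Qed.

Definition dmap m n (F : M -> 'M[R]_(m, n)) x v : 'M[R]_(m, n) :=
  \matrix_(i, j) dfun (fun y => F y i j) x v.

(** The connection form of the moving frame s. *)
Definition cmx x v : 'M[R]_d :=
  \matrix_(i, j) (invmx (s x) *m nabla x v (fun y => s y *m delta_mx j 0)) i 0.

(** The Leibniz rule, applied to the expansion of F in the frame. *)
Lemma conn_frame V (F : M -> E) x v : open V -> V `<=` U -> V x -> smooth_map V F ->
  nabla x v (fun y => s y *m F y) = s x *m (dmap F x v + cmx x v *m F x).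
Proof.
move=> oV VU Vx sF.
have -> : (fun y => s y *m F y) =
          (fun y => \sum_j F y j 0 *: (s y *m delta_mx j 0)).
  rewrite funeqE => y; rewrite [F y in LHS]matrix_sum_delta mulmx_sumr.
  by apply: eq_bigr => j _; rewrite big_ord1 scalemxAr.
have [_ ->] := @conn_sum _ (index_enum 'I_d) (fun j y => F y j 0)
  (fun j y => s y *m delta_mx j 0) V x v oV Vx
  (fun j => (smooth_map_fun V F).1 sF j 0)
  (fun j => smooth_fieldS VU (frame_smooth fs (delta_mx j 0))).
rewrite big_split /= mulmxDr; congr (_ + _).
  rewrite [dmap F x v]matrix_sum_delta mulmx_sumr.
  by apply: eq_bigr => j _; rewrite big_ord1 scalemxAr mxE.
rewrite [F x in RHS]matrix_sum_delta !mulmx_sumr; apply: eq_bigr => j _.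
rewrite big_ord1 -!scalemxAr -colE; congr (_ *: _).
have -> : col j (cmx x v) = invmx (s x) *m nabla x v (fun y => s y *m delta_mx j 0).
  by apply/colP => i; rewrite !mxE.
by rewrite mulKVmx //; apply: frame_unit fs _ (VU _ Vx).
Qed.

Lemma dmap_cst m n (A : 'M[R]_(m, n)) x v : dmap (fun=> A) x v = 0.
Proof. by apply/matrixP => i j; rewrite !mxE /dfun derive_cst. Qed.

Lemma cmxE x v w : U x -> nabla x v (fun y => s y *m w) = s x *m (cmx x v *m w).
Proof.
move=> Ux; rewrite (conn_frame v (frame_open fs) (@subset_refl _ U) Ux (@smooth_map_cst _ _ _ U _ _ w)).
by rewrite dmap_cst add0r.
Qed.

Lemma cmx_form : is_form U cmx.
Proof.
have oU := frame_open fs.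
split=> [y Uy a u v|V X oV VU sX].
  apply/matrixP => i j.
  have sY := smooth_field_near_of oU Uy (frame_smooth fs (delta_mx j 0)).
  by rewrite [LHS]mxE (conn_linear hn sY) mulmxDr -scalemxAr !mxE.
apply/smooth_map_fun => i j.
under eq_fun do rewrite mxE.
have sY := smooth_fieldS VU (frame_smooth fs (delta_mx j 0)).
exact: ((smooth_map_fun _ _).1 (coord_smooth oV VU (conn_smooth hn oV sX sY)) i 0).
Qed.

Lemma dmap_ext V m n (F : M -> 'M[R]_(m, n)) x y v : open V -> V y ->
  chart_dom (chart_at x) y -> smooth_map V F ->
  dmap F y (ext x v y) = DM v (F \o chart_inv (chart_at x)) (chart_at x y).
Proof.
move=> oV Vy dy sF; apply/matrixP => i j; rewrite !mxE.
by rewrite (dfun_ext v oV Vy dy ((smooth_map_fun _ _).1 sF i j)).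
Qed.

Definition coord y (v : E) : E := invmx (s y) *m v.

(** Both fields have constant components in the chart at x. *)
Lemma bracket_ext x u v : bracket (ext x u) (ext x v) x = 0.
Proof.
have n0 w w' : 'D_w (field_in (chart_at x) (ext x w')) (chart_at x x) = 0.
  rewrite -(derive_cst w' (chart_at x x) w); apply: near_eq_derive.
  have oi := chart_img_open (atlas_chart (chart_at_atlas x)).
  have := open_nbhs_nbhs (conj oi (ex_intro2 _ _ x (chart_at_dom x) erefl)).
  by apply: filterS => z zi; rewrite field_in_ext.
exact: etrans (congr2 (fun a b : E => a - b) (n0 _ _) (n0 _ _)) (subrr 0).
Qed.

Let dom x := U `&` chart_dom (chart_at x).

Let dom_open x : open (dom x).
Proof. by apply: openI; [exact: frame_open fs|exact: chart_at_open]. Qed.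

Let dom_ext x v : smooth_field (dom x) (ext x v).
Proof. exact: smooth_fieldS (@subIsetr _ _ _) (smooth_ext x v). Qed.

Let dom_coord x v : smooth_map (dom x) (fun y => coord y (ext x v y)).
Proof. by apply: coord_smooth; [exact: dom_open|exact: subIsetl|exact: dom_ext]. Qed.

Let conn_ext_frame x y v (Y : field) : dom x y -> smooth_field (dom x) Y ->
  nabla y (ext x v y) Y =
  s y *m (DM v ((fun p => coord p (Y p)) \o chart_inv (chart_at x)) (chart_at x y)
          + cmx y (ext x v y) *m coord y (Y y)).
Proof.
move=> xy sY; have [Uy dy] := xy.
have sC : smooth_map (dom x) (fun p => coord p (Y p)).
  by apply: coord_smooth => //; exact: subIsetl.
rewrite -(dmap_ext v (dom_open x) xy dy sC).
rewrite -(conn_frame (ext x v y) (dom_open x) (@subIsetl _ _ _) xy sC).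
apply: (conn_local hn); first exact: smooth_field_near_of (dom_open x) xy sY.
have := open_nbhs_nbhs (conj (dom_open x) xy); apply: filterS => p [Up dp].
by rewrite /coord mulKVmx //; apply: frame_unit fs _ Up.
Qed.

(** First structure equation at the centre of a chart: the bracket of the two
    coordinate fields vanishes, and their covariant derivatives are computed
    in the frame. *)
Lemma torsionE x u v : U x -> let z := chart_at x x in
  torsion nabla x u v =
  s x *m (DM u (pull coord x v) z - DM v (pull coord x u) z
          + cmx x u *m coord x v - cmx x v *m coord x u).
Proof.
move=> Ux z; have xx : dom x x by split=> //; apply: chart_at_dom.
rewrite /torsion /torsion_op bracket_ext subr0 !conn_ext_frame // !ext_at.
by rewrite -mulmxBr; congr (_ *m _); rewrite opprD addrACA addrA.
Qed.

(** Second structure equation at the centre of a chart; the second derivatives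
    of the components of the third field cancel by symmetry. *)
Lemma curvatureE x u v w : U x -> let z := chart_at x x in
  curvature nabla x u v w =
  s x *m ((DM u (pull cmx x v) z - DM v (pull cmx x u) z
           + cmx x u *m cmx x v - cmx x v *m cmx x u) *m coord x w).
Proof.
move=> Ux z; have xx : dom x x by split=> //; apply: chart_at_dom.
have oD := @chart_set_open _ _ _ (dom x) x (dom_open x).
have Dz : chart_set (dom x) x z by apply: chart_set_at.
rewrite /curvature /curvature_op bracket_ext conn0v ?subr0; last first.
  exact: smooth_field_near_of (dom_open x) xx (dom_ext x w).
have sN a : smooth_field (dom x) (fun y => nabla y (ext x a y) (ext x w)).
  by apply: (conn_smooth hn) => //; apply: dom_ext.
have sA a : smooth_mx (chart_set (dom x) x) (pull cmx x a).
  exact: (@pull_smooth _ _ _ _ (dom_open x) _ _ _ x a (is_formS (@subIsetl _ _ _) cmx_form)).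
have sW : smooth_mx (chart_set (dom x) x) (pull coord x w).
  exact: dom_coord (chart_at_atlas x).
have main a b : nabla x a (fun y => nabla y (ext x b y) (ext x w)) =
  s x *m (DM a (DM b (pull coord x w)) z + DM a (pull cmx x b) z *m coord x w
    + cmx x b *m DM a (pull coord x w) z
    + cmx x a *m DM b (pull coord x w) z + cmx x a *m (cmx x b *m coord x w)).
  rewrite -{1}(ext_at x a) conn_ext_frame // ext_at; congr (_ *m _).
  have Ex : coord x (nabla x (ext x b x) (ext x w)) =
            DM b (pull coord x w) z + cmx x b *m coord x w.
    rewrite /coord conn_ext_frame // ?ext_at.
    by rewrite mulKmx //; apply: frame_unit fs _ Ux.
  rewrite Ex mulmxDr addrA; congr (_ + _ + _).
  have FG z' : chart_set (dom x) x z' ->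
      ((fun p => coord p (nabla p (ext x b p) (ext x w))) \o chart_inv (chart_at x)) z'
      = DM b (pull coord x w) z' + pull cmx x b z' *m pull coord x w z'.
    case=> y [Uy dy] <-; rewrite /= (chart_funK (atlas_chart (chart_at_atlas x)) dy).
    rewrite /coord conn_ext_frame // mulKmx; last exact: frame_unit fs _ (proj1 Uy).
    by rewrite !pullE.
  rewrite (DM_eq oD a Dz FG).
  rewrite (DM_add a Dz (smooth_DM b sW) (smooth_mulmx oD (sA b) sW)).
  rewrite (DM_mul a Dz (sA b) sW) !pullE ?ext_at; try exact: chart_at_dom.
  by rewrite addrA.
have alg (D P1 P2 Q1 Q2 L1 L2 : E) :
    D + P1 + Q1 + Q2 + L1 - (D + P2 + Q2 + Q1 + L2) = P1 - P2 + L1 - L2.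
  by apply/colP => i; rewrite !mxE; ring.
rewrite !main -mulmxBr; congr (_ *m _).
rewrite !ext_at (DM_schwarz oD v u Dz sW) alg.
by rewrite mulmxBl mulmxDl mulmxBl -!mulmxA.
Qed.

End Frames.

(** * Cartan's structure equations *)

Lemma mx_ext (R : pzRingType) m p (A B : 'M[R]_(m, p)) :
  (forall X : 'cV[R]_p, A *m X = B *m X) -> A = B.
Proof.
move=> AB; apply/matrixP => i j.
have colj (C : 'M[R]_(m, p)) : C i j = (C *m (delta_mx j 0 : 'cV_p)) i 0.
  by rewrite -colE mxE.
by rewrite colj [RHS]colj AB.
Qed.

Section MultilinearDerivative.
Variables (R : realType) (E : normedModType R) (U : set E) (oU : open U).

Lemma linear_basis d (W : lmodType R) (L : 'cV[R]_d -> W) a : linear L ->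
  L a = \sum_k a k 0 *: L (delta_mx k 0).
Proof.
move=> lL; pose LL := GRing.isLinear.Build R 'cV[R]_d W *:%R L lL.
pose L' : {linear 'cV[R]_d -> W} := HB.pack L LL.
rewrite -[L]/(L' : _ -> _) [a in LHS]matrix_sum_delta linear_sum.
by apply: eq_bigr => k _; rewrite big_ord1 linearZ.
Qed.

Lemma linear_entry d m n (L : 'cV[R]_d -> 'M[R]_(m, n)) i j a : linear L ->
  (L a) i j = ((\row_k (L (delta_mx k 0)) i j) *m a) 0 0.
Proof.
move=> lL; rewrite (linear_basis a lL) summxE mxE; apply: eq_bigr => k _.
by rewrite !mxE mulrC.
Qed.

Lemma smooth_lin d m n (L : 'cV[R]_d -> 'M[R]_(m, n)) (f : E -> 'cV[R]_d) :
  linear L -> smooth_mx U f -> smooth_mx U (fun y => L (f y)).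
Proof.
move=> lL sf i j; under eq_fun do rewrite linear_entry //.
by apply: (smooth_mulmx oU) => //; apply: smooth_mx_cst.
Qed.

Lemma DM_lin d m n (L : 'cV[R]_d -> 'M[R]_(m, n)) v (f : E -> 'cV[R]_d) z :
  linear L -> U z -> smooth_mx U f -> DM v (fun y => L (f y)) z = L (DM v f z).
Proof.
move=> lL Uz sf; apply/matrixP => i j; rewrite mxE linear_entry //.
rewrite -(DM_mull v _ Uz sf) mxE.
by congr ('D_v _ z); apply/funext => y; rewrite linear_entry.
Qed.

(** Every entry of B is a product f^T C g with a constant matrix C, to which
    the product rule applies. *)
Lemma DM_bilin d m n (B : 'cV[R]_d -> 'cV[R]_d -> 'M[R]_(m, n)) v
    (f g : E -> 'cV[R]_d) z :
  (forall b, linear (B^~ b)) -> (forall a, linear (B a)) -> U z ->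
  smooth_mx U f -> smooth_mx U g ->
  DM v (fun y => B (f y) (g y)) z = B (DM v f z) (g z) + B (f z) (DM v g z).
Proof.
move=> lB1 lB2 Uz sf sg.
have Bij i j a b : (B a b) i j =
    (a^T *m (\matrix_(k, l) (B (delta_mx k 0) (delta_mx l 0)) i j) *m b) 0 0.
  rewrite (linear_basis a (lB1 b)) summxE -mulmxA mxE; apply: eq_bigr => k _.
  rewrite !mxE (linear_basis b (lB2 _)) summxE; congr (_ * _).
  by apply: eq_bigr => l _; rewrite !mxE mulrC.
apply/matrixP => i j; rewrite [RHS]mxE !Bij.
set C := \matrix_(k, l) _.
have sft : smooth_mx U (fun y => (f y)^T).
  by move=> k l; under eq_fun do rewrite mxE; apply: sf.
have sfC : smooth_mx U (fun y => (f y)^T *m C).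
  by apply: smooth_mulmx => //; apply: smooth_mx_cst.
rewrite -DM_tr -(DM_mulr v C Uz sft).
have -> (X Y : 'M[R]_1) : X 0 0 + Y 0 0 = (X + Y) 0 0 by rewrite mxE.
rewrite -(DM_mul v Uz sfC sg) !mxE.
by congr ('D_v _ z); apply/funext => y; rewrite Bij.
Qed.

End MultilinearDerivative.

Section Structure.
Variables (R : realType) (d : nat) (M : manifold R d).
Notation E := 'cV[R]_d.
Notation field := (M -> 'cV[R]_d).
Variables (G g : set 'M[R]_d) (P : M -> set 'M[R]_d).
Hypotheses (hP : is_Gstructure G P) (g0 : g 0).

Lemma section_frame U s : local_section P U s -> is_frame U s.
Proof.
by case=> oU Ps ss; split=> // y Uy; apply: Gstr_frame hP _ _ (Ps y Uy).
Qed.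

(** Translate a section on the right by the element of G that carries its
    value at x to p. *)
Lemma section_through x p : P x p ->
  exists U s, [/\ local_section P U s, U x & s x = p].
Proof.
move=> Pp; have [U [s [[oU Ps ss] Ux]]] := Gstr_section hP x.
have [h Gh ph] := (Gstr_orbit hP p (Ps x Ux)).1 Pp.
exists U, (fun y => s y *m h); split; [split; [exact: oU| |]|exact: Ux|exact/esym].
  by move=> y Uy; apply/(Gstr_orbit hP _ (Ps y Uy)); exists h.
by move=> w; under eq_fun do rewrite -mulmxA; apply: ss.
Qed.

Lemma frame_at x : exists p, P x p.
Proof. by have [U [s [[oU Ps _] Ux]]] := Gstr_section hP x; exists (s x); apply: Ps. Qed.

Section OneConnection.
Variables (nabla : connection M) (hn : is_connection nabla).
Variables (U : set M) (s : M -> 'M[R]_d) (fs : is_frame U s).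

(** The exterior derivative at y may be computed in the chart at y, and there
    [torsionE] applies. *)
Lemma torsion_structure x y u v : U y -> chart_dom (chart_at x) y ->
  let z := chart_at x y in
  DM u (pull (coord s) x v) z - DM v (pull (coord s) x u) z
  + pull (cmx s nabla) x u z *m pull (coord s) x v z
  - pull (cmx s nabla) x v z *m pull (coord s) x u z
  = coord s y (torsion nabla y (ext x u y) (ext x v y)).
Proof.
move=> Uy dy z; rewrite (exterior_chart (frame_open fs) u v (coord_form fs) Uy dy).
rewrite (torsionE fs hn) // /coord mulKmx; last exact: frame_unit fs _ Uy.
by rewrite !pullE.
Qed.

Lemma curvature_structure x y u v : U y -> chart_dom (chart_at x) y ->
  let z := chart_at x y in forall w,
  (DM u (pull (cmx s nabla) x v) z - DM v (pull (cmx s nabla) x u) z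
  + pull (cmx s nabla) x u z *m pull (cmx s nabla) x v z
  - pull (cmx s nabla) x v z *m pull (cmx s nabla) x u z) *m w
  = coord s y (curvature nabla y (ext x u y) (ext x v y) (s y *m w)).
Proof.
move=> Uy dy z w.
rewrite (exterior_chart (frame_open fs) u v (cmx_form fs hn) Uy dy).
have us := frame_unit fs Uy.
have Kcoord (v0 : E) : coord s y (s y *m v0) = v0 by rewrite /coord mulKmx.
by rewrite (curvatureE fs hn _ _ _ Uy) !Kcoord (pullE _ u dy) (pullE _ v dy).
Qed.

End OneConnection.

(** Cartan's structure equations of a connection with characteristic tensors
    T0, R0 and I0, read in a chart and relative to a section of P: [Sg v] and
    [A v] are the components along the coordinate direction v of the coframe
    and of the connection form. Homogeneity makes the tensors on the right
    constant. *)
Record cartan (T0 : E -> E -> E) (R0 : E -> E -> 'M[R]_d) (I0 : E -> set 'M[R]_d)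
    (O : set E) (Sg : E -> E -> E) (A : E -> E -> 'M[R]_d) : Prop := Cartan {
  cartan_open : open O;
  cartan_coframe_smooth : forall v, smooth_mx O (Sg v);
  cartan_conn_smooth : forall v, smooth_mx O (A v);
  cartan_torsion : forall u v z, O z ->
    DM u (Sg v) z - DM v (Sg u) z + A u z *m Sg v z - A v z *m Sg u z
    = T0 (Sg u z) (Sg v z);
  cartan_curvature : forall u v z, O z ->
    DM u (A v) z - DM v (A u) z + A u z *m A v z - A v z *m A u z
    = R0 (Sg u z) (Sg v z);
  cartan_inner : forall u z, O z -> I0 (Sg u z) (A u z) }.

(** The section s is one of those over which the inner torsion is taken, and
    its connection form is the map written Lambda in the definition. *)
Lemma inner_mem nabla T0 R0 I0 U s y v : is_connection nabla ->
  characteristic_tensors g nabla P T0 R0 I0 -> local_section P U s -> U y ->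
  I0 (coord s y v) (cmx s nabla y v).
Proof.
move=> hn ct ls Uy; have fs := section_frame ls.
have us := frame_unit fs Uy; have [oU Ps _] := ls.
have sv : s y *m coord s y v = v by rewrite /coord mulKVmx.
have : inner_torsion g nabla P y (s y *m coord s y v)
    (s y *m cmx s nabla y v *m invmx (s y)).
  exists U, s, (coord s y v), (cmx s nabla y v); split=> //.
    by move=> w; rewrite sv (cmxE fs hn).
  by exists (cmx s nabla y v) => //; rewrite /coset /= subrr.
rewrite (char_inner ct _ (Ps y Uy)) => -[B IB /(congr1 (fun A => A *m s y))].
by rewrite !mulmxKV // => /(congr1 (mulmx (invmx (s y)))); rewrite !mulKmx // => <-.
Qed.

Lemma cartan_of_section nabla T0 R0 I0 U s x : is_connection nabla ->
  characteristic_tensors g nabla P T0 R0 I0 -> local_section P U s ->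
  cartan T0 R0 I0 (chart_set U x) (pull (coord s) x) (pull (cmx s nabla) x).
Proof.
move=> hn ct ls; have fs := section_frame ls; have [oU Ps _] := ls.
have sE y v : U y -> s y *m coord s y v = v.
  by move=> Uy; rewrite /coord mulKVmx //; apply: frame_unit fs _ Uy.
have Kc y (v : E) : U y -> coord s y (s y *m v) = v.
  by move=> Uy; rewrite /coord mulKmx //; apply: frame_unit fs _ Uy.
split.
- exact: chart_set_open.
- by move=> v; apply: (pull_smooth oU); apply: coord_form.
- by move=> v; apply: (pull_smooth oU); apply: cmx_form.
- move=> u v _ [y [Uy dy] <-]; rewrite (torsion_structure hn fs) //.
  rewrite -{1}(sE y (ext x u y) Uy) -{1}(sE y (ext x v y) Uy).
  by rewrite (char_torsion ct _ _ (Ps y Uy)) (Kc _ _ Uy) (pullE _ u dy) (pullE _ v dy).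
- move=> u v _ [y [Uy dy] <-].
  have H w : (R0 (coord s y (ext x u y)) (coord s y (ext x v y))) *m w =
     coord s y (curvature nabla y (ext x u y) (ext x v y) (s y *m w)).
    rewrite -{2}(sE y (ext x u y) Uy) -{2}(sE y (ext x v y) Uy).
    by rewrite (char_curvature ct _ _ _ (Ps y Uy)) Kc.
  apply: mx_ext => w; rewrite !(pullE (coord s)) // H.
  by rewrite -(curvature_structure hn fs u v Uy dy).
- by move=> u _ [y [Uy dy] <-]; rewrite pullE // pullE //; apply: inner_mem ct ls Uy.
Qed.

(** As p is invertible, every vector of V is a value of the coframe at z; what
    the structure equations imply about the coframe thus holds on all of V. *)
Lemma cartan_exists nabla T0 R0 I0 x p : is_connection nabla ->
  characteristic_tensors g nabla P T0 R0 I0 -> P x p ->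
  exists O Sg A z, [/\ cartan T0 R0 I0 O Sg A, O z & forall v, Sg v z = invmx p *m v].
Proof.
move=> hn ct Pp; have [U [s [ls Ux sx]]] := section_through Pp.
exists (chart_set U x), (pull (coord s) x), (pull (cmx s nabla) x), (chart_at x x).
split; [exact: cartan_of_section|exact: chart_set_at|].
by move=> v; rewrite pullE ?ext_at /coord ?sx //; apply: chart_at_dom.
Qed.

Lemma char_unique nabla T0 R0 I0 T0' R0' I0' :
  characteristic_tensors g nabla P T0 R0 I0 ->
  characteristic_tensors g nabla P T0' R0' I0' ->
  [/\ forall u v, T0 u v = T0' u v, forall u v, R0 u v = R0' u v
    & forall u, I0 u = I0' u].
Proof.
move=> ct ct'; have [x _] := mfd_nonempty M; have [p Pp] := frame_at x.
have up := Gstr_frame hP Pp.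
have inj (a b : E) : p *m a = p *m b -> a = b.
  by move=> /(congr1 (mulmx (invmx p))); rewrite !mulKmx.
split=> [u v|u v|u].
- by apply: inj; rewrite -(char_torsion ct _ _ Pp) -(char_torsion ct' _ _ Pp).
- apply: mx_ext => w; apply: inj.
  by rewrite -(char_curvature ct _ _ _ Pp) -(char_curvature ct' _ _ _ Pp).
- have := char_inner ct u Pp; rewrite (char_inner ct' u Pp) => H.
  have Adinj (C C' : set 'M[R]_d) : Adbar p C = Adbar p C' -> C `<=` C'.
    move=> CC A CA; have : Adbar p C' (p *m A *m invmx p) by rewrite -CC; exists A.
    case=> B CB /(congr1 (fun A => A *m p)); rewrite !mulmxKV //.
    by move=> /(congr1 (mulmx (invmx p))); rewrite !mulKmx // => <-.
  by rewrite eqEsubset; split; apply: Adinj.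
Qed.

End Structure.

(** * Algebra of the Bianchi identities *)

(** Once generalized, the remaining products are atoms whose entries [ring]
    can treat as variables. *)
Ltac abstract_products :=
  repeat match goal with
  | |- context[@mulmx ?R ?m ?n ?p ?X ?Y] =>
      let x := fresh "m" in set x := (@mulmx R m n p X Y); clearbody x
  end.

Ltac mx_expand :=
  try rewrite !(mulmxDl, mulmxDr, mulmxBl, mulmxBr, mulNmx, mulmxN, mulmxA).

(** Matrix identities valid in every noncommutative ring: after expansion into
    monomials, the entries of the monomials are compared as scalars. *)
Ltac mx_ring := mx_expand; abstract_products; apply/matrixP => ? ?; rewrite !mxE; ring.

Section Bianchi.
Variables (R : realType) (d : nat).
Notation E := 'cV[R]_d.

Definition comm (A B : 'M[R]_d) := A *m B - B *m A.

(** The action of an endomorphism, as a derivation, on a tensor with values in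
    endomorphisms. *)
Definition lie_action (A : 'M[R]_d) (R0 : E -> E -> 'M[R]_d) a b : 'M[R]_d :=
  comm A (R0 a b) - R0 (A *m a) b - R0 a (A *m b).

(** Here Au and su stand for the values A_u and Sg_u at a point, DuAv for the
    derivative of A_v along u, xuv for that of Sg_v along u, and a, b, c for
    the second derivatives of the coframe, identified by symmetry. The
    hypotheses are the torsion-free first structure equation and its
    derivatives: in the cyclic sum the second derivatives cancel. *)
Lemma bianchi1_algebra (Au Av Aw DuAv DuAw DvAu DvAw DwAu DwAv : 'M[R]_d)
    (su sv sw xuv xvu xvw xwv xuw xwu a b c : E) :
  xuv - xvu + Au *m sv - Av *m su = 0 ->
  xvw - xwv + Av *m sw - Aw *m sv = 0 ->
  xwu - xuw + Aw *m su - Au *m sw = 0 ->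
  a - b + (DwAu *m sv + Au *m xwv) - (DwAv *m su + Av *m xwu) = 0 ->
  c - a + (DuAv *m sw + Av *m xuw) - (DuAw *m sv + Aw *m xuv) = 0 ->
  b - c + (DvAw *m su + Aw *m xvu) - (DvAu *m sw + Au *m xvw) = 0 ->
  (DwAu - DuAw + Aw *m Au - Au *m Aw) *m sv +
  (DuAv - DvAu + Au *m Av - Av *m Au) *m sw +
  (DvAw - DwAv + Av *m Aw - Aw *m Av) *m su = 0.
Proof.
move=> /(congr1 (mulmx Aw)); rewrite mulmx0 => e1.
move=> /(congr1 (mulmx Au)); rewrite mulmx0 => e2.
move=> /(congr1 (mulmx Av)); rewrite mulmx0 => e3 e4 e5 e6.
rewrite -[RHS](addr0 0) -{1}e4 -[RHS]addr0 -{1}e5 -[RHS]addr0 -{1}e6.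
rewrite -[RHS]addr0 -{1}e1 -[RHS]addr0 -{1}e2 -[RHS]addr0 -{1}e3.
by rewrite addr0; mx_ring.
Qed.

Lemma alt_anti (W : lmodType R) (B : E -> E -> W) a b :
  alternating_bilinear B -> B a b = - B b a.
Proof.
case=> l1 l2 B0; have := B0 (a + b).
have D1 x y z : B (x + y) z = B x z + B y z.
  by have := l1 z 1 x y; rewrite !scale1r.
have D2 x y z : B x (y + z) = B x y + B x z.
  by have := l2 x 1 y z; rewrite !scale1r.
by rewrite D1 !D2 !B0 add0r addr0 => /eqP; rewrite addr_eq0 => /eqP.
Qed.

Lemma lin_add (W : lmodType R) (L : E -> W) a b : linear L -> L (a + b) = L a + L b.
Proof. by move=> l; have := l 1 a b; rewrite !scale1r. Qed.

Lemma lin_scale (W : lmodType R) (L : E -> W) k a : linear L -> L (k *: a) = k *: L a.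
Proof.
move=> l; have L0 : L 0 = 0.
  by have := lin_add 0 0 l; rewrite addr0 => /eqP; rewrite -subr_eq subrr eq_sym => /eqP.
by have := l k a 0; rewrite !addr0 L0 addr0.
Qed.

Lemma lin_opp (W : lmodType R) (L : E -> W) a : linear L -> L (- a) = - L a.
Proof. by move=> l; rewrite -(scaleN1r a) (lin_scale (-1) a l) scaleN1r. Qed.

Lemma lin_sub (W : lmodType R) (L : E -> W) a b : linear L -> L (a - b) = L a - L b.
Proof. by move=> l; rewrite (lin_add a (- b) l) lin_opp. Qed.

Lemma lin_zero (W : lmodType R) (L : E -> W) : linear L -> L 0 = 0.
Proof. by move=> l; rewrite -(subrr 0) (lin_sub 0 0 l) subrr. Qed.

(** Notation as in [bianchi1_algebra], except that a, b, c are second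
    derivatives of the connection form. In the derivative of R0 (Sg_u, Sg_v)
    the first structure equation replaces the derivatives of the coframe,
    which produces the action of the connection form on R0. *)
Lemma bianchi2_algebra (R0 : E -> E -> 'M[R]_d)
    (Au Av Aw DuAv DuAw DvAu DvAw DwAu DwAv a b c : 'M[R]_d)
    (su sv sw xuv xvu xvw xwv xuw xwu : E) :
  alternating_bilinear R0 ->
  xuv - xvu + Au *m sv - Av *m su = 0 ->
  xvw - xwv + Av *m sw - Aw *m sv = 0 ->
  xwu - xuw + Aw *m su - Au *m sw = 0 ->
  DuAv - DvAu + Au *m Av - Av *m Au = R0 su sv ->
  DvAw - DwAv + Av *m Aw - Aw *m Av = R0 sv sw ->
  DwAu - DuAw + Aw *m Au - Au *m Aw = R0 sw su ->
  a - b + (DwAu *m Av + Au *m DwAv) - (DwAv *m Au + Av *m DwAu) =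
    R0 xwu sv + R0 su xwv ->
  c - a + (DuAv *m Aw + Av *m DuAw) - (DuAw *m Av + Aw *m DuAv) =
    R0 xuv sw + R0 sv xuw ->
  b - c + (DvAw *m Au + Aw *m DvAu) - (DvAu *m Aw + Au *m DvAw) =
    R0 xvw su + R0 sw xvu ->
  lie_action Aw R0 su sv + lie_action Au R0 sv sw + lie_action Av R0 sw su = 0.
Proof.
rewrite /lie_action.
move=> alt; have [l1 l2 _] := alt; have anti := alt_anti _ _ alt.
move=> s1 s2 s3 <- <- <- e1 e2 e3.
(* The derivative x of the coframe is replaced by its value from the first
   structure equation. *)
have f (x y p q t : E) : x - y + p - q = 0 -> R0 x t = R0 y t - R0 p t + R0 q t.
  move=> e; have -> : x = y - p + q.
    apply/eqP; rewrite -subr_eq0 -[X in _ == X]e; apply/eqP.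
    by apply/matrixP => i j; rewrite !mxE; ring.
  by have := lin_add (y - p) q (l1 t); have := lin_sub y p (l1 t) => /= -> ->.
move: e1 e2 e3; rewrite (f _ _ _ _ su s2) (f _ _ _ _ sv s3) (f _ _ _ _ sw s1) /comm.
rewrite (anti su xwv) (anti sv xuw) (anti sw xvu).
rewrite (anti su (Aw *m sv)) (anti sv (Au *m sw)) (anti sw (Av *m su)).
move: (R0 xvu sw) (R0 xwv su) (R0 xuw sv) (R0 (Au *m sv) sw) (R0 (Av *m su) sw)
 (R0 (Av *m sw) su) (R0 (Aw *m sv) su) (R0 (Aw *m su) sv) (R0 (Au *m sw) sv).
move=> r1 r2 r3 r4 r5 r6 r7 r8 r9 /eqP; rewrite -subr_eq0 => /eqP e1.
move=> /eqP; rewrite -subr_eq0 => /eqP e2 /eqP; rewrite -subr_eq0 => /eqP e3.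
rewrite -[RHS](addr0 0) -{1}oppr0 -{1}e1 -[RHS]addr0 -{1}oppr0 -{1}e2.
rewrite -[RHS]addr0 -{1}oppr0 -{1}e3 addr0.
by mx_ring.
Qed.

End Bianchi.

(** * Consequences of the structure equations *)

Section CartanConsequences.
Variables (R : realType) (d : nat).
Notation E := 'cV[R]_d.

(** The last condition stands for the closedness of g: it is what allows forms
    with values in g to be differentiated. *)
Record lie_algebra (g : set 'M[R]_d) : Prop := LieAlgebra {
  lie0 : g 0;
  lie_linear : forall k A B, g A -> g B -> g (k *: A + B);
  lie_comm : forall A B, g A -> g B -> g (comm A B);
  lie_derive : forall (O : set E) (F : E -> 'M[R]_d) v z, open O -> O z ->
    smooth_mx O F -> (forall y, O y -> g (F y)) -> g (DM v F z) }.

Variables (g : set 'M[R]_d) (hg : lie_algebra g).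
Variables (lam : E -> 'M[R]_d) (hlam : linear lam).
Hypothesis lam_inv : forall A a, g A -> comm A (lam a) = lam (A *m a).

Lemma lie_add A B : g A -> g B -> g (A + B).
Proof. by move=> gA gB; have := lie_linear hg 1 gA gB; rewrite scale1r. Qed.

Lemma lie_opp A : g A -> g (- A).
Proof. by move=> gA; have := lie_linear hg (-1) gA (lie0 hg); rewrite addr0 scaleN1r. Qed.

Lemma lie_sub A B : g A -> g B -> g (A - B).
Proof. by move=> gA gB; apply: lie_add => //; apply: lie_opp. Qed.

Variables (T0 : E -> E -> E) (R0 : E -> E -> 'M[R]_d) (I0 : E -> set 'M[R]_d).
Hypothesis I0E : forall a, I0 a = coset g (lam a).
Variables (O : set E) (Sg : E -> E -> E) (A : E -> E -> 'M[R]_d).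
Hypothesis cA : cartan T0 R0 I0 O Sg A.

(* The part of the connection form with values in g. *)
Let th u z := A u z - lam (Sg u z).

Let th_mem u z : O z -> g (th u z).
Proof. by move=> Oz; have := cartan_inner cA u Oz; rewrite I0E. Qed.

Let sSg v := cartan_coframe_smooth cA v.
Let sA v := cartan_conn_smooth cA v.
Let oO := cartan_open cA.

(** Write the connection form as lam (Sg) + theta, where theta takes values in
    g. So does the expression d theta + [theta, theta]; and as lam is
    equivariant, the terms that mix lam and theta cancel when the first
    structure equation is inserted in lam. *)
Lemma curvature_mod_lie u v z : O z -> let a := Sg u z in let b := Sg v z in
  g (R0 a b - comm (lam a) (lam b)
     + lam (lam a *m b - lam b *m a - T0 a b)).
Proof.
move=> Oz a b.
have slam w : smooth_mx O (fun y => lam (Sg w y)) by apply: smooth_lin.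
have sth w : smooth_mx O (th w).
  exact: smooth_mx_sub.
have Dth w w' : DM w (th w') z = DM w (A w') z - lam (DM w (Sg w') z).
  by rewrite -(DM_lin w hlam Oz (sSg w')) -(DM_sub oO w Oz (sA w') (slam w')).
have gD w w' : g (DM w (th w') z).
  by apply: (lie_derive hg) Oz (sth w') _ => // y; apply: th_mem.
have gu := th_mem u Oz; have gv := th_mem v Oz.
have gth := lie_comm hg gu gv.
have e1 := lam_inv b gu; have e2 := lam_inv a gv.
suff -> : R0 a b - comm (lam a) (lam b) + lam (lam a *m b - lam b *m a - T0 a b)
  = DM u (th v) z - DM v (th u) z + comm (th u z) (th v z).
  by apply: lie_add => //; apply: lie_sub.
rewrite -(cartan_curvature cA u v Oz) -(cartan_torsion cA u v Oz) !Dth.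
rewrite -/a -/b.
have AE w : A w z = lam (Sg w z) + th w z by rewrite /th addrC subrK.
have e3 := lin_sub; rewrite !(AE u) !(AE v) -/a -/b.
set x := DM u (Sg v) z; set y := DM v (Sg u) z.
have -> : lam a *m b - lam b *m a - (x - y + (lam a + th u z) *m b - (lam b + th v z) *m a)
   = - x + y - th u z *m b + th v z *m a.
  by mx_ring.
rewrite (lin_add _ _ hlam) (lin_sub _ _ hlam) (lin_add _ _ hlam) (lin_opp _ hlam).
rewrite -e1 -e2 /comm.
move: (th u z) (th v z) (lam a) (lam b) (lam x) (lam y) (DM u (A v) z) (DM v (A u) z).
by move=> *; mx_ring.
Qed.

Hypothesis T00 : forall a b, T0 a b = 0.

Let struct1 u v y : O y ->
  DM u (Sg v) y - DM v (Sg u) y + A u y *m Sg v y - A v y *m Sg u y = 0.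
Proof. by move=> Oy; rewrite (cartan_torsion cA) // T00. Qed.

(** The exterior derivative of the first structure equation. *)
Lemma cartan_bianchi1 u v w z : O z ->
  R0 (Sg w z) (Sg u z) *m Sg v z + R0 (Sg u z) (Sg v z) *m Sg w z
  + R0 (Sg v z) (Sg w z) *m Sg u z = 0.
Proof.
move=> Oz.
have sDS a b : smooth_mx O (DM a (Sg b)) by apply: smooth_DM.
have sP a b : smooth_mx O (fun y => A a y *m Sg b y) by apply: smooth_mulmx.
have D0 a b c : DM c (DM a (Sg b)) z - DM c (DM b (Sg a)) z
   + (DM c (A a) z *m Sg b z + A a z *m DM c (Sg b) z)
   - (DM c (A b) z *m Sg a z + A b z *m DM c (Sg a) z) = 0.
  rewrite -(DM_mul c Oz (sA a) (sSg b)) -(DM_mul c Oz (sA b) (sSg a)).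
  rewrite -(DM_sub oO c Oz (sDS a b) (sDS b a)).
  rewrite -(DM_add c Oz (smooth_mx_sub oO (sDS a b) (sDS b a)) (sP a b)).
  rewrite -(DM_sub oO c Oz (smooth_mx_add oO (smooth_mx_sub oO (sDS a b) (sDS b a)) (sP a b)) (sP b a)).
  by rewrite (DM_eq oO c Oz (struct1 a b)) DM_cst.
have e1 := D0 u v w; have e2 := D0 v w u; have e3 := D0 w u v.
rewrite (DM_schwarz oO v w Oz (sSg u)) in e3.
rewrite (DM_schwarz oO u w Oz (sSg v)) in e2.
rewrite (DM_schwarz oO v u Oz (sSg w)) in e3.
rewrite -!(cartan_curvature cA) //.
exact: bianchi1_algebra (struct1 u v Oz) (struct1 v w Oz) (struct1 w u Oz) e1 e2 e3.
Qed.

Hypothesis R0_alt : alternating_bilinear R0.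
Hypothesis R0_inv : forall A a b, g A ->
  comm A (R0 a b) = R0 (A *m a) b + R0 a (A *m b).

(** The exterior derivative of the second structure equation. The connection
    form acts on R0 through lam alone, since the invariant tensor R0 is
    annihilated by g. *)
Lemma cartan_bianchi2 u v w z : O z ->
  let a := Sg u z in let b := Sg v z in let c := Sg w z in
  lie_action (lam c) R0 a b + lie_action (lam a) R0 b c + lie_action (lam b) R0 c a = 0.
Proof.
move=> Oz a b c; have [l1 l2 _] := R0_alt.
have sDA u' v' : smooth_mx O (DM u' (A v')) by apply: smooth_DM.
have sP u' v' : smooth_mx O (fun y => A u' y *m A v' y) by apply: smooth_mulmx.
have D0 u' v' w' : DM w' (DM u' (A v')) z - DM w' (DM v' (A u')) z
   + (DM w' (A u') z *m A v' z + A u' z *m DM w' (A v') z)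
   - (DM w' (A v') z *m A u' z + A v' z *m DM w' (A u') z)
   = R0 (DM w' (Sg u') z) (Sg v' z) + R0 (Sg u' z) (DM w' (Sg v') z).
  rewrite -(DM_mul w' Oz (sA u') (sA v')) -(DM_mul w' Oz (sA v') (sA u')).
  rewrite -(DM_sub oO w' Oz (sDA u' v') (sDA v' u')).
  rewrite -(DM_add w' Oz (smooth_mx_sub oO (sDA u' v') (sDA v' u')) (sP u' v')).
  rewrite -(DM_sub oO w' Oz (smooth_mx_add oO (smooth_mx_sub oO (sDA u' v') (sDA v' u')) (sP u' v')) (sP v' u')).
  rewrite -(DM_bilin oO w' l1 l2 Oz (sSg u') (sSg v')).
  by apply: (DM_eq oO w' Oz) => y Oy; exact: (cartan_curvature cA u' v' Oy).
have e1 := D0 u v w; have e2 := D0 v w u; have e3 := D0 w u v.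
rewrite (DM_schwarz oO v w Oz (sA u)) in e3.
rewrite (DM_schwarz oO u w Oz (sA v)) in e2.
rewrite (DM_schwarz oO v u Oz (sA w)) in e3.
have := bianchi2_algebra R0_alt (struct1 u v Oz) (struct1 v w Oz) (struct1 w u Oz)
  (cartan_curvature cA u v Oz) (cartan_curvature cA v w Oz)
  (cartan_curvature cA w u Oz) e1 e2 e3.
have AE w' : A w' z = lam (Sg w' z) + th w' z by rewrite /th addrC subrK.
rewrite !(AE u) !(AE v) !(AE w) -/a -/b -/c.
have main x y e T : g T ->
  lie_action (lam x + T) R0 y e = lie_action (lam x) R0 y e.
  move=> gT; rewrite /lie_action !mulmxDl (lin_add (lam x *m y) (T *m y) (l1 e)).
  rewrite (lin_add (lam x *m e) (T *m e) (l2 y)).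
  have := R0_inv y e gT; rewrite /comm => /eqP; rewrite -subr_eq0 => /eqP E0.
  rewrite -[RHS]addr0 -E0.
  move: (R0 (T *m y) e) (R0 y (T *m e)) (R0 (lam x *m y) e) (R0 y (lam x *m e)).
  by move=> *; mx_ring.
by rewrite (main c a b _ (th_mem w Oz)) (main a b c _ (th_mem u Oz)) (main b c a _ (th_mem v Oz)).
Qed.

End CartanConsequences.

(** * Adding an invariant tensor to a connection *)

(** The left-hand side is the curvature of the connection form A + S0 (Sg),
    where u and v are the values of the coframe and Lu, Lv those of lam. As A
    - L lies in g, which leaves S0 invariant, A may be replaced by L in the
    terms that also contain S0. *)
Lemma shift_algebra (R : realType) d (S0 : 'cV[R]_d -> 'M[R]_d)
    (Au Av Lu Lv D1 D2 : 'M[R]_d) (u v x y : 'cV[R]_d) : linear S0 ->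
  comm (Au - Lu) (S0 v) = S0 ((Au - Lu) *m v) ->
  comm (Av - Lv) (S0 u) = S0 ((Av - Lv) *m u) ->
  D1 + S0 x - (D2 + S0 y) + (Au + S0 u) *m (Av + S0 v) - (Av + S0 v) *m (Au + S0 u)
  = (D1 - D2 + Au *m Av - Av *m Au) + (comm Lu (S0 v) - S0 (Lu *m v))
    - (comm Lv (S0 u) - S0 (Lv *m u)) + S0 (x - y + Au *m v - Av *m u)
    + comm (S0 u) (S0 v).
Proof.
move=> hS0; rewrite !mulmxBl (lin_sub _ _ hS0) (lin_sub (Av *m u) _ hS0).
rewrite (lin_sub _ (Av *m u) hS0) (lin_add _ _ hS0) (lin_sub x y hS0) /comm.
move=> /eqP; rewrite -subr_eq0 => /eqP e1 /eqP; rewrite -subr_eq0 => /eqP e2.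
rewrite -[RHS]addr0 -e1 -[RHS]subr0 -e2.
move: (S0 (Au *m v)) (S0 (Lu *m v)) (S0 (Av *m u)) (S0 (Lv *m u)) => *; mx_ring.
Qed.

Section AddTensor.
Variables (R : realType) (d : nat) (M : manifold R d).
Notation E := 'cV[R]_d.
Variables (G g : set 'M[R]_d) (P : M -> set 'M[R]_d).
Hypotheses (hP : is_Gstructure G P) (hg : lie_algebra g).
Variables (nabla : connection M) (hn : is_connection nabla).
Variables (T0 : E -> E -> E) (R0 : E -> E -> 'M[R]_d) (I0 : E -> set 'M[R]_d).
Hypothesis ct : characteristic_tensors g nabla P T0 R0 I0.
Variables (lam : E -> 'M[R]_d) (hlam : linear lam).
Hypothesis I0E : forall a, I0 a = coset g (lam a).
Variables (S0 : E -> 'M[R]_d) (hS0 : linear S0).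
Hypothesis S0_inv : forall A a, g A -> comm A (S0 a) = S0 (A *m a).
Variables (S : M -> E -> E -> E).
Hypothesis SE : forall x p u v, P x p -> S x (p *m u) (p *m v) = p *m (S0 u *m v).

Let nabla' := add_tensor nabla S.

Let SE' x p u v : P x p -> S x u v = p *m (S0 (invmx p *m u) *m (invmx p *m v)).
Proof.
move=> Pp; have up := Gstr_frame hP Pp.
by rewrite -(SE _ _ Pp) !mulKVmx.
Qed.

Lemma smooth_field_local (U : set M) (X : M -> E) :
  (forall x, U x -> exists V, [/\ open V, V x & smooth_field V X]) ->
  smooth_field U X.
Proof.
move=> H; apply: smooth_field_chart => x /H[V [oV Vx sX]].
exists (chart_at x), V; split=> //; [exact: chart_at_atlas|exact: chart_at_dom|].
exact: sX (chart_at_atlas x).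
Qed.

Lemma add_tensor_connection : is_connection nabla'.
Proof.
have Sadd x u v w : S x u (v + w) = S x u v + S x u w.
  by have [p Pp] := frame_at hP x; rewrite !(SE' _ _ Pp) !mulmxDr.
have Sscale x u k v : S x u (k *: v) = k *: S x u v.
  by have [p Pp] := frame_at hP x; rewrite !(SE' _ _ Pp) -!scalemxAr.
split.
- move=> x Y sY k u v; rewrite /nabla' /add_tensor (conn_linear hn sY).
  have [p Pp] := frame_at hP x; rewrite !(SE' _ _ Pp).
  rewrite (mulmxDr (invmx p)) -scalemxAr hS0 mulmxDl mulmxDr -scalemxAl -scalemxAr.
  by rewrite scalerDr addrACA.
- move=> x v Y Z sY sZ; rewrite /nabla' /add_tensor (conn_add hn v sY sZ) Sadd.
  by rewrite addrACA.
- move=> x v f Y sf sY; rewrite /nabla' /add_tensor (conn_leibniz hn v sf sY) Sscale.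
  by rewrite scalerDr addrA.
- move=> x v Y Z sY YZ; rewrite /nabla' /add_tensor (conn_local hn v sY YZ).
  by rewrite (nbhs_singleton YZ).
- move=> U X Y oU sX sY; apply: (smooth_field_add oU (conn_smooth hn oU sX sY)).
  apply: smooth_field_local => x Ux.
  (* In a section of P the added term has the constant components S0. *)
  have [V [s [ls Vx]]] := Gstr_section hP x.
  have fs := section_frame hP ls; have [oV Ps _] := ls.
  have oW : open (U `&` V) by apply: openI.
  exists (U `&` V); split; [exact: oW|by []|].
  have sX' := coord_smooth fs oW (@subIsetr _ _ _) (smooth_fieldS (@subIsetl _ _ _) sX).
  have sY' := coord_smooth fs oW (@subIsetr _ _ _) (smooth_fieldS (@subIsetl _ _ _) sY).
  apply: (smooth_field_eq oW (X := fun y =>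
     s y *m (S0 (invmx (s y) *m X y) *m (invmx (s y) *m Y y)))).
    by move=> y [_ Vy]; rewrite -(SE' _ _ (Ps y Vy)).
  apply: (frame_comb_smooth fs oW (@subIsetr _ _ _)).
  apply: (smooth_map_mul oW) => // c ac.
  exact: (smooth_lin (open_image ac oW) hS0 (sX' c ac)).
Qed.

Let hn' := add_tensor_connection.

Definition shifted_curvature a b : 'M[R]_d :=
  R0 a b + (comm (lam a) (S0 b) - S0 (lam a *m b))
  - (comm (lam b) (S0 a) - S0 (lam b *m a)) + S0 (T0 a b) + comm (S0 a) (S0 b).

(** In a section of P the connection form changes by S0 (Sg). Since S0 is
    constant, the exterior derivative of this term is given by the first
    structure equation. *)
Lemma add_tensor_curvature x p u v w : P x p ->
  curvature nabla' x (p *m u) (p *m v) (p *m w) = p *m (shifted_curvature u v *m w).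
Proof.
move=> Pp; have [U [s [ls Ux sx]]] := section_through hP Pp.
have fs := section_frame hP ls; have [oU Ps _] := ls.
have us y : U y -> s y \in unitmx by move=> Uy; apply: frame_unit fs _ Uy.
have cE y e : U y -> cmx s nabla' y e = cmx s nabla y e + S0 (coord s y e).
  move=> Uy; apply/matrixP => i j; rewrite [LHS]mxE /nabla' /add_tensor.
  rewrite (SE' _ _ (Ps y Uy)) mulmxDr !mulKmx ?us // -colE.
  rewrite [LHS]mxE [RHS]mxE; congr (_ + _); first by rewrite [RHS]mxE.
  by rewrite mxE.
have cA := cartan_of_section hP (lie0 hg) x hn ct ls.
have oO := cartan_open cA; set z := chart_at x x.
have Oz : chart_set U x z by apply: chart_set_at.
set Sg := pull (coord s) x in cA; set A := pull (cmx s nabla) x in cA.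
have sSg b := cartan_coframe_smooth cA b; have sA b := cartan_conn_smooth cA b.
have pE b y : chart_set U x y -> pull (cmx s nabla') x b y = A b y + S0 (Sg b y).
  by case=> q [Uq dq] <-; rewrite /A /Sg !pullE // cE.
have D0 a b : DM a (pull (cmx s nabla') x b) z = DM a (A b) z + S0 (DM a (Sg b) z).
  rewrite (DM_eq oO a Oz (pE b)) (DM_add a Oz (sA b) (smooth_lin oO hS0 (sSg b))).
  by rewrite (DM_lin a hS0 Oz (sSg b)).
have coordE b : coord s x (p *m b) = b.
  by rewrite /coord sx mulKmx // -sx; apply: us.
have SgE b : Sg (p *m b) z = b by rewrite /Sg pullE ?ext_at //; apply: chart_at_dom.
have AE b : cmx s nabla x b = A b z by rewrite /A pullE ?ext_at //; apply: chart_at_dom.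
rewrite (curvatureE fs hn' _ _ _ Ux) sx -/z !D0 !cE // !coordE !AE.
congr (_ *m (_ *m _)).
have gth b : g (A (p *m b) z - lam b).
  by have := cartan_inner cA (p *m b) Oz; rewrite I0E SgE.
have e1 := S0_inv v (gth u); have e2 := S0_inv u (gth v).
have eR := cartan_curvature cA (p *m u) (p *m v) Oz.
have eT := cartan_torsion cA (p *m u) (p *m v) Oz.
rewrite !SgE in eR eT; rewrite /shifted_curvature -eR -eT.
exact: shift_algebra hS0 e1 e2.
Qed.

Let T0' a b := T0 a b + (S0 a *m b - S0 b *m a).

Let I0' a := coset g (lam a + S0 a).

Let coset_self (A : 'M[R]_d) : coset g A A.
Proof. by rewrite /coset /= subrr; apply: lie0 hg. Qed.

Lemma coset_eq (A B : 'M[R]_d) : coset g A = coset g B <-> g (A - B).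
Proof.
split=> [AB|gAB]; first by have := coset_self A; rewrite AB.
rewrite eqEsubset /coset; split=> C /= gC.
  have -> : C - B = (C - A) + (A - B) by rewrite addrA subrK.
  exact: (lie_add hg).
have -> : C - A = (C - B) - (A - B) by rewrite opprB addrA subrK.
exact: (lie_sub hg).
Qed.

(** In the frames of P the added tensor is the constant S0; hence it is added
    to the inner torsion, and its antisymmetrization to the torsion. *)
Lemma add_tensor_characteristic :
  characteristic_tensors g nabla' P T0' shifted_curvature I0'.
Proof.
have [lT1 lT2 T00] := char_T0_alt ct; have [lR1 lR2 R00] := char_R0_alt ct.
split.
- split=> [b k a a'|a k b b'|a]; rewrite /T0'; last by rewrite T00 subrr addr0.
    rewrite lT1 hS0 mulmxDl mulmxDr -scalemxAl -scalemxAr opprD.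
    by apply/matrixP => i j; rewrite !mxE; ring.
  rewrite lT2 hS0 mulmxDl mulmxDr -scalemxAl -scalemxAr.
  by apply/matrixP => i j; rewrite !mxE; ring.
- have commDl k (X Y Z : 'M[R]_d) : comm (k *: X + Y) Z = k *: comm X Z + comm Y Z.
    rewrite /comm mulmxDl mulmxDr -scalemxAl -scalemxAr.
    by apply/matrixP => i j; rewrite !mxE; ring.
  have commDr k (X Y Z : 'M[R]_d) : comm Z (k *: X + Y) = k *: comm Z X + comm Z Y.
    rewrite /comm mulmxDl mulmxDr -scalemxAl -scalemxAr.
    by apply/matrixP => i j; rewrite !mxE; ring.
  split=> [b k a a'|a k b b'|a]; rewrite /shifted_curvature.
  + rewrite lR1 lT1 !hlam !hS0 !commDl !commDr mulmxDl -scalemxAl.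
    rewrite mulmxDr -scalemxAr !hS0.
    move: (comm _ _) (comm _ _) (comm _ _) (comm _ _) (comm _ _) (comm _ _).
    move: (S0 _) (S0 _) (S0 _) (S0 _) (S0 _) (S0 _) => *.
    by apply/matrixP => i j; rewrite !mxE; ring.
  + rewrite lR2 lT2 !hlam !hS0 !commDl !commDr mulmxDl -scalemxAl.
    rewrite mulmxDr -scalemxAr !hS0.
    move: (comm _ _) (comm _ _) (comm _ _) (comm _ _) (comm _ _) (comm _ _).
    move: (S0 _) (S0 _) (S0 _) (S0 _) (S0 _) (S0 _) => *.
    by apply/matrixP => i j; rewrite !mxE; ring.
  + by rewrite R00 T00 (lin_zero hS0) /comm !subrr !addr0 add0r subrr.
- split=> [a|k a b A B]; first by exists (lam a + S0 a).
  move=> /coset_eq gA /coset_eq gB; apply/coset_eq.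
  rewrite hlam hS0.
  have -> : k *: lam a + lam b + (k *: S0 a + S0 b) - (k *: A + B) =
     k *: (lam a + S0 a - A) + (lam b + S0 b - B).
    by apply/matrixP => i j; rewrite !mxE; ring.
  exact: (lie_linear hg).
- move=> x p u v Pp.
  have := char_torsion ct u v Pp; rewrite /torsion /torsion_op /nabla' /add_tensor.
  rewrite !bracket_ext !subr0 !ext_at !(SE _ _ Pp) => tE.
  rewrite /T0' mulmxDr -tE mulmxBr.
  by rewrite opprD addrACA.
- by move=> x p u v w Pp; apply: add_tensor_curvature.
- move=> x p u Pp; have up := Gstr_frame hP Pp.
  have adS (q B : 'M[R]_d) a : P x q -> q *m a = p *m u ->
     Adbar q (coset g (B + S0 a)) = [set A + p *m S0 u *m invmx p | A in Adbar q (coset g B)].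
    move=> Pq qa; have uq := Gstr_frame hP Pq.
    (* The endomorphism of the tangent space defined by the added tensor does
       not depend on the frame. *)
    have E0 : q *m S0 a *m invmx q = p *m S0 u *m invmx p.
      apply: mx_ext => w.
      by rewrite -!mulmxA -(SE _ _ Pq) -(SE _ _ Pp) qa !mulKVmx.
    rewrite -E0 eqEsubset; split.
      move=> _ [C gC <-]; exists (q *m (C - S0 a) *m invmx q).
        by exists (C - S0 a) => //; move: gC; rewrite /coset /= opprD addrA addrAC.
      by rewrite -mulmxDl -mulmxDr subrK.
    move=> _ [_ [C gC <-] <-]; exists (C + S0 a).
      by rewrite /coset /= opprD addrACA subrr addr0.
    by rewrite mulmxDr mulmxDl.
  have HL s a B : P x (s x) -> is_Lambda nabla' s x a B <-> is_Lambda nabla s x a (B - S0 a).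
    move=> Ps; split=> H w; have := H w; rewrite /nabla' /add_tensor (SE _ _ Ps).
      by rewrite mulmxBl mulmxBr => <-; rewrite addrK.
    by rewrite mulmxBl mulmxBr => ->; rewrite subrK.
  have -> : inner_torsion g nabla' P x (p *m u) =
     [set A + p *m S0 u *m invmx p | A in inner_torsion g nabla P x (p *m u)].
    rewrite eqEsubset; split.
      move=> B [U [s [a [A [ls Ux sa HA]]]]]; have [_ Ps _] := ls.
      rewrite -{1}(subrK (S0 a) A) (adS _ _ _ (Ps _ Ux) sa) => -[C HC <-].
      exists C => //; exists U, s, a, (A - S0 a); split=> //.
      by apply/HL => //; apply: Ps.
    move=> _ [B [U [s [a [A [ls Ux sa HA HB]]]]] <-]; have [_ Ps _] := ls.
    exists U, s, a, (A + S0 a); split=> //.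
      by apply/HL; rewrite ?addrK //; apply: Ps.
    by rewrite (adS _ _ _ (Ps _ Ux) sa); exists B.
  by rewrite (char_inner ct _ Pp) I0E -(adS p (lam u) u Pp erefl).
Qed.

End AddTensor.

(** * The Hermitian space *)

Section HermitianSpace.
Variables (R : realType) (n : nat).
Notation H := 'cV[R]_(n + n).
Local Notation J := (@J0 R n).
Implicit Types (X Y Z v : H) (A B : 'M[R]_(n + n)).

Lemma J0J : J *m J = - 1%:M.
Proof.
rewrite /J0 mulmx_block !mul0mx !mulmx0 !mulNmx !mulmxN !mul1mx ?mulmx1 !add0r !addr0.
by rewrite scalar_mx_block opp_block_mx !oppr0.
Qed.

Lemma J0_tr : J^T = - J.
Proof. by rewrite /J0 tr_block_mx opp_block_mx !trmx0 linearN /= trmx1 !oppr0 opprK. Qed.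

Lemma JJ X : J *m (J *m X) = - X.
Proof. by rewrite mulmxA J0J mulNmx mul1mx. Qed.

Lemma h0E X Y : h0 X Y = \sum_i X i 0 * Y i 0.
Proof. by rewrite /h0 mxE; apply: eq_bigr => i _; rewrite mxE. Qed.

Lemma h0C X Y : h0 X Y = h0 Y X.
Proof. by rewrite !h0E; apply: eq_bigr => i _; rewrite mulrC. Qed.

Lemma h0Dl X Y Z : h0 (X + Y) Z = h0 X Z + h0 Y Z.
Proof. by rewrite /h0 linearD /= mulmxDl mxE. Qed.

Lemma h0Zl k X Z : h0 (k *: X) Z = k * h0 X Z.
Proof. by rewrite /h0 linearZ /= -scalemxAl mxE. Qed.

Lemma h0Nl X Z : h0 (- X) Z = - h0 X Z.
Proof. by rewrite -scaleN1r h0Zl mulN1r. Qed.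

Lemma h0Dr X Y Z : h0 Z (X + Y) = h0 Z X + h0 Z Y.
Proof. by rewrite !(h0C Z) h0Dl. Qed.

Lemma h0Zr k X Z : h0 Z (k *: X) = k * h0 Z X.
Proof. by rewrite !(h0C Z) h0Zl. Qed.

Lemma h0Nr X Z : h0 Z (- X) = - h0 Z X.
Proof. by rewrite !(h0C Z) h0Nl. Qed.

Definition h0_lin := (h0Dl, h0Zl, h0Nl, h0Dr, h0Zr, h0Nr).

Lemma h0_mulmx A X Y : h0 (A *m X) Y = h0 X (A^T *m Y).
Proof. by rewrite /h0 trmx_mul mulmxA. Qed.

Lemma h0Jr X Y : h0 X (J *m Y) = - h0 (J *m X) Y.
Proof. by rewrite h0_mulmx J0_tr mulNmx h0Nr opprK. Qed.

Lemma h0JJ X Y : h0 (J *m X) (J *m Y) = h0 X Y.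
Proof. by rewrite h0Jr JJ h0Nl opprK. Qed.

Lemma h0JC X Y : h0 (J *m X) Y = - h0 (J *m Y) X.
Proof. by rewrite h0C h0Jr. Qed.

Lemma h0JX X : h0 (J *m X) X = 0.
Proof. by have := h0JC X X; lra. Qed.

Lemma h0_ge0 X : 0 <= h0 X X.
Proof. by rewrite h0E sumr_ge0 // => i _; rewrite -expr2 sqr_ge0. Qed.

Lemma h0_eq0 X : (h0 X X == 0) = (X == 0).
Proof.
apply/idP/eqP => [|->]; last first.
  by rewrite h0E; apply/eqP/big1 => i _; rewrite mxE mul0r.
rewrite h0E psumr_eq0 => [/allP H|i _]; last by rewrite -expr2 sqr_ge0.
apply/colP => i; rewrite mxE; apply/eqP.
by have := H i (mem_index_enum i); rewrite -expr2 sqrf_eq0.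
Qed.

Lemma h0_sep X Y : (forall Z, h0 X Z = h0 Y Z) -> X = Y.
Proof.
move=> XY; apply/eqP; rewrite -subr_eq0 -h0_eq0 h0Dl h0Nl XY.
by rewrite subrr.
Qed.

Lemma row_mul_h0 X Y : X^T *m Y = (h0 X Y)%:M.
Proof. by apply/matrixP => i j; rewrite !ord1 [RHS]mxE eqxx mulr1n. Qed.

Lemma mul_outer X Y Z : X *m Y^T *m Z = h0 Y Z *: X.
Proof. by rewrite -mulmxA row_mul_h0 mul_mx_scalar. Qed.

Lemma trmxD m p (A' B' : 'M[R]_(m, p)) : (A' + B')^T = A'^T + B'^T.
Proof. exact: linearD. Qed.

Lemma trmxN m p (A' : 'M[R]_(m, p)) : (- A')^T = - A'^T.
Proof. exact: linearN. Qed.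

Lemma trmxZ m p k (A' : 'M[R]_(m, p)) : (k *: A')^T = k *: A'^T.
Proof. exact: linearZ. Qed.

Lemma Un_J A X : Un A -> A *m (J *m X) = J *m (A *m X).
Proof. by case=> _ AJ; rewrite !mulmxA AJ. Qed.

Lemma Un_h0 A X Y : Un A -> h0 (A *m X) (A *m Y) = h0 X Y.
Proof. by case=> AA _; rewrite h0_mulmx mulmxA AA mul1mx. Qed.

Lemma Un_unit A : Un A -> A \in unitmx.
Proof. by case=> /mulmx1_unit []. Qed.

Lemma Un_inv A : Un A -> invmx A = A^T.
Proof.
move=> UA; have uA := Un_unit UA; case: UA => AA _.
by rewrite -[RHS]mulmx1 -(mulmxV uA) mulmxA AA mul1mx.
Qed.

Lemma Un_N1 : Un (- 1%:M : 'M[R]_(n + n)).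
Proof.
split; last by rewrite mulNmx mulmxN mul1mx mulmx1.
by rewrite trmxN trmx1 mulNmx mulmxN mul1mx opprK.
Qed.

Lemma Un_rot c s : c ^+ 2 + s ^+ 2 = 1 -> Un (c%:M + s *: J).
Proof.
move=> cs; split; last first.
  by rewrite mulmxDl mulmxDr -scalemxAl -scalemxAr mul_scalar_mx mul_mx_scalar.
rewrite trmxD trmxZ tr_scalar_mx J0_tr.
apply: mx_ext => X; rewrite -mulmxA !mulmxDl !mul_scalar_mx -!scalemxAl mulNmx.
rewrite mulmxDr -!scalemxAr JJ -[X in _ = X *: _]cs; move: (J *m X) => w.
by apply/colP => i; rewrite !mxE; ring.
Qed.

(** The unitary map that is -1 on the complex line of v and the identity on
    its orthogonal complement. *)
Definition refl v : 'M[R]_(n + n) :=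
  1%:M - (2%:R / h0 v v) *: (v *m v^T + (J *m v) *m (J *m v)^T).

Lemma reflE v X : refl v *m X =
  X - (2%:R / h0 v v) *: (h0 v X *: v + h0 (J *m v) X *: (J *m v)).
Proof. by rewrite /refl mulmxBl mul1mx -scalemxAl mulmxDl !mul_outer. Qed.

Lemma Un_refl v : v != 0 -> Un (refl v).
Proof.
rewrite -h0_eq0 => v0; have Rt : (refl v)^T = refl v.
  rewrite /refl trmxD trmxN trmx1 trmxZ trmxD !trmx_mul !trmxK.
  by [].
split; apply: mx_ext => X.
  rewrite Rt mul1mx -mulmxA !reflE; have := v0.
  rewrite !h0_lin h0JJ h0Jr h0JX.
  move: (h0 v v) (h0 v X) (h0 (J *m v) X) (J *m v) => a b c w a0.
  by apply/colP => i; rewrite !mxE; field.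
rewrite -!mulmxA !reflE !mulmxBr -!scalemxAr mulmxDr -!scalemxAr JJ h0JJ h0Jr.
move: (J *m v) (J *m X) => w Y.
by apply/colP => i; rewrite !mxE; ring.
Qed.

(** After rotating Y by a phase so that its Hermitian product with X is real,
    the complex reflection along the difference of the two vectors, which have
    the same length, exchanges them. *)
Lemma Un_transitive X Y : h0 X X = h0 Y Y -> exists2 A, Un A & A *m X = Y.
Proof.
move=> XY.
(* A phase that makes the imaginary part of the Hermitian product vanish. *)
have [c [s [cs ph]]] : exists c s, c ^+ 2 + s ^+ 2 = 1 /\
    c * h0 (J *m X) Y + s * h0 X Y = 0.
  pose x := h0 X Y; pose y := h0 (J *m X) Y.
  have [r0|r0] := eqVneq (x ^+ 2 + y ^+ 2) 0.
    exists 1, 0; rewrite expr1n expr0n addr0; split=> //.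
    move/eqP : r0; rewrite paddr_eq0 ?sqr_ge0 // !sqrf_eq0 -/x -/y => /andP[_ /eqP ->].
    by rewrite mulr0 mul0r addr0.
  have rp : 0 < x ^+ 2 + y ^+ 2 by rewrite lt_neqAle eq_sym r0 addr_ge0 ?sqr_ge0.
  pose r := Num.sqrt (x ^+ 2 + y ^+ 2).
  have rr : r ^+ 2 = x ^+ 2 + y ^+ 2 by rewrite sqr_sqrtr ?ltW.
  have rn : r != 0 by rewrite -sqrf_eq0 rr.
  exists (x / r), (- y / r); split; last by rewrite -/x -/y; field.
  by rewrite !exprMn sqrrN -mulrDl exprVn rr mulfV // -rr.
pose Y' := c *: Y + s *: (J *m Y).
pose Q := c%:M + (- s) *: J.
have UQ : Un Q by apply: Un_rot; rewrite sqrrN.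
have QY : Q *m Y' = Y.
  rewrite /Y' /Q mulmxDl mul_scalar_mx -scalemxAl mulmxDr -!scalemxAr JJ.
  rewrite -[RHS]scale1r -cs; move: (J *m Y) => w.
  by apply/colP => i; rewrite !mxE; ring.
have hY' : h0 Y' Y' = h0 X X.
  rewrite XY /Y' !h0_lin h0JJ h0Jr h0JX -[RHS]mul1r -cs; ring.
have hXY' : h0 (J *m X) Y' = 0.
  by rewrite /Y' !h0_lin h0JJ.
clearbody Y'; have [e|e] := eqVneq (X - Y') 0.
  by exists Q => //; rewrite -QY; congr (_ *m _); apply/eqP; rewrite -subr_eq0 e.
have := Un_refl e; set v := X - Y' => Uv.
exists (Q *m refl v).
  have [Qt QJ] := UQ; have [vt vJ] := Uv; split.
    by rewrite trmx_mul mulmxA -(mulmxA _ Q^T) Qt mulmx1 vt.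
  by rewrite -mulmxA vJ mulmxA QJ mulmxA.
rewrite -mulmxA reflE -[RHS]QY; congr (_ *m _).
have v1 : h0 v X = h0 X X - h0 Y' X by rewrite /v !h0_lin.
have vv : h0 v v = 2%:R * h0 v X.
  rewrite v1 /v !h0_lin hY' (h0C X Y'); ring.
have v2 : h0 (J *m v) X = 0.
  by rewrite /v mulmxBr !h0_lin h0JX (h0JC Y') hXY' !oppr0 addr0.
have vn : h0 v v != 0 by rewrite h0_eq0.
rewrite v2 scale0r addr0 scalerA vv.
have -> : 2%:R / (2%:R * h0 v X) * h0 v X = 1.
  by move: vn; rewrite vv mulf_eq0 negb_or => /andP[_ h]; field.
by rewrite scale1r /v opprB addrC subrK.
Qed.

End HermitianSpace.

(** * Tensors invariant under the unitary group *)

Section Schur.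
Variables (R : realType) (n : nat) (hn : (1 <= n)%N).
Notation H := 'cV[R]_(n + n).
Local Notation J := (@J0 R n).
Implicit Types (X Y Z W : H).

Lemma unit_vector : exists v : H, h0 v v = 1.
Proof.
have h : (0 < n + n)%N by rewrite addn_gt0 hn.
exists (delta_mx (Ordinal h) 0); rewrite h0E (bigD1 (Ordinal h)) //= big1 ?addr0.
  by rewrite mxE !eqxx mulr1.
by move=> i /negbTE ni; rewrite mxE ni mul0r.
Qed.

Lemma cmul_inj x y x' y' : (forall X, cmul x y X = cmul x' y' X) -> x = x' /\ y = y'.
Proof.
move=> e; have [v v1] := unit_vector; have := e v; rewrite /cmul => ev.
have := congr1 (h0 v) ev; rewrite !h0_lin h0Jr h0JX v1 oppr0 !mulr0 !mulr1 !addr0.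
have := congr1 (h0 (J *m v)) ev; rewrite !h0_lin h0JJ h0JX v1 !mulr0 !mulr1 !add0r.
by move=> -> ->.
Qed.

Lemma Un_cmul A x y X : Un A -> A *m cmul x y X = cmul x y (A *m X).
Proof. by move=> UA; rewrite /cmul mulmxDr -!scalemxAr Un_J. Qed.

(** For a unit vector v, the value f v lies in the eigenspace for -1 of the
    complex reflection along v, which is spanned by v and J v. By transitivity
    on spheres the two coefficients are the same for all vectors. *)
Lemma schur (f : H -> H) : linear f ->
  (forall A X, Un A -> f (A *m X) = A *m f X) ->
  exists x y, forall X, f X = cmul x y X.
Proof.
move=> lf ef; have [v v1] := unit_vector.
have v0 : v != 0 by rewrite -h0_eq0 v1 oner_eq0.
exists (h0 v (f v)), (h0 (J *m v) (f v)) => X.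
have rv : refl v *m v = - v.
  rewrite reflE v1 h0JX scale0r addr0 scale1r divr1 scaler_nat mulr2n.
  by rewrite opprD addNKr.
have fv : f v = cmul (h0 v (f v)) (h0 (J *m v) (f v)) v.
  have := ef _ v (Un_refl v0); rewrite rv (lin_opp v lf) reflE v1 divr1 /cmul.
  set a := h0 v (f v); set b := h0 (J *m v) (f v); clearbody a b.
  move: (f v) (J *m v) => w w' /colP e.
  by apply/colP => i; have := e i; rewrite !mxE => ?; lra.
pose r := Num.sqrt (h0 X X).
have rr : r ^+ 2 = h0 X X by rewrite sqr_sqrtr // h0_ge0.
have [A UA AX] : exists2 A, Un A & A *m (r *: v) = X.
  by apply: Un_transitive; rewrite !h0_lin v1 mulr1 -rr.
rewrite -AX ef // (lin_scale r v lf) {1}fv -Un_cmul //.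
congr (_ *m _); rewrite /cmul -!scalemxAr; move: (J *m v) => w.
by apply/colP => i; rewrite !mxE; ring.
Qed.

(** The form is h0 (L X, Y) for an equivariant L, thus L = x + y J; that it is
    alternating forces x = 0. *)
Lemma invariant_form (f : H -> H -> R) :
  (forall Y, linear (fun X => f X Y : R^o)) -> (forall X, linear (f X : H -> R^o)) ->
  (forall X, f X X = 0) ->
  (forall A X Y, Un A -> f (A *m X) (A *m Y) = f X Y) ->
  exists c, forall X Y, f X Y = c * omega0 X Y.
Proof.
move=> l1 l2 f0 inv.
pose L X : H := \col_k f X (delta_mx k 0).
have LE X Y : f X Y = h0 (L X) Y.
  rewrite h0E; have := @linear_basis R _ _ (f X) Y (l2 X) => ->.
  by apply: eq_bigr => k _; rewrite mxE mulrC.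
have lL : linear L.
  by move=> a X Y; apply/colP => k; rewrite !mxE; apply: (l1 _ a).
have eL A X : Un A -> L (A *m X) = A *m L X.
  move=> UA; apply: h0_sep => Z; rewrite -LE.
  have uA := Un_unit UA; rewrite -{1}(mulKVmx uA Z) inv // LE Un_inv //.
  by rewrite h0_mulmx.
have [x [y Lxy]] := schur lL eL.
exists y => X Y; have [v v1] := unit_vector.
have x0 : x = 0.
  have := f0 v; rewrite LE Lxy /cmul !h0_lin h0JX v1 mulr1 mulr0 addr0.
  by [].
by rewrite LE Lxy /cmul x0 scale0r add0r h0Zl.
Qed.

End Schur.

Section KaehlerTensors.
Variables (R : realType) (n : nat).
Notation H := 'cV[R]_(n + n).
Local Notation J := (@J0 R n).
Implicit Types (X Y Z W : H).

(** A quadrilinear form with the symmetries of the curvature tensor of a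
    Kaehler metric. *)
Record kaehler_tensor (r : H -> H -> H -> H -> R) : Prop := KaehlerTensor {
  kD1 : forall X X' Y Z W, r (X + X') Y Z W = r X Y Z W + r X' Y Z W;
  kN1 : forall X Y Z W, r (- X) Y Z W = - r X Y Z W;
  kD3 : forall X Y Z Z' W, r X Y (Z + Z') W = r X Y Z W + r X Y Z' W;
  kN3 : forall X Y Z W, r X Y (- Z) W = - r X Y Z W;
  ka12 : forall X Y Z W, r X Y Z W = - r Y X Z W;
  ka34 : forall X Y Z W, r X Y Z W = - r X Y W Z;
  kJ34 : forall X Y Z W, r X Y (J *m Z) (J *m W) = r X Y Z W;
  kbianchi : forall X Y Z W, r X Y Z W + r Y Z X W + r Z X Y W = 0 }.

Variables (r : H -> H -> H -> H -> R) (kr : kaehler_tensor r).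

(** From the Bianchi identity on the four cyclic arrangements of the
    arguments. *)
Lemma kaehler_pair X Y Z W : r X Y Z W = r Z W X Y.
Proof.
have b1 := kbianchi kr X Y Z W; have b2 := kbianchi kr Y Z W X.
have b3 := kbianchi kr Z W X Y; have b4 := kbianchi kr W X Y Z.
have e1 := ka34 kr Y Z X W; have e2 := ka34 kr Z X Y W.
have e3 := ka34 kr Z W Y X; have e4 := ka34 kr W Y Z X.
have e5 := ka34 kr W X Z Y; have e6 := ka34 kr X Z W Y.
have e7 := ka34 kr X Y W Z; have e8 := ka34 kr Y W X Z.
have f1 := ka12 kr W Y X Z; have f2 := ka12 kr X Z Y W.
have f3 := ka12 kr W Y Z X; have f4 := ka12 kr X Z W Y.
lra.
Qed.

Lemma kaehler_J12 X Y Z W : r (J *m X) (J *m Y) Z W = r X Y Z W.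
Proof. by rewrite kaehler_pair (kJ34 kr) kaehler_pair. Qed.

Lemma kD2 X Y Y' Z W : r X (Y + Y') Z W = r X Y Z W + r X Y' Z W.
Proof. by rewrite (ka12 kr) (kD1 kr) opprD -!(ka12 kr). Qed.

Lemma kN2 X Y Z W : r X (- Y) Z W = - r X Y Z W.
Proof. by rewrite (ka12 kr) (kN1 kr) -(ka12 kr). Qed.

Lemma kD4 X Y Z W W' : r X Y Z (W + W') = r X Y Z W + r X Y Z W'.
Proof. by rewrite (ka34 kr) (kD3 kr) opprD -!(ka34 kr). Qed.

Lemma kN4 X Y Z W : r X Y Z (- W) = - r X Y Z W.
Proof. by rewrite (ka34 kr) (kN3 kr) -(ka34 kr). Qed.

Definition kmulti := (kD1 kr, kN1 kr, kD2, kN2, kD3 kr, kN3 kr, kD4, kN4).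

(** A Kaehler tensor is determined by its holomorphic sectional curvature.
    Polarizing along X + Y and X - Y gives H22, and the Bianchi identity turns
    it into C; this relation for (X, Y) and for (X, J Y) makes all sectional
    curvatures vanish, and polarizing once more yields the whole tensor. *)
Lemma kaehler_polarization :
  (forall X, r X (J *m X) (J *m X) X = 0) -> forall X Y Z W, r X Y Z W = 0.
Proof.
move=> r0.
have H22 X Y : r X (J *m X) (J *m Y) Y + 2%:R * r X (J *m Y) (J *m Y) X = 0.
  have := r0 (X + Y); have := r0 (X - Y); have := r0 X; have := r0 Y.
  rewrite !mulmxBr !mulmxDr !kmulti.
  have g1 : r Y (J *m Y) (J *m X) X = r X (J *m X) (J *m Y) Y.
    by rewrite kaehler_pair (ka12 kr) (ka34 kr) opprK.
  have g2 : r X (J *m Y) (J *m X) Y = r X (J *m Y) (J *m Y) X.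
    by rewrite -(kJ34 kr) JJ (kN3 kr) -(ka34 kr).
  have g3 : r Y (J *m X) (J *m X) Y = r X (J *m Y) (J *m X) Y.
    by rewrite -kaehler_J12 JJ kN2 -(ka12 kr).
  have g4 : r Y (J *m X) (J *m Y) X = r X (J *m Y) (J *m Y) X.
    by rewrite -kaehler_J12 JJ kN2 -(ka12 kr).
  by move=> *; lra.
have C X Y : r X Y Y X + 3%:R * r X (J *m Y) (J *m Y) X = 0.
  have h := H22 X Y; have b := kbianchi kr X (J *m X) (J *m Y) Y.
  have g2 : r X (J *m Y) (J *m X) Y = r X (J *m Y) (J *m Y) X.
    by rewrite -(kJ34 kr) JJ (kN3 kr) -(ka34 kr).
  have g3 : r (J *m X) (J *m Y) X Y = - r X Y Y X.
    by rewrite kaehler_J12 (ka34 kr).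
  have g4 := ka12 kr (J *m Y) X (J *m X) Y.
  lra.
have S X Y : r X Y Y X = 0.
  have := C X Y; have := C X (J *m Y); rewrite JJ !kmulti opprK => ? ?; lra.
have S1 X Y Z : r X Y Z X = 0.
  have := S X (Y + Z); have := S X Y; have := S X Z; rewrite !kmulti.
  have : r X Z Y X = r X Y Z X by rewrite kaehler_pair (ka12 kr) (ka34 kr) opprK.
  by move=> *; lra.
move=> X Y Z W.
have S2 X' Y' Z' W' : r X' Y' Z' W' = r Z' X' Y' W'.
  have := S1 (X' + W') Y' Z'; have := S1 X' Y' Z'; have := S1 W' Y' Z'; rewrite !kmulti.
  have e1 : r W' Y' Z' X' = r Z' X' W' Y' by exact: kaehler_pair.
  have e2 := ka34 kr Z' X' W' Y'.
  by move=> *; lra.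
have := kbianchi kr X Y Z W; have := S2 X Y Z W; have := S2 Y Z X W.
by move=> *; lra.
Qed.

End KaehlerTensors.

Section KaehlerInvariant.
Variables (R : realType) (n : nat) (hn : (1 <= n)%N).
Notation H := 'cV[R]_(n + n).
Local Notation J := (@J0 R n).
Implicit Types (X Y Z W : H).

(** K, the curvature of a Kaehler metric of constant holomorphic sectional
    curvature, has the same symmetries as S. *)
Lemma kaehler_h0K (k : R) (S : H -> H -> 'M[R]_(n + n)) :
  alternating_bilinear S -> (forall X Y, un (S X Y)) ->
  (forall X Y Z, S X Y *m Z + S Y Z *m X + S Z X *m Y = 0) ->
  kaehler_tensor (fun X Y Z W => h0 (S X Y *m Z) W - k * h0 (K X Y Z) W).
Proof.
move=> altS uS bS; have [l1 l2 S0] := altS; rewrite /K /omega0.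
split=> /= [X X' Y Z W|X Y Z W|X Y Z Z' W|X Y Z W|X Y Z W|X Y Z W|X Y Z W|X Y Z W].
- rewrite (lin_add X X' (l1 Y)) /= mulmxDl !mulmxDr !h0_lin; ring.
- rewrite (lin_opp X (l1 Y)) /= mulNmx !mulmxN !h0_lin; ring.
- rewrite !mulmxDr !h0_lin; ring.
- rewrite !mulmxN !h0_lin; ring.
- rewrite (alt_anti X Y altS) mulNmx !h0_lin (h0JC Y X); ring.
- have [St SJ] := uS X Y.
  have -> : h0 (S X Y *m Z) W = - h0 (S X Y *m W) Z.
    by rewrite h0_mulmx St mulNmx h0Nr h0C.
  rewrite !h0_lin (h0C X W) (h0C X Z) (h0C Y Z) (h0C Y W) (h0JC Z W); ring.
- have [St SJ] := uS X Y.
  rewrite mulmxA SJ -mulmxA !h0_lin !h0JJ !h0Jr; ring.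
- have := bS X Y Z; move=> /(congr1 (fun V => h0 V W)); rewrite !h0_lin.
  have -> : h0 (0 : H) W = 0 by rewrite h0E big1 // => i _; rewrite mxE mul0r.
  rewrite (h0C Z X) (h0C Y X) (h0C Z Y) (h0JC Y X) (h0JC Z X) (h0JC Z Y).
  move: (h0 X Y) (h0 X Z) (h0 Y Z) => *; lra.
Qed.

(** Transitivity on the sphere makes the holomorphic sectional curvature
    constant, as is that of K; by polarization S is a multiple of K. *)
Lemma kaehler_invariant (S : H -> H -> 'M[R]_(n + n)) :
  alternating_bilinear S -> (forall X Y, un (S X Y)) ->
  (forall X Y Z, S X Y *m Z + S Y Z *m X + S Z X *m Y = 0) ->
  (forall A X Y, Un A -> S (A *m X) (A *m Y) *m A = A *m S X Y) ->
  exists k, forall X Y Z, S X Y *m Z = k *: K X Y Z.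
Proof.
move=> altS uS bS eS; have [v v1] := unit_vector R hn.
pose h X := h0 (S X (J *m X) *m (J *m X)) X.
have hA A X : Un A -> h (A *m X) = h X.
  move=> UA; rewrite /h -!(Un_J X UA) mulmxA eS //.
  by rewrite -mulmxA Un_h0.
exists (h v) => X Y Z; apply: h0_sep => W; rewrite h0Zl; apply/eqP.
rewrite -subr_eq0; apply/eqP.
apply: (kaehler_polarization (kaehler_h0K (h v) altS uS bS)) => {X Y Z W} X.
have KX : K X (J *m X) (J *m X) = h0 X X *: X.
  rewrite /K /omega0 !h0JJ !h0Jr !h0JX JJ ?oppr0.
  by move: (J *m X) => w; apply/colP => i; rewrite !mxE; field.
rewrite KX h0Zl -/(h X).
have [l1 l2 S0] := altS.
pose q := Num.sqrt (h0 X X).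
have qq : q ^+ 2 = h0 X X by rewrite sqr_sqrtr // h0_ge0.
have [A UA AX] : exists2 A, Un A & A *m (q *: v) = X.
  by apply: Un_transitive; rewrite !h0_lin v1 mulr1 -qq.
have -> : h X = q ^+ 4 * h v.
  rewrite -AX hA // /h -!scalemxAr (lin_scale q v (l1 _)) /= (lin_scale q _ (l2 _)).
  rewrite -!scalemxAl !h0_lin; ring.
rewrite -qq; ring.
Qed.

End KaehlerInvariant.

(** * Equivariance of the characteristic tensors *)

Section Equivariance.
Variables (R : realType) (d : nat) (M : manifold R d).
Variables (G g : set 'M[R]_d) (P : M -> set 'M[R]_d) (hP : is_Gstructure G P).
Variables (nabla : connection M) (T0 : 'cV[R]_d -> 'cV[R]_d -> 'cV[R]_d)
  (R0 : 'cV[R]_d -> 'cV[R]_d -> 'M[R]_d) (I0 : 'cV[R]_d -> set 'M[R]_d).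
Hypothesis ct : characteristic_tensors g nabla P T0 R0 I0.

(** Compare the defining relations in the frames p and p h. *)
Lemma characteristic_equivariant h : G h ->
  [/\ forall u v, T0 (h *m u) (h *m v) = h *m T0 u v,
      forall u v, R0 (h *m u) (h *m v) *m h = h *m R0 u v
    & forall u, I0 (h *m u) = Adbar h (I0 u)].
Proof.
move=> Gh; have [x _] := mfd_nonempty M; have [p Pp] := frame_at hP x.
have Pq : P x (p *m h) by apply/(Gstr_orbit hP _ Pp); exists h.
have up := Gstr_frame hP Pp; have := Gstr_frame hP Pq.
rewrite unitmx_mul => /andP[_ uh].
have inj m (a b : 'M[R]_(d, m)) : p *m a = p *m b -> a = b.
  by move=> /(congr1 (mulmx (invmx p))); rewrite !mulKmx.
split=> [u v|u v|u].
- by apply: inj; rewrite -(char_torsion ct _ _ Pp) !mulmxA (char_torsion ct _ _ Pq).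
- apply: mx_ext => w; apply: inj; rewrite -!mulmxA -(char_curvature ct _ _ _ Pp).
  by rewrite !mulmxA (char_curvature ct _ _ _ Pq) -!mulmxA.
- have := char_inner ct u Pq; rewrite -mulmxA (char_inner ct _ Pp) => AE.
  have iE : invmx (p *m h) = invmx h *m invmx p.
    have uph : p *m h \in unitmx by rewrite unitmx_mul up uh.
    apply: (can_inj (mulKmx uph)); rewrite mulmxV // mulmxA -(mulmxA p).
    by rewrite mulmxV // mulmx1 mulmxV.
  have cancel (A B : 'M[R]_d) : p *m A *m invmx p = p *m B *m invmx p -> A = B.
    move=> /(congr1 (fun C => C *m p)); rewrite !mulmxKV //; exact: inj.
  rewrite eqEsubset; split=> A.
    move=> IA; have : Adbar p (I0 (h *m u)) (p *m A *m invmx p) by exists A.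
    rewrite AE => -[B IB]; rewrite iE !mulmxA => e; exists B => //.
    by apply: cancel; rewrite !mulmxA.
  case=> B IB <-; have : Adbar (p *m h) (I0 u) (p *m h *m B *m invmx (p *m h)) by exists B.
  rewrite -AE => -[C IC]; rewrite iE !mulmxA => e.
  have <- : C = h *m B *m invmx h by apply: cancel; rewrite e !mulmxA.
  exact: IC.
Qed.

End Equivariance.

(** * Block matrices and the Lie algebra of U(n) x {1} *)

Section Blocks.
Variables (R : realType) (n : nat).
Notation H := 'cV[R]_(n + n).
Notation V := 'cV[R]_(n + n + 1).
Local Notation J := (@J0 R n).
Implicit Types (X Y Z : H) (s : R).

Lemma un1_block A B C D : @un1 R n (block_mx A B C D) <->
  [/\ un A, B = 0, C = 0 & D = 0].
Proof.
split=> [[A' uA' /eq_block_mx[<- <- <- <-]] //|[uA -> -> ->]].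
by exists A.
Qed.

Lemma horizD X Y : horiz (X + Y) = horiz X + horiz Y.
Proof. by rewrite /horiz add_col_mx addr0. Qed.

Lemma horizZ k X : horiz (k *: X) = k *: horiz X.
Proof. by rewrite /horiz scale_col_mx scaler0. Qed.

Lemma horiz_linear : linear (@horiz R n).
Proof. by move=> k X Y; rewrite horizD horizZ. Qed.

Lemma vecE (u : V) : u = horiz (usubmx u) + (dsubmx u 0 0) *: evec R n.
Proof.
rewrite -[LHS]vsubmxK /horiz /evec scale_col_mx add_col_mx scaler0 addr0 add0r.
congr col_mx; apply/matrixP => i j; rewrite !ord1 mxE [RHS]mxE.
by rewrite mxE eqxx mulr1.
Qed.

Lemma usub_horiz X : usubmx (horiz X) = X.
Proof. exact: col_mxKu. Qed.

Lemma dsub_horiz X : dsubmx (horiz X) = 0.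
Proof. exact: col_mxKd. Qed.

Lemma usub_evec : usubmx (evec R n) = 0.
Proof. exact: col_mxKu. Qed.

Lemma dsub_evec : dsubmx (evec R n) = 1%:M.
Proof. exact: col_mxKd. Qed.

Lemma block_horiz (A : 'M[R]_(n + n)) (B : 'cV_(n + n)) (C : 'rV_(n + n)) (D : 'M[R]_1) X :
  block_mx A B C D *m horiz X = col_mx (A *m X) (C *m X).
Proof. by rewrite /horiz mul_block_col !mulmx0 !addr0. Qed.

Lemma block_evec (A : 'M[R]_(n + n)) (B : 'cV_(n + n)) (C : 'rV_(n + n)) (D : 'M[R]_1) : block_mx A B C D *m evec R n = col_mx B D.
Proof. by rewrite /evec mul_block_col !mulmx0 !add0r !mulmx1. Qed.

Definition Gmx (A : 'M[R]_(n + n)) : 'M[R]_(n + n + 1) := block_mx A 0 0 1%:M.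

Lemma Gmx_mem A : Un A -> @Un1 R n (Gmx A).
Proof. by exists A. Qed.

Lemma Gmx_horiz A X : Gmx A *m horiz X = horiz (A *m X).
Proof. by rewrite block_horiz mul0mx. Qed.

Lemma Gmx_evec A : Gmx A *m evec R n = evec R n.
Proof. by rewrite block_evec. Qed.

Lemma Gmx_col A X (s : 'M[R]_1) : Gmx A *m col_mx X s = col_mx (A *m X) s.
Proof. by rewrite /Gmx mul_block_col !mul0mx mul1mx addr0 add0r. Qed.

Lemma Gmx_l A (B : 'M[R]_(n + n)) (C : 'cV_(n + n)) (D : 'rV_(n + n)) (E : 'M[R]_1) : Gmx A *m block_mx B C D E = block_mx (A *m B) (A *m C) D E.
Proof. by rewrite /Gmx mulmx_block !mul0mx !mul1mx !addr0 !add0r. Qed.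

Lemma Gmx_r A (B : 'M[R]_(n + n)) (C : 'cV_(n + n)) (D : 'rV_(n + n)) (E : 'M[R]_1) : block_mx B C D E *m Gmx A = block_mx (B *m A) C (D *m A) E.
Proof. by rewrite /Gmx mulmx_block !mulmx0 !mulmx1 !addr0 !add0r. Qed.

Lemma Gmx_inv A : Un A -> invmx (Gmx A) = Gmx A^T.
Proof.
move=> [AA _]; have GG : Gmx A^T *m Gmx A = 1%:M.
  by rewrite {2}/Gmx Gmx_l AA mulmx0 -scalar_mx_block.
have /andP[_ u] : (Gmx A^T \in unitmx) && (Gmx A \in unitmx).
  by rewrite -unitmx_mul GG unitmx1.
by rewrite -[RHS]mulmx1 -(mulmxV u) mulmxA GG mul1mx.
Qed.

Definition Jhat : 'M[R]_(n + n + 1) := block_mx J 0 0 0.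

(** The Lie algebra is cut out by linear equations with constant coefficients,
    and such equations pass to derivatives of maps. *)
Lemma un1P (B : 'M[R]_(n + n + 1)) :
  @un1 R n B <-> [/\ B^T = - B, B *m Jhat = Jhat *m B & B *m evec R n = 0].
Proof.
rewrite -[B]submxK; move: (ulsubmx B) (ursubmx B) (dlsubmx B) (drsubmx B) => A C D E.
rewrite un1_block tr_block_mx opp_block_mx /Jhat !mulmx_block block_evec.
rewrite !mul0mx !mulmx0 !addr0; split.
  move=> [[At AJ] -> -> ->].
  by rewrite !mul0mx !mulmx0 !trmx0 !oppr0 At AJ col_mx0.
move=> [/eq_block_mx[At _ Ct _] /eq_block_mx[AJ _ _ _]].
rewrite -col_mx0 => /eq_col_mx[C0 E0].
have D0 : D = 0 by apply: oppr_inj; rewrite -Ct C0 trmx0 oppr0.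
by split.
Qed.

Lemma un1_lie : lie_algebra (@un1 R n).
Proof.
split.
- by apply/un1P; rewrite trmx0 oppr0 !mul0mx mulmx0.
- move=> k A B /un1P[At AJ Ae] /un1P[Bt BJ Be]; apply/un1P.
  rewrite trmxD trmxZ At Bt !mulmxDl mulmxDr -!scalemxAl -scalemxAr AJ BJ Ae Be.
  by rewrite scaler0 addr0 scalerN opprD.
- move=> A B /un1P[At AJ Ae] /un1P[Bt BJ Be]; apply/un1P; rewrite /comm.
  rewrite trmxD trmxN !trmx_mul At Bt !mulNmx !mulmxN !opprK.
  rewrite !mulmxBl !mulmxBr -!mulmxA Ae Be !mulmx0 AJ BJ !mulmxA AJ BJ opprB addrC.
  by split=> //; rewrite subrr.
- move=> O F v z oO Oz sF gF; apply/un1P.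
  have FP y (Oy : O y) := (un1P (F y)).1 (gF y Oy).
  have Ft y : O y -> (F y)^T = - F y by move=> /FP[].
  have FJ y : O y -> F y *m Jhat = Jhat *m F y by move=> /FP[].
  have Fe y : O y -> F y *m evec R n = 0 by move=> /FP[].
  split.
  + by rewrite -DM_tr (DM_eq oO v Oz Ft) (DM_opp v Oz sF).
  + by rewrite -(DM_mulr v _ Oz sF) (DM_eq oO v Oz FJ) (DM_mull v _ Oz sF).
  + by rewrite -(DM_mulr v _ Oz sF) (DM_eq oO v Oz Fe) DM_cst.
Qed.

End Blocks.

(** * Parameters of the torsion and of the curvature *)

Section InvariantForms.
Variables (R : realType) (n : nat) (hn : (1 <= n)%N).
Notation H := 'cV[R]_(n + n).
Notation V := 'cV[R]_(n + n + 1).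
Local Notation J := (@J0 R n).
Local Notation e := (evec R n).
Implicit Types (X Y Z : H) (s : R).

Lemma omega0_neq0 : exists X Y, @omega0 R n X Y = 1.
Proof.
by have [v v1] := unit_vector R hn; exists v, (J *m v); rewrite /omega0 h0JJ.
Qed.

Lemma eq_oppr0 (W : lmodType R) (x : W) : x = - x -> x = 0.
Proof.
move=> h; have : x + x = 0 by rewrite {1}h addNr.
rewrite -mulr2n -scaler_nat => /eqP; rewrite scaler_eq0 pnatr_eq0 /=.
by move=> /eqP.
Qed.

(** The element -1 of U(n) fixes e and changes the sign of horizontal vectors;
    this kills the components of the wrong parity. What remains is an
    invariant two-form and an equivariant endomorphism. *)
Lemma torsion_form_exists (T0 : V -> V -> V) : alternating_bilinear T0 ->
  (forall h u v, @Un1 R n h -> T0 (h *m u) (h *m v) = h *m T0 u v) ->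
  exists t, unique (fun t' => torsion_form t' T0) t.
Proof.
move=> altT eT; have [l1 l2 T00] := altT.
have GN := Gmx_mem (@Un_N1 R n).
have uT0 X Y : usubmx (T0 (horiz X) (horiz Y)) = 0.
  apply: eq_oppr0; have := eT _ (horiz X) (horiz Y) GN.
  rewrite !Gmx_horiz !mulNmx !mul1mx.
  have -> : horiz (- X) = - horiz X by rewrite -scaleN1r horizZ scaleN1r.
  have -> : horiz (- Y) = - horiz Y by rewrite -scaleN1r horizZ scaleN1r.
  rewrite (lin_opp _ (l1 _)) (lin_opp _ (l2 _)) opprK => {1}->.
  by rewrite -[in LHS](vsubmxK (T0 _ _)) Gmx_col col_mxKu mulNmx mul1mx.
have dT0 X : dsubmx (T0 (horiz X) e) = 0.
  apply: eq_oppr0; have := eT _ (horiz X) e GN.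
  rewrite Gmx_horiz Gmx_evec mulNmx mul1mx.
  have -> : horiz (- X) = - horiz X by rewrite -scaleN1r horizZ scaleN1r.
  rewrite (lin_opp _ (l1 _)) => /(congr1 (fun w => - dsubmx w)).
  rewrite linearN /= opprK => {1}->.
  by rewrite -[in LHS](vsubmxK (T0 _ _)) Gmx_col col_mxKd.
pose f X Y := dsubmx (T0 (horiz X) (horiz Y)) 0 0.
have [c fc] : exists c, forall X Y, f X Y = c * omega0 X Y.
  apply: (invariant_form hn) => [Y k X X'|X k Y Y'|X|A X Y UA]; rewrite /f.
  - by rewrite horiz_linear l1 linearP !mxE.
  - by rewrite horiz_linear l2 linearP !mxE.
  - by rewrite T00 linear0 mxE.
  - rewrite -!Gmx_horiz (eT _ _ _ (Gmx_mem UA)) -[T0 (horiz X) (horiz Y)]vsubmxK.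
    by rewrite Gmx_col !col_mxKd.
have [x [y Pxy]] : exists x y, forall X, usubmx (T0 (horiz X) e) = cmul x y X.
  apply: (schur hn) => [k X X'|A X UA].
    by rewrite horiz_linear l1 linearP.
  rewrite -Gmx_horiz -{1}(Gmx_evec A) (eT _ _ _ (Gmx_mem UA)).
  by rewrite -[T0 (horiz X) e]vsubmxK Gmx_col !col_mxKu.
exists (TorsionParams x y c); split.
  move=> X Y /=; split.
    rewrite -[LHS]vsubmxK uT0 -fc /f /evec scale_col_mx scaler0 [dsubmx _ in LHS]mx11_scalar.
    by rewrite scalemx1.
  by rewrite -[LHS]vsubmxK dT0 Pxy.
move=> [x' y' c'] tf; have [X0 [Y0 w1]] := omega0_neq0.
have [xx yy] : x = x' /\ y = y'.
  apply: (cmul_inj hn) => X; have [_ /=] := tf X X; rewrite -Pxy => ->.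
  by rewrite usub_horiz.
have cc : c = c'.
  have := fc X0 Y0; have [/= + _] := tf X0 Y0; rewrite /f => ->.
  by rewrite linearZ /= dsub_evec !mxE eqxx w1 !mulr1 => ->.
by rewrite xx yy cc.
Qed.

Lemma row_schur (f : H -> 'rV[R]_(n + n)) : linear f ->
  (forall A X, Un A -> f (A *m X) = f X *m A^T) ->
  exists x y, forall X, f X = (cmul x y X)^T.
Proof.
move=> lf ef; have [|A X UA|x [y fxy]] := @schur R n hn (fun X => (f X)^T).
- by move=> k X Y; rewrite lf trmxD trmxZ.
- by rewrite ef // trmx_mul trmxK.
by exists x, y => X; rewrite -fxy trmxK.
Qed.

Lemma sub_linear (W : lmodType R) (L : V -> W) : linear L -> linear (fun X => L (horiz X)).
Proof. by move=> lL k X Y; rewrite horiz_linear lL. Qed.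

Lemma ulsubmxP k (A B : 'M[R]_(n + n + 1)) :
  ulsubmx (k *: A + B) = k *: ulsubmx A + ulsubmx B :> 'M[R]_(n + n).
Proof. by apply/matrixP => i j; rewrite !mxE. Qed.

Lemma ursubmxP k (A B : 'M[R]_(n + n + 1)) :
  ursubmx (k *: A + B) = k *: ursubmx A + ursubmx B :> 'cV[R]_(n + n).
Proof. by apply/matrixP => i j; rewrite !mxE. Qed.

Lemma dlsubmxP k (A B : 'M[R]_(n + n + 1)) :
  dlsubmx (k *: A + B) = k *: dlsubmx A + dlsubmx B :> 'rV[R]_(n + n).
Proof. by apply/matrixP => i j; rewrite !mxE. Qed.

Lemma drsubmxP k (A B : 'M[R]_(n + n + 1)) :
  drsubmx (k *: A + B) = k *: drsubmx A + drsubmx B :> 'M[R]_1.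
Proof. by apply/matrixP => i j; rewrite !mxE. Qed.

(** The parity argument of [torsion_form_exists] leaves the diagonal blocks on
    two horizontal vectors and the other two blocks on a horizontal vector and
    e. *)
Lemma curvature_form_exists (R0 : V -> V -> 'M[R]_(n + n + 1)) :
  alternating_bilinear R0 ->
  (forall h u v, @Un1 R n h -> R0 (h *m u) (h *m v) *m h = h *m R0 u v) ->
  exists k, unique (fun k' => curvature_form k' R0) k.
Proof.
move=> altR eR; have [l1 l2 R00] := altR.
have GN := Gmx_mem (@Un_N1 R n).
have hN X : horiz (- X) = - horiz X by rewrite -scaleN1r horizZ scaleN1r.
have even X Y A B C D : R0 (horiz X) (horiz Y) = block_mx A B C D -> B = 0 /\ C = 0.
  move=> RE; have := eR _ (horiz X) (horiz Y) GN.
  rewrite !Gmx_horiz !mulNmx !mul1mx !hN (lin_opp _ (l1 _)) (lin_opp _ (l2 _)) opprK RE.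
  rewrite Gmx_l Gmx_r !mulNmx !mulmxN !mul1mx !mulmx1 => /eq_block_mx[_ BN CN _].
  split; apply: eq_oppr0 => //.
have odd X A B C D : R0 (horiz X) e = block_mx A B C D -> A = 0 /\ D = 0.
  move=> RE; have := eR _ (horiz X) e GN.
  rewrite !Gmx_horiz Gmx_evec !mulNmx !mul1mx !hN (lin_opp _ (l1 _)) RE.
  rewrite mulNmx Gmx_l Gmx_r !mulNmx !mulmxN !mul1mx !mulmx1 opp_block_mx.
  move=> /eq_block_mx[AN _ _ DN]; split; apply: eq_oppr0 => //.
  by rewrite -AN opprK.
pose B X Y := ulsubmx (R0 (horiz X) (horiz Y)).
have lB1 Y : linear (fun X => B X Y).
  by move=> k X X'; rewrite /B horiz_linear l1 ulsubmxP.
have lB2 X : linear (B X).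
  by move=> k Y Y'; rewrite /B horiz_linear l2 ulsubmxP.
have RG A X Y : Un A -> Gmx A *m R0 (horiz X) (horiz Y) =
    R0 (horiz (A *m X)) (horiz (A *m Y)) *m Gmx A.
  by move=> UA; rewrite -!Gmx_horiz (eR _ _ _ (Gmx_mem UA)).
have RGe A X : Un A -> Gmx A *m R0 (horiz X) e = R0 (horiz (A *m X)) e *m Gmx A.
  by move=> UA; rewrite -Gmx_horiz -{2}(Gmx_evec A) (eR _ _ _ (Gmx_mem UA)).
have eB : equivariant_block B.
  split; first by split=> // X; rewrite /B R00; apply/matrixP => i j; rewrite !mxE.
  move=> A X Y UA; have := RG A X Y UA; rewrite -[R0 (horiz X) _]submxK.
  rewrite -[R0 (horiz (A *m X)) _]submxK Gmx_l Gmx_r => /eq_block_mx[BA _ _ _].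
  by rewrite /B BA -mulmxA mulmxV ?mulmx1 //; apply: Un_unit.
have [c0 Dc] : exists c, forall X Y,
    (drsubmx (R0 (horiz X) (horiz Y))) 0 0 = c * omega0 X Y.
  apply: (invariant_form hn) => [Y k X X'|X k Y Y'|X|A X Y UA].
  - by rewrite horiz_linear l1 drsubmxP !mxE.
  - by rewrite horiz_linear l2 drsubmxP !mxE.
  - by rewrite R00 !mxE.
  - have := RG A X Y UA; rewrite -[R0 (horiz X) _]submxK.
    rewrite -[R0 (horiz (A *m X)) _]submxK Gmx_l Gmx_r => /eq_block_mx[_ _ _ ->].
    by rewrite !block_mxKdr.
have [c1 [c2 C12]] : exists x y, forall X, ursubmx (R0 (horiz X) e) = cmul x y X.
  apply: (schur hn) => [k X X'|A X UA].
    by rewrite horiz_linear l1 ursubmxP.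
  have := RGe A X UA; rewrite -[R0 (horiz X) _]submxK.
  rewrite -[R0 (horiz (A *m X)) _]submxK Gmx_l Gmx_r => /eq_block_mx[_ h _ _].
  by rewrite !block_mxKur h.
have [c3 [c4 C34]] : exists x y, forall X, dlsubmx (R0 (horiz X) e) = (cmul x y X)^T.
  apply: row_schur => [k X X'|A X UA].
    by rewrite horiz_linear l1 dlsubmxP.
  have := RGe A X UA; rewrite -[R0 (horiz X) _]submxK.
  rewrite -[R0 (horiz (A *m X)) _]submxK Gmx_l Gmx_r => /eq_block_mx[_ _ h _].
  rewrite !block_mxKdl h -mulmxA -(Un_inv UA) mulmxV ?mulmx1 //.
  exact: Un_unit.
have RE X Y : R0 (horiz X) (horiz Y) = block_mx (B X Y) 0 0 (c0 * omega0 X Y)%:M.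
  have := even X Y _ _ _ _ (esym (submxK _)) => -[b c].
  by rewrite -[LHS]submxK b c -Dc -mx11_scalar.
have RO X : R0 (horiz X) e = block_mx 0 (cmul c1 c2 X) (cmul c3 c4 X)^T 0.
  have := odd X _ _ _ _ (esym (submxK _)) => -[a d].
  by rewrite -[LHS]submxK a d C12 C34.
exists (CurvatureParams c0 c1 c2 c3 c4 B); split; first by split.
move=> [d0 d1 d2 d3 d4 B'] [_ kf]; have [X0 [Y0 w1]] := omega0_neq0.
have BB : B = B'.
  apply/funext => X; apply/funext => Y; have [_] := kf X Y; rewrite RE /=.
  by move=> /eq_block_mx[].
have [e1 e2] : c1 = d1 /\ c2 = d2.
  apply: (cmul_inj hn) => X; have [+ _] := kf X X; rewrite RO /=.
  by move=> /eq_block_mx[].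
have [e3 e4] : c3 = d3 /\ c4 = d4.
  apply: (cmul_inj hn) => X; have [+ _] := kf X X; rewrite RO /=.
  by move=> /eq_block_mx[_ _ /trmx_inj].
have e0 : c0 = d0.
  have [_] := kf X0 Y0; rewrite RE /= => /eq_block_mx[_ _ _].
  by move=> /matrixP/(_ 0 0); rewrite !mxE eqxx !mulr1n w1 !mulr1.
by rewrite BB e1 e2 e3 e4 e0.
Qed.

End InvariantForms.

(** * Parameters of the inner torsion *)

Section InnerForm.
Variables (R : realType) (n : nat) (hn : (1 <= n)%N).
Notation H := 'cV[R]_(n + n).
Notation V := 'cV[R]_(n + n + 1).
Local Notation J := (@J0 R n).
Local Notation e := (evec R n).
Local Notation g := (@un1 R n).
Implicit Types (X Y Z : H) (s : R).

Let hg := @un1_lie R n.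

Lemma un_scale k (A : 'M[R]_(n + n)) : un A -> un (k *: A).
Proof.
by case=> At AJ; split; rewrite ?trmxZ ?At ?scalerN // -scalemxAl AJ scalemxAr.
Qed.

Lemma un_add (A B : 'M[R]_(n + n)) : un A -> un B -> un (A + B).
Proof.
move=> [At AJ] [Bt BJ]; split; first by rewrite trmxD At Bt opprD.
by rewrite mulmxDl mulmxDr AJ BJ.
Qed.

Lemma un_double (A : 'M[R]_(n + n)) : un (A + A) -> un A.
Proof.
move=> /(un_scale 2%:R^-1); have -> : 2%:R^-1 *: (A + A) = A by apply/matrixP => i j; rewrite !mxE; field.
by [].
Qed.

Lemma un_J : un J.
Proof. by split; rewrite ?J0_tr. Qed.

Lemma un_scalar k : un (k%:M : 'M[R]_(n + n)) -> k = 0.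
Proof.
move=> [+ _]; rewrite tr_scalar_mx => /(congr1 (fun A => A *m (sval (cid (unit_vector R hn))))).
case: cid => /= v v1; rewrite mulNmx !mul_scalar_mx => /(congr1 (h0 v)).
by rewrite !h0_lin v1 mulr1 => h; lra.
Qed.

Lemma lambdaE (q : inner_params R) X s : lambda q (horiz X + s *: e) =
  block_mx (pa q * s)%:M (cmul (palpha q) (pbeta q) X)
           (cmul (pgamma q) (pdelta q) X)^T (pb q * s)%:M.
Proof.
rewrite /lambda; have -> : usubmx (horiz X + s *: e) = X.
  by rewrite linearD linearZ /= usub_horiz usub_evec scaler0 addr0.
have -> : dsubmx (horiz X + s *: e) 0 0 = s.
  by rewrite linearD linearZ /= dsub_horiz dsub_evec !mxE eqxx mulr1 add0r.
by [].
Qed.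

Lemma lambda_horiz (q : inner_params R) X : lambda q (horiz X) =
  block_mx 0 (cmul (palpha q) (pbeta q) X) (cmul (pgamma q) (pdelta q) X)^T 0.
Proof.
have -> : horiz X = horiz X + 0 *: e by rewrite scale0r addr0.
by rewrite lambdaE !mulr0 !raddf0.
Qed.

Lemma cmulD x y k X Y : cmul x y (k *: X + Y) = k *: cmul x y X + cmul x y Y.
Proof.
rewrite /cmul mulmxDr -scalemxAr; move: (J *m X) (J *m Y) => *.
by apply/colP => i; rewrite !mxE; ring.
Qed.

Lemma cmul0 x y : cmul x y (0 : H) = 0.
Proof. by rewrite /cmul mulmx0 !scaler0 addr0. Qed.

Lemma lambda_evec (q : inner_params R) : lambda q e =
  block_mx (pa q)%:M 0 0 (pb q)%:M.
Proof.
have -> : e = horiz 0 + 1 *: e by rewrite /horiz col_mx0 add0r scale1r.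
by rewrite lambdaE !mulr1 !cmul0 trmx0.
Qed.

Lemma lambda_linear (q : inner_params R) : linear (@lambda R n q).
Proof.
move=> k u v; rewrite /lambda scale_block_mx add_block_mx.
have -> : usubmx (k *: u + v) = k *: usubmx u + usubmx v by rewrite linearP.
have -> : dsubmx (k *: u + v) = k *: dsubmx u + dsubmx v by rewrite linearP.
rewrite !cmulD trmxD trmxZ; congr block_mx.
- by rewrite scale_scalar_mx -raddfD /= !mxE; congr (_%:M); ring.
- by rewrite scale_scalar_mx -raddfD /= !mxE; congr (_%:M); ring.
Qed.

Lemma un_cmul (A : 'M[R]_(n + n)) x y X : un A -> A *m cmul x y X = cmul x y (A *m X).
Proof. by case=> _ AJ; rewrite /cmul mulmxDr -!scalemxAr !mulmxA AJ. Qed.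

Lemma lambda_invariant (q : inner_params R) A a : g A ->
  comm A (lambda q a) = lambda q (A *m a).
Proof.
case=> A' uA <-; have [At AJ] := uA; rewrite [a in RHS]vecE mulmxDr block_horiz -scalemxAr.
rewrite block_evec mul0mx col_mx0 scaler0 addr0 -/(horiz _) lambda_horiz.
rewrite /comm /lambda !mulmx_block !mul0mx !mulmx0 !addr0 !mul_scalar_mx mul_mx_scalar.
rewrite opp_block_mx add_block_mx subrr subr0 un_cmul // -un_cmul //.
congr block_mx; rewrite ?add0r ?subr0 ?oppr0 //.
by rewrite -un_cmul // trmx_mul At mulmxN.
Qed.

Lemma coset_un1 (A B : 'M[R]_(n + n + 1)) : coset g A = coset g B <-> g (A - B).
Proof. exact: coset_eq hg A B. Qed.

Lemma un1_sub_block A B C D A' B' C' D' :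
  @un1 R n (block_mx A B C D - block_mx A' B' C' D') <->
  [/\ un (A - A'), B = B', C = C' & D = D'].
Proof.
rewrite opp_block_mx add_block_mx un1_block; split.
  by move=> [? /subr0_eq ? /subr0_eq ? /subr0_eq ?].
by move=> [? -> -> ->]; rewrite !subrr.
Qed.

(** Invariance under J, an element of U(n), forces C to commute with J. The
    symmetric part of C commutes with the whole group and is a scalar by
    [schur], since J is skew-symmetric. *)
Lemma invariant_mod_un (C : 'M[R]_(n + n)) :
  (forall A, Un A -> un (A *m C *m A^T - C)) -> exists a, un (C - a%:M).
Proof.
move=> inv.
have CJ : C *m J = J *m C.
  have UJ : @Un R n J by split; rewrite // J0_tr mulNmx J0J opprK.
  have [_] := inv _ UJ; rewrite J0_tr mulmxN mulmxBl mulmxBr mulNmx mulmxN.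
  rewrite -(mulmxA (J *m C)) J0J !mulmxA J0J mulmxN !mulNmx mulmx1 mul1mx !opprK.
  move=> /matrixP h; apply/matrixP => i j; have := h i j.
  by move: (C *m J) (J *m C) => A B; rewrite !mxE => ?; lra.
have [|A X UA|x [y Sxy]] := @schur R n hn (fun X => (C + C^T) *m X).
- by move=> k X Y; rewrite mulmxDr scalemxAr.
- have uA := Un_unit UA; have iA := Un_inv UA.
  have [h _] := inv A UA; move: h.
  rewrite trmxD trmxN !trmx_mul trmxK opprD opprK => h.
  have sym : A *m (C + C^T) *m A^T = C + C^T.
    move: h; rewrite mulmxDr mulmxDl -!mulmxA.
    move: (A *m (C *m A^T)) (A *m (C^T *m A^T)) => A1 A2 /matrixP h.
    by apply/matrixP => i j; have := h i j; rewrite !mxE => ?; lra.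
  by rewrite -{1}sym !mulmxA -(mulmxA _ A^T) -iA mulVmx // mulmx1.
have S0 : C + C^T = x%:M + y *: J.
  by apply: mx_ext => X; rewrite Sxy /cmul mulmxDl mul_scalar_mx scalemxAl.
have y0 : y *: J = 0.
  have : (x%:M + y *: J)^T = x%:M + y *: J by rewrite -S0 trmxD trmxK addrC.
  rewrite trmxD trmxZ tr_scalar_mx J0_tr scalerN => /addrI.
  by move=> h; apply: eq_oppr0.
exists (x / 2%:R); split.
  rewrite trmxD trmxN tr_scalar_mx; move: S0; rewrite y0 addr0 => /matrixP h.
  apply/matrixP => i j; have := h i j; rewrite !mxE.
  by case: (i == j); rewrite ?mulr1n ?mulr0n => ?; lra.
by rewrite mulmxBl mulmxBr CJ mul_scalar_mx mul_mx_scalar.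
Qed.

(** Representatives of the cosets are linear and equivariant only modulo the
    Lie algebra. As the latter has zero entries outside the block on H, the
    three other blocks are linear and equivariant; the block on H is covered
    by [invariant_mod_un]. *)
Lemma inner_form_exists (I0 : V -> set 'M[R]_(n + n + 1)) :
  linear_to_quotient g I0 ->
  (forall h u, @Un1 R n h -> I0 (h *m u) = Adbar h (I0 u)) ->
  exists q, unique (fun q' => inner_form q' I0) q.
Proof.
move=> [ex lin] eI.
pose rho u := sval (cid (ex u)).
have IE u : I0 u = coset g (rho u) by rewrite /rho; case: cid.
have rlin k u v : g (rho (k *: u + v) - (k *: rho u + rho v)).
  by apply/coset_un1; rewrite -IE; apply: lin.
have rG A u : Un A -> g (Gmx A *m rho u *m Gmx A^T - rho (Gmx A *m u)).
  move=> UA; have : Adbar (Gmx A) (I0 u) (Gmx A *m rho u *m Gmx A^T).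
    exists (rho u); last by rewrite Gmx_inv.
    by rewrite IE /coset /= subrr; apply: lie0 hg.
  by rewrite -(eI _ _ (Gmx_mem UA)) IE.
pose r1 u := ulsubmx (rho u); pose r2 u := ursubmx (rho u).
pose r3 u := dlsubmx (rho u); pose r4 u := drsubmx (rho u).
have rE u : rho u = block_mx (r1 u) (r2 u) (r3 u) (r4 u) by rewrite submxK.
have rl k u v : [/\ un (r1 (k *: u + v) - (k *: r1 u + r1 v)),
    r2 (k *: u + v) = k *: r2 u + r2 v, r3 (k *: u + v) = k *: r3 u + r3 v
    & r4 (k *: u + v) = k *: r4 u + r4 v].
  by have := rlin k u v; rewrite !rE scale_block_mx add_block_mx => /un1_sub_block.
have rg A u : Un A -> [/\ un (A *m r1 u *m A^T - r1 (Gmx A *m u)),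
    A *m r2 u = r2 (Gmx A *m u), r3 u *m A^T = r3 (Gmx A *m u)
    & r4 u = r4 (Gmx A *m u)].
  by move=> UA; have := rG A u UA; rewrite !rE Gmx_l Gmx_r => /un1_sub_block.
have UN := @Un_N1 R n.
have hN X : horiz (- X) = - horiz X by rewrite -scaleN1r horizZ scaleN1r.
have Nt : (- 1%:M : 'M[R]_(n + n))^T = - 1%:M by rewrite trmxN trmx1.
have r4lin : linear r4 by move=> k u v; have [] := rl k u v.
have r2lin : linear r2 by move=> k u v; have [] := rl k u v.
have r3lin : linear r3 by move=> k u v; have [] := rl k u v.
have h4 X : r4 (horiz X) = 0.
  have [_ _ _] := rg _ (horiz X) UN; rewrite Gmx_horiz mulNmx mul1mx hN.
  by rewrite (lin_opp _ r4lin) => /eq_oppr0.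
(* Modulo u(n) this block is at the same time odd, by linearity, and invariant
   under -1, so that its double belongs to u(n). *)
have h1 X : un (r1 (horiz X)).
  have [+ _ _ _] := rg _ (horiz X) UN; rewrite Gmx_horiz Nt !mulNmx !mulmxN.
  rewrite mul1mx mulmx1 mul1mx opprK hN => u1.
  have [+ _ _ _] := rl (-1) (horiz X) 0; rewrite addr0 scaleN1r => u2.
  have [+ _ _ _] := rl 1 (0 : V) 0; rewrite scaler0 addr0 scale1r => u3.
  apply: un_double; have -> : r1 (horiz X) + r1 (horiz X) =
      (r1 (horiz X) - r1 (- horiz X)) + (r1 (- horiz X) - (-1 *: r1 (horiz X) + r1 0))
      + (-1 : R) *: (r1 0 - (r1 0 + r1 0)).
    by apply/matrixP => i j; rewrite !mxE; ring.
  exact: un_add (un_add u1 u2) (un_scale (-1) u3).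
have e2 : r2 e = 0.
  have [_ + _ _] := rg _ e UN; rewrite Gmx_evec mulNmx mul1mx => h.
  by apply: eq_oppr0.
have e3 : r3 e = 0.
  have [_ _ + _] := rg _ e UN; rewrite Gmx_evec Nt mulmxN mulmx1 => h.
  by apply: eq_oppr0.
have [a ua] : exists a, un (r1 e - a%:M).
  apply: invariant_mod_un => A UA; have [+ _ _ _] := rg A e UA.
  by rewrite Gmx_evec.
have [x [y P2]] : exists x y, forall X, r2 (horiz X) = cmul x y X.
  apply: (schur hn); first exact: (sub_linear r2lin).
  by move=> A X UA; have [_ + _ _] := rg A (horiz X) UA; rewrite Gmx_horiz.
have [z [w P3]] : exists x y, forall X, r3 (horiz X) = (cmul x y X)^T.
  apply: (row_schur hn); first exact: (sub_linear r3lin).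
  by move=> A X UA; have [_ _ + _] := rg A (horiz X) UA; rewrite Gmx_horiz.
exists (InnerParams a (r4 e 0 0) x y z w); split.
  move=> u; rewrite IE; apply/coset_un1; rewrite [u in lambda _ u]vecE lambdaE rE /=.
  set X := usubmx u; set s := dsubmx u 0 0.
  have uE : u = s *: e + horiz X by rewrite addrC -vecE.
  have [v1 v2 v3 v4] := rl s e (horiz X); rewrite -uE in v1 v2 v3 v4.
  apply/un1_sub_block; split.
  - have -> : r1 u - (a * s)%:M = (r1 u - (s *: r1 e + r1 (horiz X)))
        + (s *: (r1 e - a%:M) + r1 (horiz X)).
      rewrite mulrC -scale_scalar_mx; move: (a%:M : 'M[R]_(n + n)) => A.
      by apply/matrixP => i j; rewrite !mxE; ring.
    exact: un_add v1 (un_add (un_scale s ua) (h1 X)).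
  - by rewrite v2 e2 scaler0 add0r P2.
  - by rewrite v3 e3 scaler0 add0r P3.
  - by rewrite v4 h4 addr0 [r4 e in LHS]mx11_scalar scale_scalar_mx mulrC.
move=> [a' b' x' y' z' w'] qf.
have [ea _ _ eb] : [/\ un (r1 e - a'%:M), r2 e = 0, r3 e = 0 & r4 e = b'%:M].
  by apply/un1_sub_block; apply/coset_un1; rewrite -rE -IE qf lambda_evec.
have aa : a = a'.
  apply/eqP; rewrite -subr_eq0; apply/eqP/un_scalar.
  have -> : (a - a')%:M = (r1 e - a'%:M) + (-1 : R) *: (r1 e - a%:M).
    move: (r1 e) => A; apply/matrixP => i j; rewrite !mxE.
    by case: (i == j); rewrite ?mulr1n ?mulr0n; ring.
  exact: un_add ea (un_scale (-1) ua).
have hX X : [/\ r2 (horiz X) = cmul x' y' X & r3 (horiz X) = (cmul z' w' X)^T].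
  have [] // : [/\ un (r1 (horiz X) - 0), r2 (horiz X) = cmul x' y' X,
     r3 (horiz X) = (cmul z' w' X)^T & r4 (horiz X) = 0].
  by apply/un1_sub_block; apply/coset_un1; rewrite -rE -IE qf lambda_horiz.
have [xx yy] : x = x' /\ y = y'.
  by apply: (cmul_inj hn) => X; rewrite -P2; have [] := hX X.
have [zz ww] : z = z' /\ w = w'.
  by apply: (cmul_inj hn) => X; apply: trmx_inj; rewrite -P3; have [] := hX X.
by rewrite aa xx yy zz ww eb mxE eqxx mulr1n.
Qed.

End InnerForm.

(** * Equations for the torsion-free case *)

Section Classification.
Variables (R : realType) (n : nat) (hn : (1 <= n)%N).
Notation H := 'cV[R]_(n + n).
Notation V := 'cV[R]_(n + n + 1).
Local Notation J := (@J0 R n).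
Local Notation e := (evec R n).
Local Notation g := (@un1 R n).
Implicit Types (X Y Z : H) (s : R).

Lemma cmul_cmul x y x' y' X :
  cmul x y (cmul x' y' X) = cmul (x * x' - y * y') (x * y' + y * x') X.
Proof.
rewrite /cmul mulmxDr -!scalemxAr JJ; move: (J *m X) => w.
by apply/colP => i; rewrite !mxE; ring.
Qed.

Lemma cmul_scaled x y k X : k *: cmul x y X = cmul (k * x) (k * y) X.
Proof. by rewrite /cmul scalerDr !scalerA. Qed.

Lemma cmul_add x y x' y' X : cmul x y X + cmul x' y' X = cmul (x + x') (y + y') X.
Proof.
rewrite /cmul; move: (J *m X) => w.
by apply/colP => i; rewrite !mxE; ring.
Qed.

Lemma cmul_opp x y X : - cmul x y X = cmul (- x) (- y) X.
Proof.
rewrite /cmul; move: (J *m X) => w.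
by apply/colP => i; rewrite !mxE; ring.
Qed.

Lemma cmul1 k X : k *: X = cmul k 0 X.
Proof. by rewrite /cmul scale0r addr0. Qed.

Definition cmul_norm := (cmul_cmul, cmul_scaled, cmul_add, cmul_opp).

Lemma h0_cmul x y x' y' X Y : h0 (cmul x y X) (cmul x' y' Y) =
  (x * x' + y * y') * h0 X Y + (y * x' - x * y') * omega0 X Y.
Proof. rewrite /cmul /omega0 !h0_lin h0JJ !h0Jr; ring. Qed.

Lemma h0_cmul1 x y X Y : h0 (cmul x y X) Y = x * h0 X Y + y * omega0 X Y.
Proof. by rewrite /cmul /omega0 !h0_lin. Qed.

Lemma omega0C X Y : @omega0 R n X Y = - omega0 Y X.
Proof. exact: h0JC. Qed.

Section Equations.
Variables (a b alpha beta gamma delta : R) (k : curvature_params R n).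
Let q := InnerParams a b alpha beta gamma delta.
Let P := cmul alpha beta : H -> H.
Let Q := cmul gamma delta : H -> H.
Variables (R0 : V -> V -> 'M[R]_(n + n + 1)).
Hypotheses (altR : alternating_bilinear R0) (kf : curvature_form k R0).

Let lamX X : lambda q (horiz X) = block_mx 0 (P X) (Q X)^T 0.
Proof. exact: lambda_horiz. Qed.

Let lame : lambda q e = block_mx a%:M 0 0 b%:M.
Proof. exact: lambda_evec. Qed.

Let RX X : R0 (horiz X) e = block_mx 0 (cmul (pc1 k) (pc2 k) X) (cmul (pc3 k) (pc4 k) X)^T 0.
Proof. by have [] := kf.2 X X. Qed.

Let RXY X Y : R0 (horiz X) (horiz Y) = block_mx (pB k X Y) 0 0 (pc0 k * omega0 X Y)%:M.
Proof. by have [] := kf.2 X Y. Qed.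

Section FirstOrder.
Hypothesis cond : forall u v, g (R0 u v - comm (lambda q u) (lambda q v)
     + lambda q (lambda q u *m v - lambda q v *m u)).

(** The off-diagonal blocks of the condition on X and e: elements of the Lie
    algebra have none. *)
Lemma mixed_coefficients :
  [/\ pc1 k = b * alpha - alpha ^+ 2 + beta ^+ 2,
      pc2 k = beta * (b - 2%:R * alpha),
      pc3 k = (2%:R * a - b - alpha) * gamma + beta * delta
    & pc4 k = (2%:R * a - b - alpha) * delta - beta * gamma].
Proof.
have main X : cmul (pc1 k) (pc2 k) X = (b - a) *: P X - P (P X - a *: X) /\
              cmul (pc3 k) (pc4 k) X = (a - b) *: Q X - Q (P X - a *: X).
  have := cond (horiz X) e; rewrite RX lamX lame block_evec block_horiz.
  rewrite mul_scalar_mx mul0mx.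
  have -> : col_mx (P X) 0 - col_mx (a *: X) 0 = horiz (P X - a *: X) :> V.
    by rewrite opp_col_mx add_col_mx subr0.
  rewrite lambda_horiz -/P -/Q /comm !mulmx_block !mul0mx !mulmx0 !addr0 !add0r.
  rewrite !mul_scalar_mx !mul_mx_scalar !(opp_block_mx, add_block_mx).
  move=> /un1_block[_ h1 h2 _]; split.
    apply/eqP; rewrite -subr_eq0 -[X in _ == X]h1; apply/eqP.
    by move: (P (P X - a *: X)) (P X) => A B; apply/colP => i; rewrite !mxE; ring.
  apply/trmx_inj/eqP; rewrite -subr_eq0 -[X in _ == X]h2; apply/eqP.
  move: (Q (P X - a *: X)) (Q X) => A B; apply/rowP => i; rewrite !mxE; ring.
have [h1 h2] : pc1 k = b * alpha - alpha ^+ 2 + beta ^+ 2 /\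
    pc2 k = beta * (b - 2%:R * alpha).
  apply: (cmul_inj hn) => X; rewrite (main X).1 /P (cmul1 a X) !cmul_norm.
  by congr (cmul _ _ X); ring.
have [h3 h4] : pc3 k = (2%:R * a - b - alpha) * gamma + beta * delta /\
    pc4 k = (2%:R * a - b - alpha) * delta - beta * gamma.
  apply: (cmul_inj hn) => X; rewrite (main X).2 /P /Q (cmul1 a X) !cmul_norm.
  by congr (cmul _ _ X); ring.
by split.
Qed.

(** The diagonal blocks of the condition on two horizontal vectors: the block
    on H is only controlled modulo u(n), the other one vanishes. *)
Lemma horizontal_equations X Y :
  un (pB k X Y - P X *m (Q Y)^T + P Y *m (Q X)^T
      + (2%:R * a * delta * omega0 X Y)%:M) /\
  pc0 k * omega0 X Y = 2%:R * (delta * alpha - gamma * beta - delta * b) * omega0 X Y.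
Proof.
have := cond (horiz X) (horiz Y); rewrite RXY !lamX !block_horiz !mul0mx !row_mul_h0.
have t2 : h0 (Q X) Y - h0 (Q Y) X = 2%:R * delta * omega0 X Y.
  by rewrite /Q !h0_cmul1 (h0C Y X) (omega0C Y X); ring.
have -> : col_mx 0 (h0 (Q X) Y)%:M - col_mx 0 (h0 (Q Y) X)%:M =
    (2%:R * delta * omega0 X Y) *: e.
  rewrite opp_col_mx add_col_mx subrr -raddfB /= t2 /evec scale_col_mx scaler0.
  by rewrite scalemx1.
rewrite (lin_scale _ e (lambda_linear q)) lame /comm !mulmx_block.
rewrite !mul0mx !mulmx0 !addr0 !add0r !row_mul_h0 scale_block_mx !scaler0.
rewrite !(opp_block_mx, add_block_mx) !scale_scalar_mx.
move=> /un1_block[u1 _ _ /matrixP/(_ 0 0) h4]; split.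
  rewrite (_ : _ + _ = pB k X Y - (P X *m (Q Y)^T - P Y *m (Q X)^T)
     + (2%:R * delta * omega0 X Y * a)%:M) //.
  rewrite opprB addrA; congr (_ + _%:M); last ring.
  by rewrite addrAC.
move: h4; rewrite !mxE !eqxx !mulr1n /P /Q !h0_cmul (h0C Y X) (omega0C Y X) => h4.
by apply/eqP; rewrite -subr_eq0 -[X in _ == X]h4; apply/eqP; ring.
Qed.

Lemma vertical_coefficient : pc0 k = 2%:R * (delta * alpha - gamma * beta - delta * b).
Proof.
have [X [Y w1]] := @omega0_neq0 R n hn; have [_] := horizontal_equations X Y.
by rewrite w1 !mulr1.
Qed.

End FirstOrder.

Section Bianchi1.
Hypothesis b1 : forall u v w, R0 w u *m v + R0 u v *m w + R0 v w *m u = 0.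

(** The component along e of the Bianchi identity on X, Y and e. *)
Lemma bianchi1_vertical : pc0 k = 2%:R * pc4 k.
Proof.
have [X [Y w1]] := @omega0_neq0 R n hn.
have := b1 (horiz X) (horiz Y) e; rewrite (alt_anti e _ altR) mulNmx !RX RXY.
rewrite block_evec !block_horiz !row_mul_h0 !mul0mx opp_col_mx !add_col_mx.
move=> /(congr1 dsubmx) /matrixP/(_ 0 0); rewrite col_mxKd.
rewrite !mxE !eqxx !mulr1n !h0_cmul1 (h0C Y X) (omega0C Y X) w1 => h; lra.
Qed.

Lemma bianchi1_horizontal X Y Z :
  pB k X Y *m Z + pB k Y Z *m X + pB k Z X *m Y = 0.
Proof.
have := b1 (horiz X) (horiz Y) (horiz Z); rewrite !RXY !block_horiz !mul0mx.
rewrite !add_col_mx => /(congr1 usubmx); rewrite col_mxKu linear0 => h.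
by rewrite -[RHS]h addrC addrA.
Qed.

End Bianchi1.

Hypothesis cond : forall u v, g (R0 u v - comm (lambda q u) (lambda q v)
     + lambda q (lambda q u *m v - lambda q v *m u)).
Hypothesis b1 : forall u v w, R0 w u *m v + R0 u v *m w + R0 v w *m u = 0.

(** Compare the value of c0 given by the condition modulo the Lie algebra with
    the one given by the Bianchi identity. *)
Lemma branch_equation : delta * (a - alpha) = 0.
Proof.
have [_ _ _ h4] := mixed_coefficients cond.
have := bianchi1_vertical b1; rewrite (vertical_coefficient cond) h4 => h; lra.
Qed.

(* The part of B that the condition leaves undetermined. The last term, which
   lies in u(n), is included for the sake of the Bianchi identity. *)
Let S X Y : 'M[R]_(n + n) := pB k X Y - P X *m (Q Y)^T + P Y *m (Q X)^T
  + (2%:R * a * delta * omega0 X Y)%:M + (2%:R * beta * delta * omega0 X Y) *: J.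

Let SE X Y Z : S X Y *m Z = pB k X Y *m Z - h0 (Q Y) Z *: P X + h0 (Q X) Z *: P Y
  + (2%:R * a * delta * omega0 X Y) *: Z
  + (2%:R * beta * delta * omega0 X Y) *: (J *m Z).
Proof.
rewrite /S; move: (P X) (P Y) (Q X) (Q Y) => ? ? ? ?.
by rewrite !mulmxDl mulNmx !mul_outer mul_scalar_mx -scalemxAl.
Qed.

Let Su X Y : un (S X Y).
Proof.
have [u _] := horizontal_equations cond X Y.
by apply: un_add => //; apply: un_scale; apply: un_J.
Qed.

(** The remainder S takes values in u(n), satisfies the Bianchi identity
    thanks to the branch equation, and is equivariant; it is therefore a
    multiple of K. *)
Lemma horizontal_block : exists kappa, forall X Y Z, pB k X Y *m Z =
  h0 (Q Y) Z *: P X - h0 (Q X) Z *: P Y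
  - (2%:R * a * delta * omega0 X Y) *: Z
  - (2%:R * beta * delta * omega0 X Y) *: (J *m Z)
  + kappa *: K X Y Z.
Proof.
clearbody S; have [[l1 l2 B0] eB] := kf.1.
have [kappa kE] : exists kappa, forall X Y Z, S X Y *m Z = kappa *: K X Y Z.
  apply: (kaehler_invariant hn).
  - split=> [Y c X X'|X c Y Y'|X]; apply: mx_ext => Z.
    + rewrite mulmxDl -scalemxAl !SE l1 mulmxDl -scalemxAl /P /Q !cmulD /omega0.
      rewrite mulmxDr -scalemxAr !h0_lin; move: (J *m Z) (pB k X Y *m Z) (pB k X' Y *m Z).
      by move=> *; apply/colP => i; rewrite !mxE; ring.
    + rewrite mulmxDl -scalemxAl !SE l2 mulmxDl -scalemxAl /P /Q !cmulD /omega0.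
      rewrite !h0_lin; move: (J *m Z) (pB k X Y *m Z) (pB k X Y' *m Z).
      by move=> *; apply/colP => i; rewrite !mxE; ring.
    + by rewrite SE B0 mul0mx /omega0 h0JX !mulr0 !scale0r !addr0 add0r addNr.
  - exact: Su.
  - move=> X Y Z; rewrite !SE; have h := bianchi1_horizontal b1 X Y Z.
    rewrite -[RHS]h; have hd := branch_equation.
    rewrite /P /Q !h0_cmul1 (h0C Z X) (h0C Y X) (h0C Z Y) (omega0C Z X) (omega0C Y X).
    rewrite (omega0C Z Y) /cmul.
    move: (pB k X Y *m Z) (pB k Y Z *m X) (pB k Z X *m Y) (J *m X) (J *m Y) (J *m Z).
    have [d0|an] : delta = 0 \/ a = alpha.
        move/eqP: hd; rewrite mulf_eq0 => /orP[/eqP|]; [by left|].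
        by rewrite subr_eq0 => /eqP; right.
      by rewrite d0 => *; apply/colP => i; rewrite !mxE; ring.
    by rewrite an => *; apply/colP => i; rewrite !mxE; ring.
  - move=> A X Y UA; apply: mx_ext => Z; rewrite -!mulmxA !SE eB //.
    rewrite -!mulmxA (mulmxA (invmx A)) mulVmx ?Un_unit // mul1mx.
    rewrite /P /Q -!Un_cmul // /omega0 -!(Un_J _ UA) !Un_h0 //.
    move: (cmul alpha beta X) (cmul alpha beta Y) (cmul gamma delta X).
    move: (cmul gamma delta Y) (J *m Z) => *.
    by rewrite !mulmxDr mulmxN -!scalemxAr.
exists kappa => X Y Z; rewrite -kE SE.
move: (pB k X Y *m Z) (P X) (P Y) (J *m Z) => *.
by apply/colP => i; rewrite !mxE; ring.
Qed.

End Equations.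

End Classification.

(** * The second Bianchi identity and the coefficient of K *)

Section Families.
Variables (R : realType) (n : nat) (hn : (1 <= n)%N).
Notation H := 'cV[R]_(n + n).
Notation V := 'cV[R]_(n + n + 1).
Local Notation J := (@J0 R n).
Local Notation e := (evec R n).
Local Notation g := (@un1 R n).
Implicit Types (X Y Z : H) (s : R).

Lemma un_h0r (A : 'M[R]_(n + n)) X Y : un A -> h0 X (A *m Y) = - h0 (A *m X) Y.
Proof. by case=> At _; rewrite h0_mulmx At mulNmx h0Nr opprK. Qed.

Lemma un_Jr (A : 'M[R]_(n + n)) X : un A -> A *m (J *m X) = J *m (A *m X).
Proof. by case=> _ AJ; rewrite !mulmxA AJ. Qed.

(** Every term on the right is built from h0 and J, which u(n) leaves
    invariant. *)
Lemma block_invariant (A : 'M[R]_(n + n)) (B : H -> H -> 'M[R]_(n + n))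
    (x y z w m r kappa : R) : un A ->
  (forall X Y Z, B X Y *m Z =
    h0 (cmul z w Y) Z *: cmul x y X - h0 (cmul z w X) Z *: cmul x y Y
    - (m * omega0 X Y) *: Z - (r * omega0 X Y) *: (J *m Z) + kappa *: K X Y Z) ->
  forall X Y, comm A (B X Y) = B (A *m X) Y + B X (A *m Y).
Proof.
move=> uA BE X Y; apply: mx_ext => Z; rewrite /comm mulmxBl mulmxDl -!mulmxA !BE /K /omega0.
rewrite -!(un_cmul _ _ _ uA) -!(un_Jr _ uA) !(un_h0r _ _ uA).
move: (cmul x y X) (cmul x y Y) (cmul z w X) (cmul z w Y) (J *m X) (J *m Y) (J *m Z).
move=> PX PY QX QY JX JY JZ.
rewrite !(mulmxDr, mulmxBr, mulmxN, =^~ scalemxAr).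
move: (A *m PX) (A *m PY) (A *m QX) (A *m QY) (A *m JX) (A *m JY) (A *m JZ).
move: (A *m X) (A *m Y) (A *m Z) => *.
by apply/colP => i; rewrite !mxE; ring.
Qed.

Section Equations.
Variables (q : inner_params R) (k : curvature_params R n).
Variables (R0 : V -> V -> 'M[R]_(n + n + 1)).
Hypotheses (altR : alternating_bilinear R0) (kf : curvature_form k R0).

(** The other blocks of R0 are combinations of the identity, J and omega0,
    which u(n) leaves invariant; only B requires a hypothesis. *)
Lemma curvature_invariant :
  (forall A X Y, un A -> comm A (pB k X Y) = pB k (A *m X) Y + pB k X (A *m Y)) ->
  forall A u v, g A -> comm A (R0 u v) = R0 (A *m u) v + R0 u (A *m v).
Proof.
move=> Binv _ u v [A uA <-]; have [l1 l2 R00] := altR.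
have RX X : R0 (horiz X) e = _ := (kf.2 X X).1.
have RXY X Y : R0 (horiz X) (horiz Y) = _ := (kf.2 X Y).2.
have commD (B C D : 'M[R]_(n + n + 1)) : comm B (C + D) = comm B C + comm B D.
  by rewrite /comm mulmxDr mulmxDl opprD addrACA.
have commZ c (B C : 'M[R]_(n + n + 1)) : comm B (c *: C) = c *: comm B C.
  by rewrite /comm -scalemxAl -scalemxAr scalerBr.
have Ah X : block_mx A 0 0 0 *m horiz X = horiz (A *m X) by rewrite block_horiz mul0mx.
have Ae : block_mx A 0 0 (0 : 'M[R]_1) *m e = 0 by rewrite [LHS]block_evec col_mx0.
have hXe X : comm (block_mx A 0 0 0) (R0 (horiz X) e) = R0 (horiz (A *m X)) e.
  rewrite !RX /comm !mulmx_block !mul0mx !mulmx0 !addr0.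
  rewrite opp_block_mx add_block_mx !subr0 sub0r un_cmul //.
  congr block_mx; rewrite -un_cmul // trmx_mul; case: uA => -> _.
  by rewrite mulmxN.
have hXY X Y : comm (block_mx A 0 0 0) (R0 (horiz X) (horiz Y)) =
    R0 (horiz (A *m X)) (horiz Y) + R0 (horiz X) (horiz (A *m Y)).
  rewrite !RXY /comm !mulmx_block !mul0mx !mulmx0 !addr0.
  rewrite opp_block_mx !add_block_mx !subr0 !addr0 -Binv //.
  congr block_mx; rewrite /omega0 un_h0r // un_Jr // mulrN.
  by apply/matrixP => i j; rewrite !ord1 !mxE eqxx !mulr1n addrC addNr.
rewrite [u]vecE [v]vecE; set X := usubmx u; set Y := usubmx v.
set s := dsubmx u 0 0; set t := dsubmx v 0 0.
have expand X' Y' s' t' : R0 (horiz X' + s' *: e) (horiz Y' + t' *: e) =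
    R0 (horiz X') (horiz Y') + t' *: R0 (horiz X') e - s' *: R0 (horiz Y') e.
  rewrite (lin_add _ _ (l1 _)) (lin_scale _ _ (l1 _)) !(lin_add _ _ (l2 _)).
  rewrite !(lin_scale _ _ (l2 _)) R00 scaler0 addr0 (alt_anti e _ altR) scalerN.
  by [].
rewrite !mulmxDr -!scalemxAr Ae !scaler0 !addr0 !Ah.
have -> : horiz (A *m X) = horiz (A *m X) + 0 *: e by rewrite scale0r addr0.
have -> : horiz (A *m Y) = horiz (A *m Y) + 0 *: e by rewrite scale0r addr0.
rewrite !expand !scale0r !addr0 !subr0 -scaleNr !commD !commZ hXY !hXe scaleNr.
move: (R0 _ _) (R0 _ _) (R0 _ _) (R0 _ _) => B1 B2 B3 B4.
by apply/matrixP => i j; rewrite !mxE; ring.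
Qed.

(** In the second Bianchi identity on v, J v and e, where v is a unit vector,
    the block on H applied to J v and paired with v isolates the contribution
    of K. *)
Lemma kaehler_coefficient (kappa a b alpha beta gamma : R) :
  (forall X Y Z, pB k X Y *m Z =
     gamma *: (h0 Y Z *: cmul alpha beta X - h0 X Z *: cmul alpha beta Y)
     + kappa *: K X Y Z) ->
  pc1 k = b * alpha - alpha ^+ 2 + beta ^+ 2 ->
  pc2 k = beta * (b - 2%:R * alpha) ->
  pc3 k = (2%:R * a - b - alpha) * gamma -> pc4 k = - (beta * gamma) ->
  (forall u v w, let lam := lambda (InnerParams a b alpha beta gamma 0) in
    lie_action (lam w) R0 u v + lie_action (lam u) R0 v w + lie_action (lam v) R0 w u = 0) ->
  kappa * (a - alpha) = 0.
Proof.
move=> BE c1 c2 c3 c4 b2; have [l1 l2 R00] := altR.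
have RX X : R0 (horiz X) e = _ := (kf.2 X X).1.
have RXY X Y : R0 (horiz X) (horiz Y) = _ := (kf.2 X Y).2.
have [v v1] := unit_vector R hn.
have := b2 (horiz v) (horiz (J *m v)) e; rewrite /lie_action /= lambda_evec !lambda_horiz /=.
rewrite !block_evec !block_horiz !mul_scalar_mx !mul0mx !row_mul_h0 -/(horiz _).
have cE (D : 'M[R]_1) : col_mx 0 D = (D 0 0) *: e.
  by rewrite /evec scale_col_mx scaler0 {1}[D]mx11_scalar scalemx1.
rewrite !cE -!/(horiz _) !mxE !eqxx !mulr1n.
rewrite !(lin_scale _ _ (l1 _), lin_scale _ _ (l2 _)) !R00 !scaler0 !subr0.
rewrite (alt_anti e _ altR) !RX !RXY.
rewrite /comm !(mulmxN, mulNmx) !mulmx_block !(opp_block_mx, add_block_mx).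
have ul0 : ulsubmx (0 : 'M[R]_(n + n + 1)) = 0 :> 'M[R]_(n + n).
  by apply/matrixP => i j; rewrite !mxE.
move=> /(congr1 ulsubmx); rewrite block_mxKul ul0.
rewrite !(mul0mx, mulmx0, addr0, add0r) mul_scalar_mx mul_mx_scalar subrr sub0r.
move=> /(congr1 (fun A => h0 v (A *m (J *m v)))); rewrite mul0mx.
have h00 : h0 v 0 = 0 by rewrite h0C h0E big1 // => i _; rewrite mxE mul0r.
rewrite h00 !(mulmxDl, mulNmx) !mul_outer !BE c1 c2 c3 c4 /K /omega0 /cmul.
do 2 rewrite !(mulmxDr, mulmxN, =^~scalemxAr, JJ) !(h0_lin, h0JJ, h0Jr, JJ, h0JX, v1).
move=> h; lra.
Qed.

End Equations.
End Families.

(** * Classification of torsion-free connections *)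

Section TorsionFreeClassification.
Variables (R : realType) (n : nat) (hn : (1 <= n)%N).
Variables (M : manifold R (n + n + 1)) (P : M -> set 'M[R]_(n + n + 1)).
Hypothesis hP : is_Gstructure (@Un1 R n) P.
Notation H := 'cV[R]_(n + n).
Notation V := 'cV[R]_(n + n + 1).

Lemma torsion_free_characteristic (nabla : connection M) T0 R0 I0 :
  torsion_free nabla -> characteristic_tensors (@un1 R n) nabla P T0 R0 I0 ->
  forall u v, T0 u v = 0.
Proof.
move=> tf ct u v; have [x _] := mfd_nonempty M; have [p Pp] := frame_at hP x.
have up := Gstr_frame hP Pp; have := char_torsion ct u v Pp.
rewrite tf => /(congr1 (mulmx (invmx p))).
by rewrite mulmx0 mulKmx.
Qed.

(** At the value p of a section, the identities derived from the structure
    equations hold for all vectors of V. The branch equation separates a =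
    alpha from delta = 0, and if a differs from alpha the second Bianchi
    identity removes the multiple of K. *)
Lemma torsion_free_family (nabla : connection M) T0 R0 I0 q k :
  is_connection nabla -> torsion_free nabla ->
  characteristic_tensors (@un1 R n) nabla P T0 R0 I0 ->
  inner_form q I0 -> curvature_form k R0 -> in_exactly_one_family q k.
Proof.
move=> hc tf ct qf kf; have T00 := torsion_free_characteristic tf ct.
have altR := char_R0_alt ct.
have [x _] := mfd_nonempty M; have [p Pp] := frame_at hP x.
have up := Gstr_frame hP Pp.
have [D [Sg [A [z [cA Oz SgE]]]]] := cartan_exists hP (lie0 (@un1_lie R n)) hc ct Pp.
have SgK u : Sg (p *m u) z = u by rewrite SgE mulKmx.
have lin := @lambda_linear R n q; have inv := @lambda_invariant R n q.
have cond u v : @un1 R n (R0 u v - comm (lambda q u) (lambda q v)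
     + lambda q (lambda q u *m v - lambda q v *m u)).
  have := curvature_mod_lie (@un1_lie R n) lin inv qf cA (p *m u) (p *m v) Oz.
  by cbv zeta; rewrite !SgK T00 subr0.
have b1 u v w : R0 w u *m v + R0 u v *m w + R0 v w *m u = 0.
  have := cartan_bianchi1 cA T00 (p *m u) (p *m v) (p *m w) Oz.
  by rewrite !SgK.
have b2 (Rinv : forall A u v, @un1 R n A ->
      comm A (R0 u v) = R0 (A *m u) v + R0 u (A *m v)) u v w :
    lie_action (lambda q w) R0 u v + lie_action (lambda q u) R0 v w
    + lie_action (lambda q v) R0 w u = 0.
  have := cartan_bianchi2 qf cA T00 altR Rinv (p *m u) (p *m v) (p *m w) Oz.
  by cbv zeta; rewrite !SgK.
case: q qf lin inv cond b2 => a b alpha beta gamma delta qf lin inv cond b2.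
have [c1 c2 c3 c4] := mixed_coefficients hn kf cond.
have c0 := bianchi1_vertical hn altR kf b1.
have br := branch_equation hn altR kf cond b1.
have [kappa BE] := horizontal_block hn altR kf cond b1.
split.
- have [aa|aa] := eqVneq a alpha.
    have [q0|q0] := pselect (InnerParams a b alpha beta gamma delta = inner0).
      apply: Or31; move: q0 => [a0 b0 al0 be0 ga0 de0]; split.
      + by rewrite a0 b0 al0 be0 ga0 de0.
      + by rewrite c0 c1 c2 c3 c4 a0 b0 al0 be0 ga0 de0; split; ring.
      + exists kappa => X Y Z; rewrite BE a0 al0 be0 ga0 de0.
        rewrite /cmul !scale0r !addr0 !scaler0 !mulr0 !mul0r !scale0r !subr0.
        by rewrite add0r.
    apply: Or32; split=> //; last by exists kappa.
    by rewrite c0 c1 c2 c3 c4 aa; split; ring.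
  apply: Or33; have d0 : delta = 0.
    by move/eqP: br; rewrite mulf_eq0 subr_eq0 (negbTE aa) orbF => /eqP.
  rewrite d0 in c3 c4 BE br b2.
  have BE' X Y Z : pB k X Y *m Z =
     gamma *: (h0 Y Z *: cmul alpha beta X - h0 X Z *: cmul alpha beta Y) + kappa *: K X Y Z.
    rewrite BE !mulr0 !mul0r !scale0r !subr0; congr (_ + _).
    by rewrite !h0_cmul1 !mul0r !addr0 scalerBr !scalerA.
  have k0 : kappa = 0.
    have := kaehler_coefficient hn altR kf BE' c1 c2.
    have c3' : pc3 k = (2%:R * a - b - alpha) * gamma by rewrite c3; ring.
    have c4' : pc4 k = - (beta * gamma) by rewrite c4; ring.
    move=> /(_ a c3' c4') HH.
    have : kappa * (a - alpha) = 0.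
      apply: HH => u v w; apply: b2 => A' u' v' gA'.
      apply: (curvature_invariant altR kf) gA' => A'' X Y uA.
      by apply: (block_invariant uA BE).
    by move=> /eqP; rewrite mulf_eq0 subr_eq0 (negbTE aa) orbF => /eqP.
  split=> //; first exact/eqP.
    by rewrite c0 c1 c2 c3 c4; split; ring.
  by move=> X Y Z; rewrite BE' k0 scale0r addr0.
- by case=> -[q0 _ _] [q1 _ _ _].
- by case=> -[q0 _ _] [q1 _ _ _]; apply: q1; move: q0 => [-> _ -> _ _ _].
- by case=> -[_ a1 _ _] [a2 _ _ _].
Qed.

End TorsionFreeClassification.

(** * Effect of the torsion on the curvature *)

Section TorsionMatrix.
Variables (R : realType) (n : nat) (hn : (1 <= n)%N).
Notation H := 'cV[R]_(n + n).
Notation V := 'cV[R]_(n + n + 1).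
Local Notation J := (@J0 R n).
Local Notation e := (evec R n).
Local Notation g := (@un1 R n).
Implicit Types (X Y Z : H) (s : R) (t : torsion_params R).

Definition cmul_mx x y : 'M[R]_(n + n) := x%:M + y *: J.

Lemma cmul_mxE x y X : cmul_mx x y *m X = cmul x y X.
Proof. by rewrite mulmxDl mul_scalar_mx -scalemxAl. Qed.

Lemma row_cmul_mx x y X : X^T *m cmul_mx x y = (cmul x (- y) X)^T.
Proof.
apply: trmx_inj; rewrite trmxK trmx_mul trmxK /cmul_mx trmxD trmxZ tr_scalar_mx J0_tr.
by rewrite scalerN -scaleNr -/(cmul_mx x (- y)) cmul_mxE.
Qed.

(** The endomorphism v |-> T0 (u, v) for the torsion T0 with parameters t; one
    half of it is what the torsion contributes to lambda. *)
Definition Tmx t (u : V) : 'M[R]_(n + n + 1) :=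
  let X := usubmx u in let s := dsubmx u 0 0 in
  block_mx ((- s) *: cmul_mx (tau1 t) (tau2 t)) (cmul (tau1 t) (tau2 t) X)
    (tau3 t *: (J *m X))^T 0.

Lemma TmxE t X s : Tmx t (horiz X + s *: e) =
  block_mx ((- s) *: cmul_mx (tau1 t) (tau2 t)) (cmul (tau1 t) (tau2 t) X)
    (tau3 t *: (J *m X))^T 0.
Proof.
rewrite /Tmx; have -> : usubmx (horiz X + s *: e) = X.
  by rewrite linearD linearZ /= usub_horiz usub_evec scaler0 addr0.
have -> : dsubmx (horiz X + s *: e) 0 0 = s.
  by rewrite linearD linearZ /= dsub_horiz dsub_evec !mxE eqxx mulr1 add0r.
by [].
Qed.

Lemma Tmx_horiz t X : Tmx t (horiz X) =
  block_mx 0 (cmul (tau1 t) (tau2 t) X) (tau3 t *: (J *m X))^T 0.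
Proof.
have -> : horiz X = horiz X + 0 *: e by rewrite scale0r addr0.
by rewrite TmxE oppr0 scale0r.
Qed.

Lemma Tmx_evec t : Tmx t e = block_mx (- cmul_mx (tau1 t) (tau2 t)) 0 0 0.
Proof.
have -> : e = horiz 0 + 1 *: e by rewrite /horiz col_mx0 add0r scale1r.
by rewrite TmxE cmul0 mulmx0 scaler0 trmx0 scaleN1r.
Qed.

Lemma Tmx_linear t : linear (Tmx t).
Proof.
move=> k u v; rewrite /Tmx scale_block_mx add_block_mx.
have -> : usubmx (k *: u + v) = k *: usubmx u + usubmx v by rewrite linearP.
have -> : dsubmx (k *: u + v) = k *: dsubmx u + dsubmx v by rewrite linearP.
rewrite cmulD mulmxDr -scalemxAr (scalerDr (tau3 t)) trmxD scaler0 addr0.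
congr block_mx.
  rewrite scalerA -scalerDl !mxE; congr (_ *: _); ring.
by rewrite !trmxZ !scalerA mulrC.
Qed.

Lemma Tmx_zero t : Tmx t 0 = 0.
Proof. exact: lin_zero (Tmx_linear t). Qed.

Lemma torsion_formE t (T0 : V -> V -> V) : alternating_bilinear T0 ->
  torsion_form t T0 <-> (forall u v, T0 u v = Tmx t u *m v).
Proof.
move=> altT; have [l1 l2 T00] := altT; split=> [tf u v|TE X Y]; last first.
  rewrite !TE !Tmx_horiz block_horiz block_evec mul0mx row_mul_h0 h0Zl -/(omega0 X Y).
  by rewrite /evec scale_col_mx scaler0 scalemx1.
rewrite [u]vecE [v]vecE; set X := usubmx u; set Y := usubmx v.
set s := dsubmx u 0 0; set r := dsubmx v 0 0.
rewrite (lin_add _ _ (l1 _)) (lin_scale _ _ (l1 _)) !(lin_add _ _ (l2 _)).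
rewrite !(lin_scale _ _ (l2 _)) T00 scaler0 addr0 (alt_anti e _ altT).
have [-> ->] := tf X Y; have [_ ->] := tf Y Y.
rewrite (lin_add _ _ (Tmx_linear t)) (lin_scale _ _ (Tmx_linear t)) Tmx_horiz Tmx_evec.
rewrite mulmxDl -!scalemxAl !mulmxDr -!scalemxAr !block_horiz !block_evec.
rewrite !mul0mx row_mul_h0 h0Zl -/(omega0 X Y) mulNmx cmul_mxE col_mx0 scaler0 addr0.
rewrite /horiz opp_col_mx !scale_col_mx !add_col_mx !scaler0 scalemx1.
by rewrite oppr0 scaler0.
Qed.

Lemma Tmx_alternating t : alternating_bilinear (fun u v => Tmx t u *m v).
Proof.
split=> [v k u u'|u k v v'|u].
- by rewrite Tmx_linear mulmxDl scalemxAl.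
- by rewrite mulmxDr scalemxAr.
rewrite [u]vecE TmxE mulmxDr -scalemxAr block_horiz block_evec row_mul_h0.
rewrite h0Zl h0JX mulr0 -scalemxAl cmul_mxE scale_col_mx scaler0 add_col_mx addr0.
by rewrite raddf0 scaleNr addNr col_mx0.
Qed.

Lemma cmul_mx_un (A : 'M[R]_(n + n)) x y : un A -> A *m cmul_mx x y = cmul_mx x y *m A.
Proof.
move=> uA; apply: mx_ext => X; rewrite -!mulmxA cmul_mxE un_cmul //.
by rewrite cmul_mxE.
Qed.

Lemma Tmx_invariant t A a : g A -> comm A (Tmx t a) = Tmx t (A *m a).
Proof.
case=> A' uA <-; have [At AJ] := uA; rewrite [a in RHS]vecE mulmxDr block_horiz -scalemxAr.
rewrite block_evec mul0mx col_mx0 scaler0 addr0 -/(horiz _) Tmx_horiz.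
rewrite /comm /Tmx !mulmx_block !mul0mx !mulmx0 !addr0 -scalemxAr -scalemxAl.
rewrite cmul_mx_un // opp_block_mx add_block_mx subrr !subr0 sub0r un_cmul //.
congr block_mx; rewrite !trmxZ -scalemxAl -scalerN; congr (_ *: _).
by rewrite -(un_Jr _ uA) [in RHS]trmx_mul At mulmxN.
Qed.

Lemma Tmx_Un t h (u v : V) : @Un1 R n h -> Tmx t (h *m u) *m (h *m v) = h *m (Tmx t u *m v).
Proof.
case=> A UA <-; rewrite -/(Gmx A).
have TG (w : V) : Tmx t (Gmx A *m w) *m Gmx A = Gmx A *m Tmx t w.
  rewrite [w]vecE mulmxDr -scalemxAr Gmx_horiz Gmx_evec !TmxE Gmx_l Gmx_r.
  rewrite Un_cmul //; congr block_mx.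
    rewrite -scalemxAl -scalemxAr; congr (_ *: _); apply: mx_ext => X.
    by rewrite -!mulmxA !cmul_mxE Un_cmul.
  rewrite !trmxZ -scalemxAl; congr (_ *: _); rewrite -(Un_J _ UA) trmx_mul -mulmxA.
  by case: UA => -> _; rewrite mulmx1.
by rewrite !mulmxA TG -!mulmxA.
Qed.

Section Formulas.
Variables (a b alpha beta gamma delta : R) (t : torsion_params R).
Let q := InnerParams a b alpha beta gamma delta.
Variables (ks k : curvature_params R n).
Variables (R0s R0 : V -> V -> 'M[R]_(n + n + 1)).
Hypotheses (ksf : curvature_form ks R0s) (kf : curvature_form k R0).
Let S0 u := 2%:R^-1 *: Tmx t u.
Hypothesis R0E : forall u v, R0 u v = R0s u v
  + (comm (lambda q u) (S0 v) - S0 (lambda q u *m v))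
  - (comm (lambda q v) (S0 u) - S0 (lambda q v *m u)) + comm (S0 u) (S0 v).

Lemma cmulJ x X : x *: (J *m X) = cmul 0 x X.
Proof. by rewrite /cmul scale0r add0r. Qed.

Lemma mixed_with_torsion :
  [/\ pc1 k = pc1 ks + 2%:R^-1 * b * tau1 t + 4%:R^-1 * (tau1 t ^+ 2 - tau2 t ^+ 2),
      pc2 k = pc2 ks + 2%:R^-1 * b * tau2 t + 2%:R^-1 * tau1 t * tau2 t,
      pc3 k = pc3 ks - 2%:R^-1 * gamma * tau1 t - 2%:R^-1 * delta * tau2 t
              + 2%:R^-1 * beta * tau3 t - 4%:R^-1 * tau2 t * tau3 t
    & pc4 k = pc4 ks - 2%:R^-1 * delta * tau1 t + 2%:R^-1 * gamma * tau2 t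
              + (a - (alpha + b) / 2%:R) * tau3 t - 4%:R^-1 * tau1 t * tau3 t].
Proof.
have main X : cmul (pc1 k) (pc2 k) X =
    cmul (pc1 ks + 2%:R^-1 * b * tau1 t + 4%:R^-1 * (tau1 t ^+ 2 - tau2 t ^+ 2))
      (pc2 ks + 2%:R^-1 * b * tau2 t + 2%:R^-1 * tau1 t * tau2 t) X /\
    cmul (pc3 k) (pc4 k) X =
    cmul (pc3 ks - 2%:R^-1 * gamma * tau1 t - 2%:R^-1 * delta * tau2 t
              + 2%:R^-1 * beta * tau3 t - 4%:R^-1 * tau2 t * tau3 t)
      (pc4 ks - 2%:R^-1 * delta * tau1 t + 2%:R^-1 * gamma * tau2 t
              + (a - (alpha + b) / 2%:R) * tau3 t - 4%:R^-1 * tau1 t * tau3 t) X.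
  have [RXs _] := ksf.2 X X; have [RX _] := kf.2 X X.
  have := R0E (horiz X) e; rewrite RX RXs /S0 lambda_horiz lambda_evec /=.
  rewrite block_evec block_horiz mul_scalar_mx mul0mx -!/(horiz _) !Tmx_horiz Tmx_evec.
  rewrite /comm !scale_block_mx !mulmx_block !(opp_block_mx, add_block_mx).
  rewrite !(mul0mx, mulmx0, scaler0, addr0, add0r, subr0, sub0r, oppr0).
  move=> /eq_block_mx[_ h1 h2 _]; split.
    rewrite h1 !mul_scalar_mx !mul_mx_scalar -!scalemxAl -!scalemxAr.
    rewrite !(mulNmx, mulmxN, scalerN, opprK) !cmul_mxE (cmul1 a X) !cmul_norm.
    by congr (cmul _ _ X); field.
  move: (congr1 trmx h2); rewrite trmxK => ->.
  rewrite !mul_scalar_mx !mul_mx_scalar -!scalemxAl -!scalemxAr.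
  rewrite !(mulNmx, mulmxN, scalerN, opprK) !row_cmul_mx.
  rewrite !(trmxD, trmxN, trmxZ, trmxK) !cmulJ !cmul_norm.
  by congr (cmul _ _ X); field.
have [e1 e2] := cmul_inj hn (fun X => (main X).1).
by have [e3 e4] := cmul_inj hn (fun X => (main X).2); split.
Qed.

Lemma horizontal_with_torsion X Y :
  pc0 k * omega0 X Y = (pc0 ks + delta * tau1 t - gamma * tau2 t + alpha * tau3 t
              + 2%:R^-1 * tau1 t * tau3 t) * omega0 X Y /\
  forall Z, pB k X Y *m Z = pB ks X Y *m Z
     + (tau3 t / 2%:R) *: (
         omega0 Y Z *: (cmul alpha beta X + 2%:R^-1 *: cmul (tau1 t) (tau2 t) X)
         - omega0 X Z *: (cmul alpha beta Y + 2%:R^-1 *: cmul (tau1 t) (tau2 t) Y))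
     + (delta * omega0 X Y) *: cmul (tau1 t) (tau2 t) Z
     - (2%:R^-1 * h0 (cmul gamma delta X) Z) *: cmul (tau1 t) (tau2 t) Y
     + (2%:R^-1 * h0 (cmul gamma delta Y) Z) *: cmul (tau1 t) (tau2 t) X.
Proof.
have [_ RXs] := ksf.2 X Y; have [_ RX] := kf.2 X Y.
have := R0E (horiz X) (horiz Y); rewrite RX RXs /S0 !lambda_horiz /=.
rewrite !block_horiz !mul0mx !row_mul_h0.
have cE (D : 'M[R]_1) : col_mx 0 D = (D 0 0) *: e.
  by rewrite /evec scale_col_mx scaler0 {1}[D]mx11_scalar scalemx1.
rewrite !cE !mxE !eqxx !mulr1n !(lin_scale _ _ (Tmx_linear t)) !Tmx_horiz Tmx_evec.
rewrite /comm !scale_block_mx !mulmx_block !(opp_block_mx, add_block_mx).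
move=> /eq_block_mx[h1 _ _ h4]; split; last first.
  move=> Z; move: h1.
  rewrite (h0_cmul1 gamma delta X Y) (h0_cmul1 gamma delta Y X) (h0C Y X) (omega0C Y X).
  rewrite -(cmul_mxE (tau1 t) (tau2 t) Z) /omega0; move: (cmul_mx (tau1 t) (tau2 t)) => C.
  move: (cmul alpha beta X) (cmul alpha beta Y) (cmul gamma delta X) (cmul gamma delta Y).
  move: (cmul (tau1 t) (tau2 t) X) (cmul (tau1 t) (tau2 t) Y) (J *m X) (J *m Y).
  move=> TX TY JX JY PX PY QX QY ->.
  rewrite !(mul0mx, mulmx0, scaler0, addr0, add0r, subr0, sub0r, oppr0) !trmxZ.
  rewrite !(mulmxDl, mulNmx, mulmxN, =^~ scalemxAl, =^~ scalemxAr) !mul_outer.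
  by move: (pB ks X Y *m Z) (C *m Z) => *; apply/colP => i; rewrite !mxE; field.
move: h4 => /matrixP/(_ 0 0).
rewrite !(mul0mx, mulmx0, scaler0, addr0, add0r, subr0, sub0r, oppr0).
rewrite -!(scalemxAl, scalemxAr) !row_mul_h0 !mxE !eqxx !mulr1n !cmulJ !h0_cmul.
by rewrite (h0C Y X) (omega0C Y X) => ->; field.
Qed.

(** [R0E] expresses the curvature of a torsion-free connection shifted by one
    half of the torsion; the formulas are its blocks. *)
Lemma curvature_formulas : curvature_with_torsion q ks t k.
Proof.
have [c1 c2 c3 c4] := mixed_with_torsion.
have c0 : pc0 k = pc0 ks + delta * tau1 t - gamma * tau2 t + alpha * tau3 t
              + 2%:R^-1 * tau1 t * tau3 t.
  have [X [Y w1]] := @omega0_neq0 R n hn; have [+ _] := horizontal_with_torsion X Y.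
  by rewrite w1 !mulr1.
rewrite /curvature_with_torsion /q.
have BE X Y := (horizontal_with_torsion X Y).2.
by move: c0 c1 c2 c3 c4 BE; case: t.
Qed.

End Formulas.
End TorsionMatrix.

(** * Symmetrization *)

Section Symmetrization.
Variables (R : realType) (n : nat) (hn : (1 <= n)%N).
Variables (M : manifold R (n + n + 1)) (P : M -> set 'M[R]_(n + n + 1)).
Hypothesis hP : is_Gstructure (@Un1 R n) P.
Notation H := 'cV[R]_(n + n).
Notation V := 'cV[R]_(n + n + 1).
Local Notation g := (@un1 R n).
Implicit Types (q : inner_params R) (t : torsion_params R).

Let hg := @un1_lie R n.

Lemma characteristic_params (nabla : connection M) T0 R0 I0 :
  characteristic_tensors g nabla P T0 R0 I0 ->
  [/\ exists t, unique (fun t' => torsion_form t' T0) t,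
      exists q, unique (fun q' => inner_form q' I0) q
    & exists k, unique (fun k' => curvature_form k' R0) k].
Proof.
move=> ct; have eq h (Gh : @Un1 R n h) := characteristic_equivariant hP ct Gh.
split.
- apply: torsion_form_exists => //; first exact: char_T0_alt ct.
  by move=> h u v /eq[].
- apply: inner_form_exists => //; first exact: char_I0_lin ct.
  by move=> h u /eq[].
- apply: curvature_form_exists => //; first exact: char_R0_alt ct.
  by move=> h u v /eq[].
Qed.

(** On e, one half of the torsion adds - (tau1 + tau2 J) / 2 to the block on
    H; the multiple of J belongs to u(n), and only tau1 changes the parameter
    a. *)
Lemma inner_form_with_torsion q t :
  inner_form (inner_with_torsion q t)
    (fun u : V => coset g (lambda q u + 2%:R^-1 *: Tmx t u)).
Proof.
case: q t => a b alpha beta gamma delta [t1 t2 t3] u.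
apply/coset_un1; rewrite [u]vecE !lambdaE TmxE /= scale_block_mx add_block_mx.
move: (usubmx u) (dsubmx u 0 0) => X s; apply/un1_sub_block; split.
- have -> : (a * s)%:M + 2%:R^-1 *: (- s *: cmul_mx n t1 t2) - ((a - t1 / 2%:R) * s)%:M
     = (- (2%:R^-1 * s * t2)) *: @J0 R n.
    rewrite /cmul_mx; apply/matrixP => i j; rewrite !mxE.
    by case: (i == j); rewrite ?mulr1n ?mulr0n; field.
  by apply: un_scale; apply: un_J.
- by rewrite !cmul_norm; congr (cmul _ _ X); field.
- rewrite -trmxZ -trmxD cmulJ !cmul_norm; congr (_^T).
  by congr (cmul _ _ X); field.
- by rewrite scaler0 addr0.
Qed.

Section Shift.
Variables (nabla : connection M) (hc : is_connection nabla) (T0 : V -> V -> V).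
Variables (R0 : V -> V -> 'M[R]_(n + n + 1)) (I0 : V -> set 'M[R]_(n + n + 1)).
Hypothesis ct : characteristic_tensors g nabla P T0 R0 I0.
Variables (q : inner_params R) (qf : inner_form q I0) (c : R) (t : torsion_params R).
Variable (S : M -> V -> V -> V).
Hypothesis SE : forall x p u v, P x p ->
  S x (p *m u) (p *m v) = p *m ((c *: Tmx t u) *m v).

Let S0 (u : V) : 'M[R]_(n + n + 1) := c *: Tmx t u.

Let S0_linear : linear S0.
Proof. by move=> k u v; rewrite /S0 Tmx_linear scalerDr !scalerA mulrC. Qed.

Let S0_invariant A a : g A -> comm A (S0 a) = S0 (A *m a).
Proof.
by move=> gA; rewrite /S0 -Tmx_invariant // /comm -scalemxAl -scalemxAr scalerBr.
Qed.

Lemma shift_connection : is_connection (add_tensor nabla S).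
Proof. exact: (add_tensor_connection hP hc S0_linear SE). Qed.

Lemma shift_characteristic :
  characteristic_tensors g (add_tensor nabla S) P
    (fun u v => T0 u v + ((c *: Tmx t u) *m v - (c *: Tmx t v) *m u))
    (shifted_curvature T0 R0 (lambda q) (fun u => c *: Tmx t u))
    (fun u : V => coset g (lambda q u + c *: Tmx t u)).
Proof.
exact: (add_tensor_characteristic hP hg hc ct (@lambda_linear R n q) qf S0_linear S0_invariant SE).
Qed.

End Shift.

(** The shift by S0 = T0 / 2. A connection is also obtained in this way from
    its symmetrization, so that this lemma yields the formulas for both halves
    of the theorem. *)
Lemma add_half_torsion (nablas : connection M) T0s R0s I0s qs ks t
    (T : M -> V -> V -> V) : is_connection nablas -> torsion_free nablas ->
  characteristic_tensors g nablas P T0s R0s I0s ->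
  inner_form qs I0s -> curvature_form ks R0s ->
  (forall x p u v, P x p -> T x (p *m u) (p *m v) = p *m (Tmx t u *m v)) ->
  let nabla := add_tensor nablas (fun x u v => 2%:R^-1 *: T x u v) in
  is_connection nabla /\ exists R0 I0,
    [/\ characteristic_tensors g nabla P (fun u v => Tmx t u *m v) R0 I0,
        inner_form (inner_with_torsion qs t) I0
      & forall k, curvature_form k R0 -> curvature_with_torsion qs ks t k].
Proof.
move=> hc tf cts qf kf TE nabla.
have SE x p u v : P x p -> 2%:R^-1 *: T x (p *m u) (p *m v) =
    p *m ((2%:R^-1 *: Tmx t u) *m v).
  by move=> Pp; rewrite (TE _ _ _ _ Pp) -scalemxAl -scalemxAr.
have T00 := torsion_free_characteristic hP tf cts.
pose S x (u v : V) := 2%:R^-1 *: T x u v; rewrite -/S in nabla *.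
split; first exact: (shift_connection hc (S := S) SE).
have := shift_characteristic hc cts qf (S := S) SE.
have -> : (fun u v => T0s u v + ((2%:R^-1 *: Tmx t u) *m v - (2%:R^-1 *: Tmx t v) *m u))
    = (fun u v => Tmx t u *m v).
  apply/funext => u; apply/funext => v; rewrite T00 add0r -!scalemxAl.
  rewrite (alt_anti v u (Tmx_alternating n t)) scalerN opprK -scalerDl.
  have -> : 2%:R^-1 + 2%:R^-1 = 1 :> R by field.
  by rewrite scale1r.
move=> ct; do 2 eexists; split; [exact: ct|exact: inner_form_with_torsion|].
move=> k kf'; case: qs qf ct kf' => a b alpha beta gamma delta qf ct kf'.
apply: (curvature_formulas hn kf kf') => u v.
by rewrite /shifted_curvature T00 (Tmx_zero n t) scaler0 addr0.
Qed.

End Symmetrization.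

Theorem theorem4p13 (R : realType) (n : nat) (hn : (1 <= n)%N)
    (M : manifold R (n + n + 1)) (P : M -> set 'M[R]_(n + n + 1))
    (hP : is_Gstructure (@Un1 R n) P) :
  (forall (nabla : connection M), is_connection nabla ->
   forall T0 R0 I0, characteristic_tensors (@un1 R n) nabla P T0 R0 I0 ->
   let nablas := symmetrized nabla in
   [/\ is_connection nablas, torsion_free nablas,
       infinitesimally_homogeneous (@un1 R n) nablas P,
       (forall x v Y,
          nabla x v Y = nablas x v Y + 2%:R^-1 *: torsion nabla x v (Y x))
     & forall T0s R0s I0s,
       characteristic_tensors (@un1 R n) nablas P T0s R0s I0s ->
       exists (t : torsion_params R) (q qs : inner_params R)
              (k ks : curvature_params R n),
       [/\ unique (fun t' => torsion_form t' T0) t,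
           unique (fun q' => inner_form q' I0) q /\
           unique (fun k' => curvature_form k' R0) k,
           unique (fun q' => inner_form q' I0s) qs /\
           unique (fun k' => curvature_form k' R0s) ks,
           in_exactly_one_family qs ks
         & q = inner_with_torsion qs t /\
           curvature_with_torsion qs ks t k]])
  /\
  (forall (nablas : connection M), is_connection nablas ->
   torsion_free nablas ->
   forall T0s R0s I0s,
   characteristic_tensors (@un1 R n) nablas P T0s R0s I0s ->
   forall (qs : inner_params R) (ks : curvature_params R n),
   inner_form qs I0s -> curvature_form ks R0s ->
   forall (t : torsion_params R) T0,
   alternating_bilinear T0 -> torsion_form t T0 ->
   let nabla :=
     add_tensor nablas (fun x u v => 2%:R^-1 *: tensor_of P T0 x u v) in
   [/\ is_connection nabla,
       (forall x v Y, smooth_field_near x Y ->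
          symmetrized nabla x v Y = nablas x v Y),
       in_exactly_one_family qs ks
     & exists R0 I0 k,
       [/\ characteristic_tensors (@un1 R n) nabla P T0 R0 I0,
           inner_form (inner_with_torsion qs t) I0,
           curvature_form k R0
         & curvature_with_torsion qs ks t k]]).
Proof.
have sym_frame (T0 : 'cV[R]_(n + n + 1) -> _) (t : torsion_params R) :
    alternating_bilinear T0 -> torsion_form t T0 ->
    forall u v, T0 u v = Tmx t u *m v.
  by move=> altT tf; apply/(torsion_formE _ altT).
split.
  move=> nabla hc T0 R0 I0 ct nablas; have altT := char_T0_alt ct.
  have [[t ut] [q uq] [k uk]] := characteristic_params hn hP ct.
  have TE := sym_frame T0 t altT ut.1.
  have TP x p u v : P x p -> torsion nabla x (p *m u) (p *m v) = p *m (Tmx t u *m v).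
    by move=> Pp; rewrite (char_torsion ct _ _ Pp) TE.
  (* Symmetrization is the shift by minus one half of the torsion. *)
  have SE x p u v : P x p -> - (2%:R^-1 *: torsion nabla x (p *m u) (p *m v)) =
      p *m ((- 2%:R^-1 *: Tmx t u) *m v).
    by move=> Pp; rewrite (TP _ _ _ _ Pp) -scalemxAl -scalemxAr scaleNr.
  have hcs : is_connection nablas := shift_connection hP hc (S := fun x u v => - (2%:R^-1 *: torsion nabla x u v)) SE.
  have cts := shift_characteristic hP hc ct uq.1 (S := fun x u v => - (2%:R^-1 *: torsion nabla x u v)) SE.
  have tfs : torsion_free nablas.
    move=> x u v; have [p Pp] := frame_at hP x; have up := Gstr_frame hP Pp.
    rewrite -(mulKVmx up u) -(mulKVmx up v) (char_torsion cts _ _ Pp).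
    move: (invmx p *m u) (invmx p *m v) => a b; rewrite TE -!scalemxAl.
    rewrite (alt_anti b a (Tmx_alternating n t)) scalerN opprK -scalerDl.
    have -> : - 2%:R^-1 + - 2%:R^-1 = -1 :> R by field.
    by rewrite scaleN1r subrr mulmx0.
  have nablaE x v Y : nabla x v Y = nablas x v Y + 2%:R^-1 *: torsion nabla x v (Y x).
    by rewrite /nablas /symmetrized /add_tensor subrK.
  split=> //; first by do 3 eexists; exact: cts.
  move=> T0s R0s I0s cts'.
  have [_ [qs uqs] [ks uks]] := characteristic_params hn hP cts'.
  exists t, q, qs, k, ks; split=> //.
    exact: (torsion_free_family hn hP hcs tfs cts' uqs.1 uks.1).
  have [_ [R0' [I0' [ct' qf' kf']]]] :=
    add_half_torsion hn hP hcs tfs cts' uqs.1 uks.1 TP.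
  (* Adding half of the torsion to the symmetrized connection restores nabla,
     whose characteristic tensors are unique. *)
  have nE : add_tensor nablas (fun x u v => 2%:R^-1 *: torsion nabla x u v) = nabla.
    apply/funext => x; apply/funext => v; apply/funext => Y.
    by rewrite nablaE.
  rewrite nE in ct'; have [_ RE IE] := char_unique hP ct ct'.
  split.
    by apply: uq.2 => u; rewrite IE qf'.
  apply: kf'; have [eB kE] := uk.1; split=> // X Y; have := kE X Y.
  by rewrite -!RE.
move=> nablas hcs tfs T0s R0s I0s cts qs ks qf kf t T0 altT tf nabla.
have TE := sym_frame T0 t altT tf.
(* As T0 is invariant under G, the tensor may be computed in any frame of P. *)
have TP x p u v : P x p -> tensor_of P T0 x (p *m u) (p *m v) = p *m (Tmx t u *m v).
  move=> Pp; rewrite /tensor_of.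
  have Pp' : P x (xget 1%:M (P x)) by apply: xgetPex; exists p.
  move: (xget _ _) Pp' => p' Pp'.
  have [h Gh ph] := (Gstr_orbit hP p Pp').1 Pp.
  have up' := Gstr_frame hP Pp'.
  by rewrite ph -!mulmxA !(mulKmx up') TE Tmx_Un.
have [hc [R0 [I0 [ct qf' kf']]]] := add_half_torsion hn hP hcs tfs cts qf kf TP.
rewrite -/nabla in hc ct.
have T0E : (fun u v => Tmx t u *m v) = T0.
  by apply/funext => u; apply/funext => v; rewrite TE.
split=> //.
- move=> x v Y sY; rewrite /symmetrized /add_tensor.
  have [p Pp] := frame_at hP x; have up := Gstr_frame hP Pp.
  have -> : nabla x v Y = nablas x v Y + 2%:R^-1 *: tensor_of P T0 x v (Y x) by [].
  have -> : tensor_of P T0 x v (Y x) = torsion nabla x v (Y x).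
    rewrite -(mulKVmx up v) -(mulKVmx up (Y x)) (char_torsion ct _ _ Pp).
    exact: TP.
  by rewrite addrK.
- exact: (torsion_free_family hn hP hcs tfs cts qf kf).
have [_ _ [k uk]] := characteristic_params hn hP ct.
exists R0, I0, k; split=> //; first by rewrite T0E in ct.
  exact: uk.1.
exact: kf' uk.1.
Qed.
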